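(* Let $n\ge1$ be an integer and $s\in(0,1)$. The embedding $H^{s+\mathrm{Log}}(\mathbb{R}^n)\hookrightarrow\mathcal{H}^{s+\mathrm{Log}}(\mathbb{R}^n)$ is continuous. In general the reverse inclusion fails, hence the embedding is typically strict. Moreover, $$\mathcal{H}^{s+\mathrm{Log}}(\mathbb{R}^n)=\Bigl\{u\in L^2(\mathbb{R}^n):\int_{\mathbb{R}^n}|\xi|^{2s}\ln(|\xi|^2)\,|\widehat u(\xi)|^2\,d\xi<\infty\Bigr\}.$$
   Context: Functions are real-valued; $\widehat u(\xi)=(2\pi)^{-n/2}\int_{\mathbb{R}^n}e^{-i\xi\cdot x}u(x)\,dx$ denotes the Fourier transform. Spectral space: with $E$ the spectral resolution of the nonnegative self-adjoint operator $-\Delta$ on $L^2(\mathbb{R}^n)$ and $E_{u,u}(B)=\langle E(B)u,u\rangle_{L^2}$ for Borel sets $B\subset[0,\infty)$, $H^{s+\mathrm{Log}}(\mathbb{R}^n):=\{u\in L^2(\mathbb{R}^n):\int_{(0,\infty)}\lambda^s\ln^2\lambda\,dE_{u,u}(\lambda)<\infty\}$, equivalently $\{u\in L^2(\mathbb{R}^n):\int_{\mathbb{R}^n}|\xi|^{2s}\ln^2(|\xi|^2)|\widehat u(\xi)|^2\,d\xi<\infty\}$, with the norm $\bigl(\|u\|_{L^2}^2+\int_{(0,\infty)}\lambda^s\ln^2\lambda\,dE_{u,u}(\lambda)\bigr)^{1/2}$. Energy space: with $a_+:=\max\{0,a\}$, $c_{n,s}=2^{2s}\pi^{-n/2}s\frac{\Gamma((n+2s)/2)}{\Gamma(1-s)}$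 and $\mathbf{k}_{s+\mathrm{Log},+}(z):=c_{n,s}|z|^{-n-2s}(-\ln|z|)_+$ for $z\in\mathbb{R}^n\setminus\{0\}$, put $[u]_{s+\mathrm{Log},+}^2:=\iint_{\mathbb{R}^n\times\mathbb{R}^n}(u(x)-u(y))^2\,\mathbf{k}_{s+\mathrm{Log},+}(x-y)\,dx\,dy$; then $\mathcal{H}^{s+\mathrm{Log}}(\mathbb{R}^n):=\{u\in L^2(\mathbb{R}^n):[u]_{s+\mathrm{Log},+}<\infty\}$ with norm $\|u\|_{\mathcal{H}^{s+\mathrm{Log}}}^2:=\|u\|_{L^2}^2+[u]_{s+\mathrm{Log},+}^2$. *)

(* Defs.v *)
From HB Require Import structures.
From mathcomp Require Import all_boot all_order all_algebra.
From mathcomp Require Import all_classical all_reals all_analysis.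
From mathcomp Require Import measurable_realfun complex.
Set Implicit Arguments.
Unset Strict Implicit.
Unset Printing Implicit Defensive.
Import Order.TTheory GRing.Theory Num.Theory.
Import numFieldNormedType.Exports.
Local Open Scope classical_set_scope.
Local Open Scope ring_scope.

(* R^n is n.-tuple R with the product sigma-algebra.  Its Lebesgue measure is
   the n-fold product of the one-dimensional one, transported along
   R * R^m -> R^m.+1. *)
Section lebesgue_measure_tuple.
Context {R : realType}.

Definition tuple_of_pair n (p : R * n.-tuple R) : n.+1.-tuple R :=
  [tuple of p.1 :: p.2].

Fixpoint lebesgue_tuple n : set (n.-tuple R) -> \bar R :=
  match n with
  | 0 => \d_([tuple] : 0.-tuple R)
  | m.+1 => pushforward (@lebesgue_measure R \x @lebesgue_tuple m)%E
              (@tuple_of_pair m)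
  end.

Let measurable_tuple_of_pair n :
  measurable_fun [set: R * n.-tuple R] (@tuple_of_pair n).
Proof. by apply: measurable_cons; [exact: measurable_fst|exact: measurable_snd]. Qed.

Let measurable_pair_of_tuple n :
  measurable_fun [set: n.+1.-tuple R]
    (fun x => (thead x, [tuple of behead x] : n.-tuple R)).
Proof.
by apply: measurable_fun_pair;
  [exact: measurable_tnth|exact: measurable_behead].
Qed.

Let lebesgue_tuple_packed n :
  exists mu : {sigma_finite_measure set (n.-tuple R) -> \bar R},
    (mu : set _ -> _) = @lebesgue_tuple n.
Proof.
elim: n => [|n [mu mun]]; first by exists (\d_([tuple] : 0.-tuple R)).
pose leb1 : {sigma_finite_measure set (measurableTypeR R) -> \bar R} :=
  @lebesgue_measure R.
pose nu : {measure set (measurableTypeR R * n.-tuple R)%type -> \bar R} :=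
  (leb1 \x mu)%E.
pose pm : {measure set (n.+1.-tuple R) -> \bar R} :=
  measure_function_pushforward__canonical__measure_function_Measure nu
    (@measurable_tuple_of_pair n).
have pS : sigma_finite setT pm.
  have /sigma_finiteP[F [FT ndF Foo]] := sigma_finiteT leb1.
  have /sigma_finiteP[G [GT ndG Goo]] := sigma_finiteT mu.
  pose g (x : n.+1.-tuple R) := (thead x, [tuple of behead x] : n.-tuple R).
  exists (fun i => g @^-1` (F i `*` G i)).
    rewrite -preimage_bigcup; apply/esym; rewrite -subTset => x _.
    have [i _ Fi] : (\bigcup_i F i) (thead x) by rewrite -FT.
    have [j _ Gj] : (\bigcup_i G i) [tuple of behead x] by rewrite -GT.
    exists (maxn i j) => //; split => /=.
      by move: Fi; exact/subsetPset/ndF/leq_maxl.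
    by move: Gj; exact/subsetPset/ndG/leq_maxr.
  move=> i; have [mF Fi] := Foo i; have [mG Gi] := Goo i; split.
    rewrite -[X in measurable X]setTI.
    by apply: measurable_pair_of_tuple => //; exact: measurableX.
  rewrite /pm/= /pushforward -comp_preimage.
  rewrite (_ : g \o _ = id); last first.
    rewrite funeqE => -[a t] /=; rewrite /g /= theadE.
    by congr pair; exact: val_inj.
  by rewrite preimage_id product_measure1E// lte_mul_pinfty// ge0_fin_numE.
pose pmS := Measure_isSigmaFinite.Build _ _ _ pm pS.
pose ps : {sigma_finite_measure set (n.+1.-tuple R) -> \bar R} :=
  HB.pack (pm : set _ -> _) (Measure.class pm) pmS.
by exists ps; rewrite /= -mun.
Qed.

Let lebesgue_tuple0 n : @lebesgue_tuple n set0 = 0%E.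
Proof. by have [mu <-] := lebesgue_tuple_packed n; exact: measure0. Qed.

Let lebesgue_tuple_ge0 n A : (0 <= @lebesgue_tuple n A)%E.
Proof. by have [mu <-] := lebesgue_tuple_packed n; exact: measure_ge0. Qed.

Let lebesgue_tuple_sigma_additive n : semi_sigma_additive (@lebesgue_tuple n).
Proof.
by have [mu <-] := lebesgue_tuple_packed n; exact: measure_semi_sigma_additive.
Qed.

HB.instance Definition _ n := isMeasure.Build _ _ _ (@lebesgue_tuple n)
  (@lebesgue_tuple0 n) (@lebesgue_tuple_ge0 n)
  (@lebesgue_tuple_sigma_additive n).

Let sigma_finite_lebesgue_tuple n : sigma_finite setT (@lebesgue_tuple n).
Proof. by have [mu <-] := lebesgue_tuple_packed n; exact: sigma_finiteT. Qed.

HB.instance Definition _ n := Measure_isSigmaFinite.Build _ _ _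
  (@lebesgue_tuple n) (@sigma_finite_lebesgue_tuple n).

End lebesgue_measure_tuple.
Arguments lebesgue_tuple {R} n.

Section euclidean.
Context {R : realType} {n : nat}.
Implicit Types x y : n.-tuple R.

Definition dotp x y : R := \sum_(i < n) tnth x i * tnth y i.
Definition enorm x : R := Num.sqrt (dotp x x).
Definition subt x y : n.-tuple R := [tuple tnth x i - tnth y i | i < n].

End euclidean.

Section fourier.
Context {R : realType} {n : nat}.
Local Notation leb := (@lebesgue_tuple R n).
Local Notation Rn := (n.-tuple R).

Definition expi (t : R) : R[i] := (cos t +i* sin t)%C.

Definition cintegral (f : Rn -> R[i]) : R[i] :=
  ((\int[leb]_x complex.Re (f x)) +i* (\int[leb]_x complex.Im (f x)))%C.

(* Meaningful for integrable u only. *)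
Definition fourier_int (u : Rn -> R) (xi : Rn) : R[i] :=
  (((2 * pi) `^ (- (n%:R / 2)))%:C *
    cintegral (fun x => expi (- dotp xi x) * (u x)%:C))%C.

Definition ball0 (k : nat) : set Rn := [set x | enorm x <= k%:R].

(* v represents the L^2 (Plancherel) Fourier transform of u: it is the L^2
   limit of the transforms of the truncations of u to the balls of radius k. *)
Definition is_fourier (u : Rn -> R) (v : Rn -> R[i]) : Prop :=
  [/\ (fun xi => complex.Re (v xi)) \in Lfun leb 2%:E,
      (fun xi => complex.Im (v xi)) \in Lfun leb 2%:E &
      (\int[leb]_xi
         (Normc.normc (fourier_int (fun x => u x * \1_(ball0 k) x) xi - v xi)
            ^+ 2)%:E)%E @[k --> \oo] --> 0%E].

(* A chosen representative of the class of \hat u, which is unique up to a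
   null set; the default value is irrelevant for u in L^2. *)
Definition fourier (u : Rn -> R) : Rn -> R[i] :=
  xget (cst 0) [set v | is_fourier u v].

End fourier.

Section spaces.
Context {R : realType} (n : nat).
Local Notation leb := (@lebesgue_tuple R n).
Local Notation Rn := (n.-tuple R).

Definition L2 : set (Rn -> R) := [set u | u \in Lfun leb 2%:E].

Definition L2norm (u : Rn -> R) : \bar R := ('N[leb]_2%:E [EFin \o u])%E.

(* The spectral resolution E of - Delta is the multiplication by
   1_B(|xi|^2) on the Fourier side, so that by Plancherel
   <E(B)u, u> is the mass that |\hat u|^2 gives to {|xi|^2 \in B}. *)
Definition spectral_measure (u : Rn -> R) (B : set R) : \bar R :=
  (\int[leb]_(xi in [set xi : Rn | B (enorm xi ^+ 2)%R])
     (Normc.normc (fourier u xi) ^+ 2)%:E)%E.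

Let measurable_fourier (u : Rn -> R) :
  measurable_fun setT (fun xi => complex.Re (fourier u xi)) /\
  measurable_fun setT (fun xi => complex.Im (fourier u xi)).
Proof.
rewrite /fourier; case: xgetP => [v _ [Rev Imv _]|_].
  by split; [move: Rev|move: Imv] => /sub_Lfun_mfun; rewrite inE.
by split; exact: measurable_cst.
Qed.

Let measurable_fourier_normc2 (u : Rn -> R) :
  measurable_fun setT (fun xi => (Normc.normc (fourier u xi) ^+ 2)%:E).
Proof.
have [mRe mIm] := measurable_fourier u.
rewrite (_ : (fun _ => _) = (fun xi => (complex.Re (fourier u xi) ^+ 2
    + complex.Im (fourier u xi) ^+ 2)%:E)).
  by apply/measurable_EFinP; apply: measurable_funD; apply: measurable_funX.
apply/funext => xi; congr EFin; case: (fourier u xi) => a b /=.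
by rewrite sqr_sqrtr// addr_ge0// sqr_ge0.
Qed.

Let measurable_enorm2 : measurable_fun [set: Rn] (fun x : Rn => enorm x ^+ 2).
Proof.
rewrite (_ : (fun _ => _) = (fun x => \sum_(i < n) tnth x i ^+ 2)).
  apply: measurable_sum => i; apply: measurable_funX.
  exact: (@measurable_tnth _ R).
apply/funext => x; rewrite sqr_sqrtr//; last first.
  by apply: sumr_ge0 => i _; rewrite -expr2 sqr_ge0.
Qed.

Let spectral_measure0 u : spectral_measure u set0 = 0%E.
Proof. exact: integral_set0. Qed.

Let spectral_measure_ge0 u B : (0 <= spectral_measure u B)%E.
Proof. by apply: integral_ge0 => x _; rewrite lee_fin sqr_ge0. Qed.

Let spectral_measure_sigma_additive u :
  semi_sigma_additive (spectral_measure u).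
Proof.
move=> F mF tF mUF.
pose h (x : Rn) : R := enorm x ^+ 2.
rewrite /spectral_measure.
rewrite (_ : [set xi : Rn | _] = \bigcup_k (h @^-1` F k)); last first.
  by rewrite -preimage_bigcup.
apply: cvg_toP.
  apply: ereal_nondecreasing_is_cvgn => k m km.
  by apply: lee_sum_nneg_natr => // i _ _; exact: spectral_measure_ge0.
rewrite ge0_integral_bigcup//=.
- by move=> k; rewrite -[X in measurable X]setTI; exact: measurable_enorm2.
- by apply: measurable_funTS; exact: measurable_fourier_normc2.
- by move=> x _; rewrite lee_fin sqr_ge0.
- apply/trivIsetP => /= i j _ _ ij; rewrite -preimage_setI.
  by move/trivIsetP : tF => /(_ _ _ _ _ ij) ->//; rewrite preimage_set0.
Qed.

HB.instance Definition _ u := isMeasure.Build _ _ _ (spectral_measure u)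
  (spectral_measure0 u) (@spectral_measure_ge0 u)
  (@spectral_measure_sigma_additive u).

Definition spectral_form (s : R) (u : Rn -> R) : \bar R :=
  (\int[spectral_measure u]_(l in `]0%R, +oo[) (l `^ s * ln l ^+ 2)%:E)%E.

Definition spectral_space (s : R) : set (Rn -> R) :=
  [set u | L2 u /\ (spectral_form s u < +oo)%E].

Definition spectral_norm (s : R) (u : Rn -> R) : \bar R :=
  sqrte (L2norm u ^+ 2 + spectral_form s u)%E.

Definition Gamma (z : R) : R :=
  \int[@lebesgue_measure R]_(t in `]0, +oo[) (t `^ (z - 1) * expR (- t)).

Definition c_ns (s : R) : R :=
  2 `^ (2 * s) * pi `^ (- (n%:R / 2)) * s
    * (Gamma ((n%:R + 2 * s) / 2) / Gamma (1 - s)).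

(* The value at z = 0 is irrelevant: it is multiplied by 0 in energy_form. *)
Definition kernel_plus (s : R) (z : Rn) : R :=
  c_ns s * enorm z `^ (- n%:R - 2 * s) * Num.max 0 (- ln (enorm z)).

Definition energy_form (s : R) (u : Rn -> R) : \bar R :=
  (\int[leb \x leb]_p
     ((u p.1 - u p.2) ^+ 2 * kernel_plus s (subt p.1 p.2))%:E)%E.

Definition energy_space (s : R) : set (Rn -> R) :=
  [set u | L2 u /\ (energy_form s u < +oo)%E].

Definition energy_norm (s : R) (u : Rn -> R) : \bar R :=
  sqrte (L2norm u ^+ 2 + energy_form s u)%E.

End spaces.
Arguments L2 {R} n _.
Arguments spectral_space {R} n s _.
Arguments energy_space {R} n s _.

Definition continuous_embedding (R : realType) (T : Type)
    (X : set T) (normX : T -> \bar R) (Y : set T) (normY : T -> \bar R) :=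
  X `<=` Y /\
  exists C : R, 0 <= C /\ forall u, X u -> (normY u <= C%:E * normX u)%E.

(* Main.v *)
Require Import Defs.
From HB Require Import structures.
From mathcomp Require Import all_boot all_order all_algebra.
From mathcomp Require Import all_classical all_reals all_analysis.
From mathcomp Require Import measurable_realfun complex ring lra.
Set Implicit Arguments.
Unset Strict Implicit.
Unset Printing Implicit Defensive.
Import Order.TTheory GRing.Theory Num.Theory.
Import numFieldNormedType.Exports.
Local Open Scope classical_set_scope.
Local Open Scope ring_scope.

(* Proof idea.  Let v be the Plancherel transform of u.  By Plancherel,
   |u(. + z) - u|_2^2 = int 2 (1 - cos (z . xi)) |v(xi)|^2 dxi, so Tonelli turns
   the energy form into int m(xi) |v(xi)|^2 dxi with the symbol
   m(xi) = int k_+(z) 2 (1 - cos (z . xi)) dz.  The substitution z = w / |xi|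
   gives m(xi) <= K (1 + |xi|^(2s) (ln |xi|)_+), and integrating over a box of
   size ~ 1/|xi| around xi / |xi|^2 gives the matching lower bound for
   |xi| >= 2.  This yields the description of the energy space and the
   embedding, since the spectral form has weight |xi|^(2s) ln^2 |xi|^2.  The
   two spaces are separated by the lacunary sum
   sum_k b_k e^(-|x_1| - ... - |x_n|) cos (N_k x_1) with ln N_k = 2 * 16^k
   and b_k N_k^s = 8^-k, whose transform is a nonnegative sum of bumps at
   the frequencies +- N_k e_1.

   Plancherel itself is derived from the explicit transform of
   e^(-|x_1| - ... - |x_n|), used as an approximate identity. *)

(** * Lebesgue measure on tuples *)

(** The transform is only determined up to a null set, as an L2 limit of transforms of truncations.
    Facts about it are therefore stated as integrals of a weight against |v|^2. The separating
    example needs pointwise bounds on its transform, so for integrable u such integrals are shown to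
    agree with those of the explicit transform.

    The exponential profile keeps Plancherel elementary: it is a product over the coordinates, its
    transform comes from an explicit antiderivative, and that transform, a product of factors 2 / (1
    + t^2), is nonnegative, bounded and integrable. No inversion formula enters: weighting the
    squared transform by the dilated profile gives a double integral of f(x) f(y) Q(x - y), and 2ab
    = a^2 + b^2 - (a - b)^2 reduces its limit to the L2-continuity of translations.

    In the description of the energy space the weight is negative for |xi| < 1; since r^(2s) |ln r|
    is bounded there, only the positive part matters.

    In the example b_k^2 N_k^(2s) = 64^-k. One logarithm, of size 16^k, leaves a summable series;
    two of them, of size 256^k, leave an unbounded one. *)

Section affine_line.
Context {R : realType}.
Local Notation leb1 := (@lebesgue_measure R).

Lemma measurable_affine1 (a b : R) :
  measurable_fun [set: measurableTypeR R] (fun x : R => a * x + b : measurableTypeR R).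
Proof. by apply: measurable_funD => //; exact: mulrl_measurable. Qed.

(** Both sides are measures in [A] that agree on half-open intervals, and these determine Lebesgue
    measure. *)
Lemma lebesgue_measure_affine (a b : R) (A : set (measurableTypeR R)) :
  0 < a -> measurable A ->
  lebesgue_measure A =
    (a%:E * pushforward leb1 (fun x => (a * x + b)%R : measurableTypeR R) A)%E.
Proof.
move=> a0 mA.
have mphi := measurable_affine1 a b.
pose nu : {measure set (measurableTypeR R) -> \bar R} :=
  measure_function_pushforward__canonical__measure_function_Measure leb1 mphi.
pose a' : {nonneg R} := NngNum (ltW a0).
rewrite -[RHS]/(mscale a' nu A).
apply: lebesgue_measure_unique => //= X [[x y] _ <-].
rewrite /mscale/= /pushforward.
rewrite (_ : _ @^-1` _ = `](x - b) / a, (y - b) / a]%classic); last first.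
  apply/seteqP; split => z /=; rewrite !in_itv/= ltr_pdivrMr// ler_pdivlMr//;
    by rewrite ltrBlDr lerBrDr (mulrC z).
rewrite !lebesgue_measure_itv/= !lte_fin ltr_pM2r ?invr_gt0// ltrD2r.
case: ifPn => _; last by rewrite mule0.
by rewrite -!EFinD -EFinM; congr EFin; field; rewrite gt_eqF.
Qed.

Lemma ge0_integral_affine (a b : R) (f : R -> \bar R) : 0 < a ->
  measurable_fun setT f -> (forall x, 0 <= f x)%E ->
  (\int[leb1]_x f (a * x + b)%R = (a^-1)%:E * \int[leb1]_x f x)%E.
Proof.
move=> a0 mf f0.
have mphi := measurable_affine1 a b.
pose nu : {measure set (measurableTypeR R) -> \bar R} :=
  measure_function_pushforward__canonical__measure_function_Measure leb1 mphi.
pose a' : {nonneg R} := NngNum (ltW a0).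
rewrite [in RHS](@eq_measure_integral _ _ _ setT (mscale a' nu) leb1 f); last first.
  by move=> A mA _; rewrite [LHS](lebesgue_measure_affine b a0 mA).
rewrite ge0_integral_mscale//=.
have nuE : (\int[nu]_x f x = \int[leb1]_x f (a * x + b)%R)%E.
  transitivity (\int[pushforward leb1 (fun x => (a * x + b)%R : measurableTypeR R)]_x f x)%E.
    by [].
  exact: (ge0_integral_pushforward mphi leb1 measurableT mf (fun y _ => f0 y)).
by rewrite nuE muleA -EFinM mulVf ?gt_eqF// mul1e.
Qed.

End affine_line.

(** * Changes of variables and product functions on tuples *)

Section tuple_calculus.
Context {R : realType}.
Local Notation leb1 := (@lebesgue_measure R).
Local Notation leb n := (@lebesgue_tuple R n).

Definition affine n (a : R) (h x : n.-tuple R) : n.-tuple R :=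
  [tuple a * tnth x i + tnth h i | i < n].

Definition addt n (x h : n.-tuple R) : n.-tuple R :=
  [tuple tnth x i + tnth h i | i < n].

Definition scalet n (a : R) (x : n.-tuple R) : n.-tuple R :=
  [tuple a * tnth x i | i < n].

Lemma measurable_tuple_of_pair n :
  measurable_fun [set: measurableTypeR R * n.-tuple R] (@tuple_of_pair R n).
Proof. by apply: measurable_cons; [exact: measurable_fst|exact: measurable_snd]. Qed.

Lemma tnth_tuple_of_pair0 n (p : R * n.-tuple R) :
  tnth (tuple_of_pair p) ord0 = p.1.
Proof. by rewrite (tnth_nth 0). Qed.

Lemma tnth_tuple_of_pairS n (p : R * n.-tuple R) i :
  tnth (tuple_of_pair p) (lift ord0 i) = tnth p.2 i.
Proof. by rewrite !(tnth_nth 0). Qed.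

Lemma eq_tupleP n (x y : n.-tuple R) : (forall i, tnth x i = tnth y i) -> x = y.
Proof. by move=> xy; apply: eq_from_tnth. Qed.

Lemma tuple_of_pairK n (x : n.+1.-tuple R) :
  tuple_of_pair (thead x, [tuple of behead x]) = x.
Proof. by rewrite /tuple_of_pair/= -tuple_eta. Qed.

Lemma affine_tuple_of_pair n a (h : n.+1.-tuple R) (p : R * n.-tuple R) :
  affine a h (tuple_of_pair p) =
  tuple_of_pair (a * p.1 + thead h, affine a [tuple of behead h] p.2).
Proof.
apply: eq_tupleP => i; rewrite tnth_mktuple.
case: (unliftP ord0 i) => [j|] ->.
  by rewrite !tnth_tuple_of_pairS/= tnth_mktuple tnth_behead; congr (_ + tnth _ _);
    apply: val_inj => /=; rewrite inordK// ltnS ltn_ord.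
by rewrite !tnth_tuple_of_pair0.
Qed.

Lemma measurable_affine n a (h : n.-tuple R) :
  measurable_fun setT (affine a h).
Proof.
apply/measurable_fun_tnthP => i.
rewrite (_ : _ \o _ = (fun x : n.-tuple R => a * tnth x i + tnth h i)).
  apply: measurable_funD => //; apply: measurable_funM => //.
  exact: measurable_tnth.
by apply/funext => x /=; rewrite tnth_mktuple.
Qed.

Lemma measurable_tuple_section n (f : n.+1.-tuple R -> \bar R) :
  measurable_fun setT f ->
  measurable_fun [set: measurableTypeR R * n.-tuple R] (f \o @tuple_of_pair R n).
Proof. by move=> mf; apply: measurableT_comp => //; exact: measurable_tuple_of_pair. Qed.

Lemma measurable_tuple_section1 n (f : n.+1.-tuple R -> \bar R) x :
  measurable_fun setT f -> measurable_fun setT (fun t => f (tuple_of_pair (x, t))).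
Proof. by move=> mf; exact: (measurable_fun_pair2 x (measurable_tuple_section mf)). Qed.

Lemma ge0_integral_tuple_prod n (f : n.+1.-tuple R -> \bar R) :
  measurable_fun setT f -> (forall x, 0 <= f x)%E ->
  (\int[leb n.+1]_x f x = \int[leb1 \x leb n]_p f (tuple_of_pair p))%E.
Proof.
move=> mf f0.
transitivity (\int[pushforward (leb1 \x leb n) (@tuple_of_pair R n)]_y f y)%E.
  by [].
by rewrite (ge0_integral_pushforward (@measurable_tuple_of_pair n))// preimage_setT.
Qed.

Lemma ge0_integral_tupleS n (f : n.+1.-tuple R -> \bar R) :
  measurable_fun setT f -> (forall x, 0 <= f x)%E ->
  (\int[leb n.+1]_x f x =
    \int[leb1]_x \int[leb n]_t f (tuple_of_pair (x, t)))%E.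
Proof.
move=> mf f0; rewrite ge0_integral_tuple_prod// fubini_tonelli1//.
exact: (measurable_tuple_section mf).
Qed.

Lemma integral_tuple0 (f : 0.-tuple R -> \bar R) : measurable_fun setT f ->
  (\int[leb 0]_x f x = f [tuple])%E.
Proof. by move=> mf; rewrite integral_dirac// diracT mul1e. Qed.

(** Induction on the dimension: Tonelli splits off the first coordinate, and each coordinate
    contributes one factor [a^-1]. Translations and dilations are the two special cases used
    later. *)
Lemma ge0_integral_tuple_affine n (a : R) (h : n.-tuple R)
    (f : n.-tuple R -> \bar R) : 0 < a ->
  measurable_fun setT f -> (forall x, 0 <= f x)%E ->
  (\int[leb n]_x f (affine a h x) = (a^-1 ^+ n)%:E * \int[leb n]_x f x)%E.
Proof.
move=> a0; elim: n h f => [|n IH] h f mf f0.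
  rewrite !integral_tuple0//; last exact: measurableT_comp mf (measurable_affine a h).
  by rewrite expr0 mul1e; congr f; apply: eq_tupleP; case.
rewrite ge0_integral_tupleS//; last exact: measurableT_comp mf (measurable_affine a h).
under eq_integral => x _.
  under eq_integral do rewrite affine_tuple_of_pair/=.
  rewrite (IH _ (fun t => f (tuple_of_pair (a * x + thead h, t))))//; last first.
    exact: measurable_tuple_section1.
  over.
have mF : measurable_fun setT (fun x => \int[leb n]_t f (tuple_of_pair (x, t)))%E.
  apply: (@measurable_fun_fubini_tonelli_F _ _ (measurableTypeR R) (n.-tuple R) R
    (leb n) (f \o @tuple_of_pair R n)).
    exact: (measurable_tuple_section mf).
  by move=> x; exact: f0.
have F0 x : (0 <= \int[leb n]_t f (tuple_of_pair (x, t)))%E by exact: integral_ge0.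
rewrite ge0_integralZl//; last 2 first.
  exact: (measurableT_comp mF (measurable_affine1 a (thead h))).
  by rewrite lee_fin exprn_ge0// invr_ge0 ltW.
rewrite (ge0_integral_affine (thead h) (f := fun x => \int[leb n]_t f (tuple_of_pair (x, t)))%E)//.
by rewrite muleA -EFinM -exprSr (ge0_integral_tupleS mf f0).
Qed.

Lemma ge0_integral_translate n (h : n.-tuple R) (f : n.-tuple R -> \bar R) :
  measurable_fun setT f -> (forall x, 0 <= f x)%E ->
  (\int[leb n]_x f (addt x h) = \int[leb n]_x f x)%E.
Proof.
move=> mf f0; have := ge0_integral_tuple_affine h ltr01 mf f0.
rewrite invr1 expr1n mul1e => <-; apply: eq_integral => x _; congr f.
by apply: eq_tupleP => i; rewrite !tnth_mktuple mul1r.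
Qed.

Lemma ge0_integral_scale n (a : R) (f : n.-tuple R -> \bar R) : 0 < a ->
  measurable_fun setT f -> (forall x, 0 <= f x)%E ->
  (\int[leb n]_x f (scalet a x) = (a^-1 ^+ n)%:E * \int[leb n]_x f x)%E.
Proof.
move=> a0 mf f0; rewrite -(ge0_integral_tuple_affine [tuple 0 | i < n] a0 mf f0).
apply: eq_integral => x _; congr f.
by apply: eq_tupleP => i; rewrite !tnth_mktuple addr0.
Qed.

Definition prodt n (g : R -> R) (x : n.-tuple R) : R := \prod_(i < n) g (tnth x i).

Lemma prodt_tuple_of_pair n g (p : R * n.-tuple R) :
  prodt g (tuple_of_pair p) = g p.1 * prodt g p.2.
Proof.
rewrite /prodt big_ord_recl tnth_tuple_of_pair0; congr (_ * _).
by apply: eq_bigr => i _; rewrite tnth_tuple_of_pairS.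
Qed.

Lemma prodt_ge0 n g (x : n.-tuple R) : (forall t, 0 <= g t) -> 0 <= prodt g x.
Proof. by move=> g0; apply: prodr_ge0. Qed.

Lemma measurable_prodt n g : measurable_fun setT g -> measurable_fun setT (@prodt n g).
Proof.
move=> mg; rewrite /prodt; apply: measurable_prod => i _.
by apply: measurableT_comp => //; exact: measurable_tnth.
Qed.

Lemma ge0_integral_prodt n (g : R -> R) : measurable_fun setT g -> (forall t, 0 <= g t) ->
  (\int[leb n]_x (prodt g x)%:E = (\int[leb1]_x (g x)%:E) ^+ n)%E.
Proof.
move=> mg g0; elim: n => [|n IH].
  rewrite integral_tuple0; first by rewrite /prodt big_ord0.
  by apply/measurable_EFinP; exact: measurable_prodt.
rewrite ge0_integral_tupleS//; last 2 first.
- by apply/measurable_EFinP; exact: measurable_prodt.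
- by move=> x; rewrite lee_fin prodt_ge0.
under eq_integral => x _.
  under eq_integral do rewrite prodt_tuple_of_pair EFinM /=.
  rewrite ge0_integralZl_EFin//=; [|by move=> t _; rewrite lee_fin prodt_ge0|
    by apply/measurable_EFinP; exact: measurable_prodt].
  rewrite IH; over.
rewrite ge0_integralZr//.
- by rewrite expeS.
- exact/measurable_EFinP.
- by move=> x _; rewrite lee_fin.
- by apply: expe_ge0; apply: integral_ge0 => x _; rewrite lee_fin.
Qed.

Lemma dotp_tuple_of_pair n (p q : R * n.-tuple R) :
  dotp (tuple_of_pair p) (tuple_of_pair q) = p.1 * q.1 + dotp p.2 q.2.
Proof.
rewrite /dotp big_ord_recl !tnth_tuple_of_pair0; congr (_ + _).
by apply: eq_bigr => i _; rewrite !tnth_tuple_of_pairS.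
Qed.

End tuple_calculus.

(** * Continuity of translations in L2 *)

Section cvg_ge0.
Context {R : realType}.
Local Open Scope ereal_scope.

Lemma ge0_cvge0P (u : (\bar R)^nat) : (forall k, 0 <= u k) ->
  u @ \oo --> 0 <-> forall e : R, (0 < e)%R -> \forall k \near \oo, u k <= e%:E.
Proof.
move=> u0; split=> [/fine_cvgP[ufin /cvgr0Pnorm_le cu] e e0|H].
  near=> k; have kfin : u k \is a fin_num by near: k.
  rewrite -(fineK kfin) lee_fin.
  have : (`|(fine \o u) k| <= e)%R by near: k; exact: cu.
  by rewrite /= ger0_norm// fine_ge0.
apply/fine_cvgP; split.
  near=> k; rewrite ge0_fin_numE//.
  apply: (@le_lt_trans _ _ 1%:E); last exact: ltry.
  by near: k; exact: H.
apply/cvgr0Pnorm_le => e e0; near=> k.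
have ke : u k <= e%:E by near: k; exact: H.
have kfin : u k \is a fin_num by rewrite ge0_fin_numE// (le_lt_trans ke)// ltry.
by rewrite /= ger0_norm ?fine_ge0// -lee_fin fineK.
Unshelve. all: by end_near. Qed.

Lemma ge0_squeeze_cvge0 (u v : (\bar R)^nat) : (forall k, 0 <= u k) ->
  (forall k, u k <= v k) -> v @ \oo --> 0 -> u @ \oo --> 0.
Proof.
move=> u0 uv v0; apply: (@squeeze_cvge _ _ _ _ (cst 0) _ v) => //.
- by apply: nearW => k; rewrite u0 uv.
- exact: cvg_cst.
Qed.

End cvg_ge0.

Section integral_helpers.
Context d (T : measurableType d) {R : realType} (mu : {measure set T -> \bar R}).
Local Open Scope ereal_scope.

Lemma ge0_le_integralT (f g : T -> \bar R) : measurable_fun setT f ->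
  measurable_fun setT g -> (forall x, 0 <= f x) -> (forall x, f x <= g x) ->
  \int[mu]_x f x <= \int[mu]_x g x.
Proof. by move=> mf mg f0 fg; apply: ge0_le_integral. Qed.

(** Pointwise convergence is asked only where the majorant is finite, which is almost everywhere.
    When [F k x] is itself an inner integral, this finiteness is what puts the section at [x] in
    L2. *)
Lemma ge0_dominated_cvg0 (F : nat -> T -> \bar R) (g : T -> \bar R) :
  (forall k, measurable_fun setT (F k)) -> measurable_fun setT g ->
  (forall k x, 0 <= F k x) -> (forall k x, F k x <= g x) ->
  \int[mu]_x g x < +oo ->
  (forall x, g x < +oo -> F k x @[k --> \oo] --> 0) ->
  \int[mu]_x F k x @[k --> \oo] --> 0.
Proof.
move=> mF mg F0 Fg goo Fx.
have g0 x : 0 <= g x by exact: le_trans (F0 0%N x) (Fg 0%N x).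
have ig : mu.-integrable setT g.
  apply/integrableP; split => //.
  by under eq_integral do rewrite gee0_abs//.
have fx : {ae mu, forall x, setT x -> F ^~ x @ \oo --> cst 0 x}.
  have := integrable_ae measurableT ig; apply: filterS => x /(_ I) gx _.
  by apply: Fx; rewrite ltey_eq gx.
have fg : {ae mu, forall x n, setT x -> `|F n x| <= g x}.
  by apply: aeW => x n _; rewrite gee0_abs.
have [_ _] := dominated_convergence measurableT mF (measurable_cst 0) fx ig fg.
by rewrite integral0.
Qed.

End integral_helpers.

Section square_integrals.
Context d (T : measurableType d) {R : realType} (mu : {measure set T -> \bar R}).

Lemma sqrrB_le2 (a b c : R) :
  (a - b) ^+ 2 <= 2 * (a - c) ^+ 2 + 2 * (c - b) ^+ 2.
(* The right side minus the left side is exactly (a + b - 2c)^2. *)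
Proof. have := sqr_ge0 (a + b - 2 * c); rewrite !expr2; nra. Qed.

Lemma measurable_sqr (f : T -> R) : measurable_fun setT f ->
  measurable_fun setT (fun x => (f x ^+ 2)%:E).
Proof. by move=> mf; apply/measurable_EFinP; exact: measurable_funX. Qed.

Lemma integral_sqr_ge0 (f : T -> R) : (0 <= \int[mu]_x (f x ^+ 2)%:E)%E.
Proof. by apply: integral_ge0 => x _; rewrite lee_fin sqr_ge0. Qed.

(** Serves as the triangle inequality of L2. Squared distances in [\bar R] call for neither roots
    nor finiteness conditions. *)
Lemma integral_sqrB_le2 (f g h : T -> R) : measurable_fun setT f ->
  measurable_fun setT g -> measurable_fun setT h ->
  (\int[mu]_x ((f x - g x) ^+ 2)%:E <=
   2%:E * \int[mu]_x ((f x - h x) ^+ 2)%:E +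
   2%:E * \int[mu]_x ((h x - g x) ^+ 2)%:E)%E.
Proof.
move=> mf mg mh.
have mB (p q : T -> R) : measurable_fun setT p -> measurable_fun setT q ->
    measurable_fun setT (fun x => ((p x - q x) ^+ 2)%:E).
  by move=> mp mq; apply: measurable_sqr; exact: measurable_funB.
rewrite -!ge0_integralZl_EFin//=; try exact: mB; try by move=> x _; rewrite lee_fin sqr_ge0.
rewrite -ge0_integralD//=; try (by apply: measurable_funeM; exact: mB);
  try by move=> x _; rewrite -EFinM lee_fin mulr_ge0// sqr_ge0.
apply: ge0_le_integralT; first exact: mB.
- by apply: emeasurable_funD; apply: measurable_funeM; exact: mB.
- by move=> x; rewrite lee_fin sqr_ge0.
- by move=> x; rewrite -!EFinM -EFinD lee_fin; exact: sqrrB_le2.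
Qed.

End square_integrals.

(** * L2 increments along measure-preserving maps *)

Section translation_continuity_abstract.
Context d (T : measurableType d) {R : realType} (mu : {measure set T -> \bar R}).
Variable S_ : nat -> T -> T.
Hypothesis mS : forall k, measurable_fun setT (S_ k).
Hypothesis presS : forall k (f : T -> \bar R), measurable_fun setT f ->
  (forall x, 0 <= f x)%E -> (\int[mu]_x f (S_ k x) = \int[mu]_x f x)%E.
Local Notation sq f := (\int[mu]_x (f x ^+ 2)%:E)%E.
Local Notation tau f k := (\int[mu]_x ((f (S_ k x) - f x) ^+ 2)%:E)%E.

Lemma measurable_compS k (f : T -> R) :
  measurable_fun setT f -> measurable_fun setT (fun x => f (S_ k x)).
Proof. by move=> mf; exact: (measurableT_comp mf (mS k)). Qed.

(** Going through 0 in [integral_sqrB_le2] gives 2 + 2 = 4, because the shifted function has the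
    same squared integral. *)
Lemma integral_increment_le4 (f : T -> R) k : measurable_fun setT f ->
  (tau f k <= 4%:E * sq f)%E.
Proof.
move=> mf.
have := integral_sqrB_le2 mu (measurable_compS k mf) mf (measurable_cst (0 : R)).
under [X in (_ <= 2%:E * X + _)%E -> _]eq_integral do rewrite /cst subr0.
under [X in (_ <= _ + 2%:E * X)%E -> _]eq_integral do rewrite /cst sub0r sqrrN.
rewrite (presS k (f := fun x => (f x ^+ 2)%:E))//.
- move/le_trans; apply; rewrite -ge0_muleDl//.
  by rewrite -EFinD; have -> : (2 + 2 = 4 :> R) by lra.
- exact: measurable_sqr.
- by move=> x; rewrite lee_fin sqr_ge0.
Qed.

(** The functions whose increments vanish in the limit are closed for the L2 distance, uniformly in
    [k] thanks to the factor 4 above; it then suffices to treat a dense class. *)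
Lemma integral_increment_closed (f : T -> R) : measurable_fun setT f ->
  (forall e : R, 0 < e -> exists g : T -> R, [/\ measurable_fun setT g,
    (\int[mu]_x ((f x - g x) ^+ 2)%:E <= e%:E)%E &
    tau g k @[k --> \oo] --> 0%E]) ->
  tau f k @[k --> \oo] --> 0%E.
Proof.
move=> mf H; apply/ge0_cvge0P => [k|e e0].
  by apply: integral_ge0 => x _; rewrite lee_fin sqr_ge0.
(* The increment of [f - g] is at most 4 (e / 16) = e / 4; together with e / 4 for [g] and the
   factors 2 this adds up to [e]. *)
have e20 : 0 < e / 16 by lra.
have [g [mg fg tg]] := H _ e20.
have tg0 k : (0 <= tau g k)%E by apply: integral_ge0 => x _; rewrite lee_fin sqr_ge0.
have e40 : 0 < e / 4 by lra.
have /(_ _ e40) := (ge0_cvge0P tg0).1 tg; apply: filterS => k tgk.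
have mfg : measurable_fun setT (fun x => f x - g x) by exact: measurable_funB.
have tfg := integral_increment_le4 k mfg.
have tfg' : (tau (fun x => (f x - g x)%R) k <= (e / 4)%:E)%E.
  apply: (le_trans tfg); apply: (@le_trans _ _ (4%:E * (e / 16)%:E)%E).
    by apply: lee_pmul => //; exact: integral_sqr_ge0.
  by rewrite -EFinM lee_fin; lra.
have m1 : measurable_fun setT (fun x => f (S_ k x) - f x).
  by apply: measurable_funB => //; exact: measurable_compS.
have m2 : measurable_fun setT (fun x => g (S_ k x) - g x).
  by apply: measurable_funB => //; exact: measurable_compS.
have := integral_sqrB_le2 mu m1 (measurable_cst (0 : R)) m2.
under eq_integral do rewrite /cst subr0.
move/le_trans; apply.
rewrite (_ : e%:E = 2%:E * (e / 4)%:E + 2%:E * (e / 4)%:E)%E; last first.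
  by rewrite -!EFinM -EFinD; congr EFin; lra.
apply: leeD; apply: lee_pmul => //; try exact: integral_sqr_ge0.
- rewrite (eq_integral (fun x =>
    ((f (S_ k x) - g (S_ k x) - (f x - g x)) ^+ 2)%:E))// => x _.
  by congr ((_ ^+ 2)%:E); ring.
- by under eq_integral do rewrite /cst subr0.
Qed.

End translation_continuity_abstract.

(** * Continuity of translations on the line *)

Section translation_continuity_line.
Context {R : realType}.
Local Notation leb1 := (@lebesgue_measure R).

Lemma lipschitz1_continuous (h : R -> R) :
  (forall a b, `|h a - h b| <= `|a - b|) -> continuous h.
Proof.
move=> H x; apply/cvgrPdist_le => e e0; near=> y.
apply: (le_trans (H _ _)).
by near: y; apply: cvgr_dist_le => //; exact: cvg_id.
Unshelve. all: by end_near. Qed.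

(** A 1-Lipschitz retraction onto [-M, M]. With [cutoff] it makes an L1-approximant bounded and
    compactly supported without moving it away from a function that is bounded by [M] and vanishes
    beyond [M]. *)
Definition clip (M y : R) : R := if y < - M then - M else if M < y then M else y.

Definition cutoff (M x : R) : R :=
  if `|x| <= M then 1 else if M + 1 <= `|x| then 0 else M + 1 - `|x|.

Lemma clip_lip M : 0 <= M -> forall a b, `|clip M a - clip M b| <= `|a - b|.
Proof.
move=> M0 a b; have := ler_norm (a - b); have := ler_norm (b - a).
rewrite (distrC b a) ler_norml /clip => ? ?; apply/andP.
by do 4 case: ltP => ?; split; lra.
Qed.

Lemma cutoff_lip M : forall a b, `|cutoff M a - cutoff M b| <= `|a - b|.
Proof.
move=> a b; have := ler_dist_dist a b; have := normr_ge0 (a - b).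
rewrite 2!ler_norml /cutoff.
move: `|a - b| `|a| `|b| => r p q r0 /andP[? ?]; apply/andP.
by case: (leP p M) => ?; case: (leP q M) => ?;
  case: (leP (M + 1) p) => ?; case: (leP (M + 1) q) => ?; split; lra.
Qed.

Lemma clip_bound M y : 0 <= M -> `|clip M y| <= M.
Proof. by move=> M0; rewrite ler_norml /clip; do 2 case: ltP => ?; apply/andP; split; lra. Qed.

Lemma cutoff_bound M x : 0 <= cutoff M x <= 1.
Proof. by rewrite /cutoff; case: (leP `|x| M) => ?; case: (leP (M + 1) `|x|) => ?; apply/andP; split; lra. Qed.

Lemma integral_translate1 h (f : R -> \bar R) :
  measurable_fun setT f -> (forall x, 0 <= f x)%E ->
  (\int[leb1]_x f (x + h)%R = \int[leb1]_x f x)%E.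
Proof.
move=> mf f0; have := ge0_integral_affine h ltr01 mf f0.
by rewrite invr1 mul1e => <-; apply: eq_integral => x _; rewrite mul1r.
Qed.

Lemma measurable_translate1 (h : R) :
  measurable_fun [set: measurableTypeR R] (fun x : R => x + h : measurableTypeR R).
Proof. by apply: measurable_funD. Qed.

(** The shifts run along a sequence because the convergence theorems are sequential and the
    Plancherel argument takes its limit along e = 1 / (k + 1). *)
Let S_ (h : R) (k : nat) (x : measurableTypeR R) : measurableTypeR R := (x + h / k.+1%:R)%R.

Lemma cvg_scaled_harmonic (h : R) : h / k.+1%:R @[k --> \oo] --> (0 : R).
Proof.
rewrite -[X in _ --> X](mulr0 h); apply: cvgM; first exact: cvg_cst.
exact: cvg_harmonic.
Qed.

Lemma scaled_harmonic_le (h : R) k : `|h / k.+1%:R| <= `|h|.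
Proof.
rewrite normrM ler_piMr// normfV invf_le1 ?normr_gt0 ?pnatr_eq0//.
by rewrite normr_nat ler1n.
Qed.

Lemma translation_continuity_continuous (G : R -> R) (M A h : R) : 0 <= M ->
  continuous G -> (forall x, `|G x| <= M) -> (forall x, A < `|x| -> G x = 0) ->
  (\int[leb1]_x ((G (x + h / k.+1%:R) - G x) ^+ 2)%:E)%E @[k --> \oo] --> 0%E.
Proof.
move=> M0 cG GM GA.
have mG : measurable_fun setT G by exact: continuous_measurable_fun.
(* All shifts have length at most |h|, so every increment vanishes outside this interval, and (2M)^2
   on it is an integrable majorant. *)
pose I := `[- (A + `|h|), A + `|h|]%classic : set (measurableTypeR R).
have mI : measurable_fun [set: measurableTypeR R] (\1_I : _ -> R).
  by apply: measurable_indic; exact: measurable_itv.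
apply: (@ge0_dominated_cvg0 _ _ _ leb1
  (fun k x => ((G (x + h / k.+1%:R) - G x) ^+ 2)%:E)
  (fun x => ((2 * M) ^+ 2 * \1_I x)%:E)).
- move=> k; apply: measurable_sqr; apply: measurable_funB => //.
  exact: (measurableT_comp mG (measurable_translate1 (h / k.+1%:R))).
- by apply/measurable_EFinP; exact: (measurable_funM (measurable_cst _) mI).
- by move=> k x; rewrite lee_fin sqr_ge0.
- move=> k x; rewrite lee_fin indicE.
  have [xI|xI] := boolP (x \in I).
    rewrite mulr1 -ler_sqrt ?sqr_ge0// !sqrtr_sqr.
    rewrite (ger0_norm (_ : 0 <= 2 * M)); last by lra.
    apply: (le_trans (ler_normB _ _)); have := GM (x + h / k.+1%:R); have := GM x; lra.
  rewrite mulr0.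
  have hk := scaled_harmonic_le h k.
  have Ax : A + `|h| < `|x|.
    rewrite ltNge; apply: contra xI => xA; rewrite inE /I/= in_itv/=.
    by move: xA; rewrite ler_norml.
  have h0 := normr_ge0 h.
  rewrite !GA; last 2 first.
  + by lra.
  + have := ler_normB (x + h / k.+1%:R) (h / k.+1%:R); rewrite addrK; lra.
  + by rewrite subrr expr0n.
- under eq_integral do rewrite EFinM.
  rewrite ge0_integralZl_EFin//=; [|by apply/measurable_EFinP; exact: mI|exact: sqr_ge0].
  rewrite integral_indic//; last exact: measurable_itv.
  have Ioo : (leb1 I < +oo)%E.
    by rewrite lebesgue_measure_itv/=; case: ifP => _; rewrite ?ltry// -EFinD ltry.
  by rewrite setIT lte_mul_pinfty// lee_fin sqr_ge0.
- move=> x _; apply: cvg_EFin; first by apply: nearW.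
  rewrite (_ : _ \o _ = (fun k => (G (x + h / k.+1%:R) - G x) ^+ 2))//.
  have cGx : G (x + h / k.+1%:R) - G x @[k --> \oo] --> G x - G x.
    apply: cvgB; last exact: cvg_cst.
    apply: continuous_cvg; first exact: cG.
    rewrite -[X in _ --> X]addr0; apply: cvgD; first exact: cvg_cst.
    exact: cvg_scaled_harmonic.
  rewrite subrr in cGx; rewrite -(mulr0 (0 : R)).
  rewrite (_ : (fun k => _) = (fun k => (G (x + h / k.+1%:R) - G x) *
    (G (x + h / k.+1%:R) - G x))); last by apply/funext => k; rewrite expr2.
  exact: cvgM.
Qed.

(** Approximation by continuous functions is available in L1. It becomes L2 approximation once the
    approximants are clipped to [-M, M], because then |f - G|^2 <= 2M |f - G|. *)
Lemma translation_continuity_bounded (f : R -> R) (M h : R) : 0 < M ->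
  measurable_fun setT f -> (forall x, `|f x| <= M) ->
  (forall x, M < `|x| -> f x = 0) ->
  (\int[leb1]_x ((f (x + h / k.+1%:R) - f x) ^+ 2)%:E)%E @[k --> \oo] --> 0%E.
Proof.
move=> M0 mf fM f0.
have mf' : measurable_fun [set: measurableTypeR R] f by exact: mf.
apply: (@integral_increment_closed _ _ _ leb1 (S_ h)) => //.
- by move=> k; exact: measurable_translate1.
- by move=> k g mg g0; exact: integral_translate1.
move=> e e0.
(* [cutoff M] vanishes outside this interval, which is one unit wider than the support of [f]. *)
pose E := `[- (M + 1), M + 1]%classic : set (measurableTypeR R).
have muE : (leb1 E < +oo)%E.
  by rewrite lebesgue_measure_itv/=; case: ifP => _; rewrite ?ltry// -EFinD ltry.
have iE : leb1.-integrable E (EFin \o f).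
  apply: measurable_bounded_integrable; [exact: measurable_itv|by []|exact: measurable_funTS mf'|].
  exists M; split; first by rewrite num_real.
  by move=> x Mx y _ /=; rewrite (le_trans (fM y))// ltW.
have [g [cg ig gf]] := approximation_continuous_integrable (measurable_itv _ : measurable E) muE iE.
(* The squared distance is at most 2M times the L1 distance, hence this tolerance. *)
have e20 : 0 < e / (2 * M) by rewrite divr_gt0// mulr_gt0.
have mgk j : measurable_fun [set: measurableTypeR R] (g j).
  exact: continuous_measurable_fun.
have [k _ /(_ k)] : \forall k \near \oo, (\int[leb1]_(z in E) `|(f z - g k z)%:E| <= (e / (2 * M))%:E)%E.
  apply: (ge0_cvge0P _).1 => // k; exact: integral_ge0.
move=> /(_ (leqnn _)) gk.
have M0' := ltW M0.
pose G x := cutoff M x * clip M (g k x).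
have cG : continuous G.
  move=> x; apply: cvgM; first exact: (lipschitz1_continuous (cutoff_lip M)).
  apply: continuous_cvg; first exact: (lipschitz1_continuous (clip_lip M0')).
  exact: cg.
have GM x : `|G x| <= M.
  rewrite normrM -[leRHS]mul1r ler_pM//; last exact: clip_bound.
  by have /andP[? ?] := cutoff_bound M x; rewrite ger0_norm.
have GA x : M + 1 < `|x| -> G x = 0.
  move=> Mx; rewrite /G /cutoff; case: (leP `|x| M) => ?; first by lra.
  by case: (leP (M + 1) `|x|) => ?; [rewrite mul0r|lra].
exists G; split.
- exact: continuous_measurable_fun.
- apply: (@le_trans _ _ (\int[leb1]_(z in E) ((2 * M)%:E * `|(f z - g k z)%:E|))%E).
    rewrite [leRHS]integral_mkcond.
    apply: ge0_le_integralT.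
    + by apply: measurable_sqr; apply: measurable_funB => //; exact: continuous_measurable_fun.
    + apply/(measurable_restrictT _ _).1; first exact: measurable_itv.
      apply: measurable_funTS; apply: measurable_funeM; apply: measurableT_comp => //.
      apply/measurable_EFinP; exact: measurable_funB.
    + by move=> x; rewrite lee_fin sqr_ge0.
    + move=> x; rewrite /patch; case: ifPn => xE; last first.
        have Mx : M + 1 < `|x|.
          rewrite ltNge; apply: contra xE => xA; rewrite inE /E/= in_itv/=.
          by move: xA; rewrite ler_norml.
        by rewrite GA// f0 ?subrr ?expr0n//; lra.
      rewrite lee_fin -real_normK ?num_real// expr2 ler_pM//.
        apply: (le_trans (ler_normB _ _)); have := GM x; have := fM x; lra.
      rewrite /G /cutoff; case: (leP `|x| M) => xM.
        rewrite mul1r; have := clip_lip M0' (f x) (g k x).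
        rewrite {1}/clip; have := fM x; rewrite ler_norml => /andP[? ?].
        by case: ltP => ?; [lra|case: ltP => ? //; lra].
      rewrite f0//; case: (leP (M + 1) `|x|) => ?; first by rewrite mul0r subrr normr0.
      rewrite !sub0r !normrN normrM.
      apply: (@le_trans _ _ (1 * `|clip M (g k x)|)).
        by rewrite ler_wpM2r// ger0_norm; lra.
      rewrite mul1r; have := clip_lip M0' (g k x) 0; rewrite subr0.
      by rewrite (_ : clip M 0 = 0) ?subr0// /clip; case: ltP => ?; [lra|case: ltP => ?; lra].
  rewrite ge0_integralZl_EFin//; last 2 first.
  + apply: measurableT_comp => //; apply/measurable_EFinP.
    by apply: measurable_funTS; exact: measurable_funB.
  + lra.
  apply: (@le_trans _ _ ((2 * M)%:E * (e / (2 * M))%:E)%E).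
    by apply: lee_pmul => //; [rewrite lee_fin; lra|exact: integral_ge0].
  by rewrite -EFinM lee_fin mulrC divfK//; lra.
- exact: measurable_itv.
- exact: (translation_continuity_continuous h M0' cG GM GA).
Qed.

(** Cutting off both the argument and the values at level M + 1 reduces to the bounded case; the
    cut-off functions converge in L2 by dominated convergence with majorant [f x ^+ 2]. *)
Lemma translation_continuity1 (f : R -> R) (h : R) :
  measurable_fun setT f -> (\int[leb1]_x (f x ^+ 2)%:E < +oo)%E ->
  (\int[leb1]_x ((f (x + h / k.+1%:R) - f x) ^+ 2)%:E)%E @[k --> \oo] --> 0%E.
Proof.
move=> mf f2.
have mf' : measurable_fun [set: measurableTypeR R] f by exact: mf.
apply: (@integral_increment_closed _ _ _ leb1 (S_ h)) => //.
- by move=> k; exact: measurable_translate1.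
- by move=> k g mg g0; exact: integral_translate1.
move=> e e0.
pose f_ M x := if (`|x| <= M.+1%:R) && (`|f x| <= M.+1%:R) then f x else 0.
have mf_ M : measurable_fun setT (f_ M).
  apply: measurable_fun_ifT => //; apply: measurable_and.
    by apply: measurable_fun_ler => //; exact: measurableT_comp.
  by apply: measurable_fun_ler => //; exact: measurableT_comp.
have mf_' M : measurable_fun [set: measurableTypeR R] (f_ M) by exact: mf_.
have cf : (\int[leb1]_x ((f x - f_ M x) ^+ 2)%:E)%E @[M --> \oo] --> 0%E.
  apply: (@ge0_dominated_cvg0 _ _ _ leb1 (fun M x => ((f x - f_ M x) ^+ 2)%:E)
    (fun x => (f x ^+ 2)%:E)) => //.
  - by move=> k; apply: measurable_sqr; exact: measurable_funB.
  - exact: measurable_sqr.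
  - by move=> k x; rewrite lee_fin sqr_ge0.
  - move=> k x; rewrite lee_fin /f_; case: ifP => _; last by rewrite subr0.
    by rewrite subrr expr0n sqr_ge0.
  - move=> x _; apply: cvg_near_cst.
    near=> k; rewrite /f_ ifT ?subrr ?expr0n//; apply/andP; split.
      by rewrite (@le_trans _ _ k%:R) ?ler_nat//; near: k; exact: nbhs_infty_ger.
    by rewrite (@le_trans _ _ k%:R) ?ler_nat//; near: k; exact: nbhs_infty_ger.
have [M _ /(_ M (leqnn _)) fM] : \forall M \near \oo, (\int[leb1]_x ((f x - f_ M x) ^+ 2)%:E <= e%:E)%E.
  by apply: (ge0_cvge0P _).1 => // k; exact: integral_sqr_ge0.
exists (f_ M); split => //.
apply: (translation_continuity_bounded (M := M.+1%:R)) => //.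
- by move=> x; rewrite /f_; case: ifP => [/andP[]//|_]; rewrite normr0.
- by move=> x Mx; rewrite /f_ leNgt Mx.
Unshelve. all: by end_near. Qed.

End translation_continuity_line.

(** * Continuity of translations in several variables *)

Section translation_continuity_tuple.
Context {R : realType}.
Local Notation leb1 := (@lebesgue_measure R).
Local Notation leb n := (@lebesgue_tuple R n).

Lemma addt_tuple_of_pair n a (h : n.+1.-tuple R) (p : R * n.-tuple R) :
  addt (tuple_of_pair p) (scalet a h) =
  tuple_of_pair (p.1 + thead h * a, addt p.2 (scalet a [tuple of behead h])).
Proof.
apply: eq_tupleP => i; rewrite !tnth_mktuple.
case: (unliftP ord0 i) => [j|] ->.
  rewrite !tnth_tuple_of_pairS/= !tnth_mktuple tnth_behead; congr (_ + _ * tnth _ _).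
  by apply: val_inj => /=; rewrite inordK// ltnS ltn_ord.
by rewrite !tnth_tuple_of_pair0/= mulrC.
Qed.

Lemma measurable_addt n (h : n.-tuple R) : measurable_fun setT (fun x => addt x h).
Proof.
rewrite (_ : (fun x => _) = affine 1 h); first exact: measurable_affine.
by apply/funext => x; apply: eq_tupleP => i; rewrite !tnth_mktuple mul1r.
Qed.

(** Induction on the dimension: the increment is split into one in the first coordinate ([phi]) and
    one in the others ([psi]). Each inner integral tends to 0 by the lower-dimensional case and is
    at most four times the inner integral of F^2, which is integrable by Tonelli. *)
Lemma translation_continuity n (f : n.-tuple R -> R) (h : n.-tuple R) :
  measurable_fun setT f -> (\int[leb n]_x (f x ^+ 2)%:E < +oo)%E ->
  (\int[leb n]_x ((f (addt x (scalet k.+1%:R^-1 h)) - f x) ^+ 2)%:E)%E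
    @[k --> \oo] --> 0%E.
Proof.
elim: n f h => [|n IH] f h mf f2.
  rewrite (_ : (fun k => _) = cst 0%E); first exact: cvg_cst.
  apply/funext => k; apply: integral0_eq => x _.
  by rewrite (_ : addt _ _ = x) ?subrr ?expr0n//; apply: eq_tupleP; case.
pose P : {measure set (measurableTypeR R * n.-tuple R)%type -> \bar R} :=
  (leb1 \x leb n)%E.
pose F (p : measurableTypeR R * n.-tuple R) := f (tuple_of_pair p).
have mF : measurable_fun setT F.
  by apply: (measurableT_comp mf); exact: measurable_tuple_of_pair.
pose a k : R := thead h / k.+1%:R.
pose h' k := scalet k.+1%:R^-1 [tuple of behead h].
have ma k : measurable_fun setT
    (fun p : measurableTypeR R * n.-tuple R => (p.1 + a k)%R : measurableTypeR R).
  by apply: measurable_funD => //; exact: measurable_fst.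
have mh k : measurable_fun setT
    (fun p : measurableTypeR R * n.-tuple R => addt p.2 (h' k)).
  by apply: (measurableT_comp (measurable_addt (h' k))); exact: measurable_snd.
have mFah k : measurable_fun setT
    (fun p : measurableTypeR R * n.-tuple R => F (p.1 + a k, addt p.2 (h' k))).
  by apply: (measurableT_comp mF); exact: measurable_fun_pair.
have mFh k : measurable_fun setT
    (fun p : measurableTypeR R * n.-tuple R => F (p.1, addt p.2 (h' k))).
  by apply: (measurableT_comp mF); apply: measurable_fun_pair.
have mFa k : measurable_fun setT
    (fun p : measurableTypeR R * n.-tuple R => F (p.1 + a k, p.2)).
  by apply: (measurableT_comp mF); apply: measurable_fun_pair.
have mF2 : measurable_fun setT (fun p => (F p ^+ 2)%:E) by exact: measurable_sqr.
have intF2 : (\int[P]_p (F p ^+ 2)%:E < +oo)%E.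
  move: f2; rewrite ge0_integral_tuple_prod//; first exact: measurable_sqr.
  by move=> x; rewrite lee_fin sqr_ge0.
pose phi k (t : n.-tuple R) : \bar R :=
  (\int[leb1]_x ((F (x + a k, t) - F (x, t))%R ^+ 2)%:E)%E.
pose psi k (x : measurableTypeR R) : \bar R :=
  (\int[leb n]_t ((F (x, addt t (h' k)) - F (x, t)) ^+ 2)%:E)%E.
have mphi k : measurable_fun setT (phi k).
  apply: (@measurable_fun_fubini_tonelli_G _ _ _ _ _ leb1
    (fun p => ((F (p.1 + a k, p.2) - F (p.1, p.2))%R ^+ 2)%:E)).
    apply: measurable_sqr; apply: measurable_funB; first exact: mFa.
    by under eq_fun do rewrite -surjective_pairing.
  by move=> p; rewrite lee_fin sqr_ge0.
have mpsi k : measurable_fun setT (psi k).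
  apply: (@measurable_fun_fubini_tonelli_F _ _ _ _ _ (leb n)
    (fun p => ((F (p.1, addt p.2 (h' k)) - F (p.1, p.2))%R ^+ 2)%:E)).
    apply: measurable_sqr; apply: measurable_funB; first exact: mFh.
    by under eq_fun do rewrite -surjective_pairing.
  by move=> p; rewrite lee_fin sqr_ge0.
have cphi : (\int[leb n]_t phi k t)%E @[k --> \oo] --> 0%E.
  pose g t := (4%:E * \int[leb1]_x (F (x, t) ^+ 2)%:E)%E.
  have mg0 : measurable_fun setT (fun t => \int[leb1]_x (F (x, t) ^+ 2)%:E)%E.
    apply: (@measurable_fun_fubini_tonelli_G _ _ _ _ _ leb1 (fun p => (F p ^+ 2)%:E)) => //.
    by move=> p; rewrite lee_fin sqr_ge0.
  have mFt t : measurable_fun [set: measurableTypeR R] (fun x => F (x, t)).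
    exact: (measurable_fun_pair1 t mF).
  apply: (@ge0_dominated_cvg0 _ _ _ (leb n) phi g) => //.
  - exact: measurable_funeM.
  - by move=> k t; exact: integral_sqr_ge0.
  - move=> k t.
    apply: (@integral_increment_le4 _ _ _ leb1 (fun k x => (x + a k)%R)) => //.
      by move=> j; exact: measurable_translate1.
    by move=> j q mq q0; exact: integral_translate1.
  - rewrite ge0_integralZl_EFin//; last by move=> t _; exact: integral_sqr_ge0.
    rewrite lte_mul_pinfty//; move: intF2; rewrite /P fubini_tonelli2//.
    by move=> p; rewrite lee_fin sqr_ge0.
  - move=> t gt; apply: translation_continuity1; first exact: mFt.
    move: gt; rewrite /g; case: (\int[leb1]_x _)%E (integral_sqr_ge0 leb1 (fun x => F (x, t))) => //=.
    + by move=> r _ _; rewrite ltry.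
    + by move=> _; rewrite gt0_muley ?lte_fin.
have cpsi : (\int[leb1]_x psi k x)%E @[k --> \oo] --> 0%E.
  pose g x := (4%:E * \int[leb n]_t (F (x, t) ^+ 2)%:E)%E.
  have mg0 : measurable_fun setT (fun x => \int[leb n]_t (F (x, t) ^+ 2)%:E)%E.
    apply: (@measurable_fun_fubini_tonelli_F _ _ _ _ _ (leb n) (fun p => (F p ^+ 2)%:E)) => //.
    by move=> p; rewrite lee_fin sqr_ge0.
  have mFx x : measurable_fun setT (fun t => F (x, t)).
    exact: (measurable_fun_pair2 x mF).
  apply: (@ge0_dominated_cvg0 _ _ _ leb1 psi g) => //.
  - exact: measurable_funeM.
  - by move=> k x; exact: integral_sqr_ge0.
  - move=> k x.
    apply: (@integral_increment_le4 _ _ _ (leb n) (fun k t => addt t (h' k))) => //.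
      by move=> j; exact: measurable_addt.
    by move=> j q mq q0; exact: ge0_integral_translate.
  - rewrite ge0_integralZl_EFin//; last by move=> x _; exact: integral_sqr_ge0.
    rewrite lte_mul_pinfty//; move: intF2; rewrite /P fubini_tonelli1//.
    by move=> p; rewrite lee_fin sqr_ge0.
  - move=> x gx; apply: IH; first exact: mFx.
    move: gx; rewrite /g; case: (\int[leb n]_t _)%E (integral_sqr_ge0 (leb n) (fun t => F (x, t))) => //=.
    + by move=> r _ _; rewrite ltry.
    + by move=> _; rewrite gt0_muley ?lte_fin.
apply: (@ge0_squeeze_cvge0 _ _ (fun k =>
    2%:E * \int[leb n]_t phi k t + 2%:E * \int[leb1]_x psi k x)%E).
- by move=> k; exact: integral_sqr_ge0.
- move=> k; rewrite ge0_integral_tuple_prod//; last 2 first.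
  + apply: measurable_sqr; apply: measurable_funB => //.
    exact: (measurableT_comp mf (measurable_addt _)).
  + by move=> x; rewrite lee_fin sqr_ge0.
  have := integral_sqrB_le2 P (mFah k) mF (mFh k).
  under [X in (X <= _)%E -> _]eq_integral => p _.
    rewrite (_ : F (p.1 + a k, _) = f (addt (tuple_of_pair p) (scalet k.+1%:R^-1 h))); last first.
      by rewrite addt_tuple_of_pair.
    over.
  move/le_trans; apply; apply: leeD; apply: lee_pmul => //; try exact: integral_sqr_ge0.
  + rewrite /P fubini_tonelli2/fubini_G/=; last 2 first.
    * by apply: measurable_sqr; exact: measurable_funB.
    * by move=> p; rewrite lee_fin sqr_ge0.
    (* The increment in the first coordinate occurs at the shifted point [addt t (h' k)];
       translation invariance of the outer integral removes this shift. *)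
    rewrite -(ge0_integral_translate (h' k) (f := phi k))//.
    by move=> t; exact: integral_sqr_ge0.
  + rewrite /P fubini_tonelli1/fubini_F//=.
    * by apply: measurable_sqr; exact: measurable_funB.
    * by move=> p; rewrite lee_fin sqr_ge0.
- rewrite -[X in _ --> X](adde0 0%E); apply: cvgeD => //.
    by rewrite -[X in _ --> X](mule0 2%:E); apply: cvgeZl.
  by rewrite -[X in _ --> X](mule0 2%:E); apply: cvgeZl.
Qed.

End translation_continuity_tuple.

(** * The Fourier transform of the exponential of the l1-norm *)

Section bounded_kernels.
Context d (T : measurableType d) {R : realType} (mu : {measure set T -> \bar R}).

Lemma integrableMbounded (f k : T -> R) (B : R) :
  mu.-integrable setT (EFin \o f) -> measurable_fun setT k ->
  (forall x, `|k x| <= B) -> mu.-integrable setT (EFin \o (fun x => f x * k x)).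
Proof.
move=> intf mk kB.
have mf : measurable_fun setT f by apply/measurable_EFinP; exact: measurable_int intf.
apply: (le_integrable measurableT _ _ (integrableZl measurableT B intf)).
  by apply/measurable_EFinP; exact: measurable_funM.
move=> x _; rewrite /= lee_fin !normrM mulrC.
by apply: ler_wpM2r => //; apply: (le_trans (kB x)); exact: ler_norm.
Qed.

Lemma integrable_EFinP (f : T -> R) : measurable_fun setT f ->
  (\int[mu]_x (`|f x|)%:E < +oo)%E -> mu.-integrable setT (EFin \o f).
Proof.
move=> mf foo; apply/integrableP; split; first exact/measurable_EFinP.
by under eq_integral do rewrite /=.
Qed.

Lemma integrable_EFin_lty (f : T -> R) : mu.-integrable setT (EFin \o f) ->
  (\int[mu]_x (`|f x|)%:E < +oo)%E.
Proof. by move=> /integrableP[_]; under eq_integral do rewrite /=. Qed.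

Lemma EFin_Rintegral (f : T -> R) : mu.-integrable setT (EFin \o f) ->
  ((\int[mu]_x f x)%:E = \int[mu]_x (f x)%:E)%E.
Proof. by move=> fi; rewrite fineK//; exact: integrable_fin_num. Qed.

Lemma integrable_EFinZl (c : R) (f : T -> R) : mu.-integrable setT (EFin \o f) ->
  mu.-integrable setT (EFin \o (fun x => c * f x)).
Proof. by move=> fi; exact: eq_integrable (integrableZl measurableT c fi). Qed.

Lemma integrable_EFinD (f g : T -> R) : mu.-integrable setT (EFin \o f) ->
  mu.-integrable setT (EFin \o g) -> mu.-integrable setT (EFin \o (fun x => f x + g x)).
Proof. by move=> fi gi; exact: eq_integrable (integrableD measurableT fi gi). Qed.

Lemma integrable_EFinB (f g : T -> R) : mu.-integrable setT (EFin \o f) ->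
  mu.-integrable setT (EFin \o g) -> mu.-integrable setT (EFin \o (fun x => f x - g x)).
Proof. by move=> fi gi; exact: eq_integrable (integrableB measurableT fi gi). Qed.

End bounded_kernels.

(** * Exchange of integrals against a bounded kernel *)

Section swap.
Context d1 d2 (T1 : measurableType d1) (T2 : measurableType d2) {R : realType}.
Variable m1 : {sigma_finite_measure set T1 -> \bar R}.
Variable m2 : {sigma_finite_measure set T2 -> \bar R}.
Variables (g : T1 -> R) (h : T2 -> R) (K : T1 * T2 -> R) (B : R).
Hypothesis intg : m1.-integrable setT (EFin \o g).
Hypothesis inth : m2.-integrable setT (EFin \o h).
Hypothesis mK : measurable_fun setT K.
Hypothesis KB : forall p, `|K p| <= B.

Let mg : measurable_fun setT g.
Proof. by apply/measurable_EFinP; exact: measurable_int intg. Qed.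

Let mh : measurable_fun setT h.
Proof. by apply/measurable_EFinP; exact: measurable_int inth. Qed.

Lemma integrable_section1 x : m2.-integrable setT (EFin \o (fun y => h y * K (x, y))).
Proof. by apply: (integrableMbounded (B := B)) => //; exact: measurable_fun_pair2. Qed.

Lemma integrable_section2 y : m1.-integrable setT (EFin \o (fun x => g x * K (x, y))).
Proof. by apply: (integrableMbounded (B := B)) => //; exact: measurable_fun_pair1. Qed.

Lemma integrable_product :
  (m1 \x m2)%E.-integrable setT (EFin \o (fun p => g p.1 * h p.2 * K p)).
Proof.
have mgh : measurable_fun setT (fun p : T1 * T2 => g p.1 * h p.2).
  by apply: measurable_funM; apply: measurableT_comp.
apply: (integrableMbounded (f := fun p => g p.1 * h p.2) (B := B)) => //.
apply/integrable12ltyP; first exact/measurable_EFinP.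
have mnh : measurable_fun setT (fun y => (`|h y|)%:E).
  by apply/measurable_EFinP; exact: measurableT_comp.
have mng : measurable_fun setT (fun x => (`|g x|)%:E).
  by apply/measurable_EFinP; exact: measurableT_comp.
under eq_integral => x _.
  under eq_integral do rewrite /= normrM EFinM.
  rewrite ge0_integralZl_EFin//; over.
rewrite ge0_integralZr//.
  by apply: lte_mul_pinfty; [exact: integral_ge0| |exact: integrable_EFin_lty];
    rewrite ge0_fin_numE; [exact: integrable_EFin_lty|exact: integral_ge0].
by apply: integral_ge0.
Qed.

Lemma Rintegral_section1 :
  \int[m1]_x (g x * \int[m2]_y (h y * K (x, y))) =
  \int[(m1 \x m2)%E]_p (g p.1 * h p.2 * K p).
Proof.
congr fine; rewrite -[RHS](integral12_prod_meas1 integrable_product).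
apply: eq_integral => x _; rewrite EFinM EFin_Rintegral; last exact: integrable_section1.
rewrite -integralZl//; last exact: integrable_section1.
by apply: eq_integral => y _; rewrite -EFinM mulrA.
Qed.

Lemma Rintegral_section2 :
  \int[m2]_y (h y * \int[m1]_x (g x * K (x, y))) =
  \int[(m1 \x m2)%E]_p (g p.1 * h p.2 * K p).
Proof.
congr fine; rewrite -[RHS](integral21_prod_meas1 integrable_product).
apply: eq_integral => y _; rewrite EFinM EFin_Rintegral; last exact: integrable_section2.
rewrite -integralZl//; last exact: integrable_section2.
by apply: eq_integral => x _; rewrite -EFinM mulrA (mulrC (h y)).
Qed.

Lemma Rintegral_swap :
  \int[m1]_x (g x * \int[m2]_y (h y * K (x, y))) =
  \int[m2]_y (h y * \int[m1]_x (g x * K (x, y))).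
Proof. by rewrite Rintegral_section1 Rintegral_section2. Qed.

Lemma Rintegral_section_bound x :
  `|\int[m2]_y (h y * K (x, y))| <= B * \int[m2]_y `|h y|.
Proof.
have inh : m2.-integrable setT (EFin \o (fun y => `|h y|)) by exact: integrable_norm.
apply: (le_trans (le_normr_Rintegral measurableT (integrable_section1 x))).
rewrite -RintegralZl//; apply: le_Rintegral => //.
- exact: integrable_norm (integrable_section1 x).
- exact: integrable_EFinZl.
- by move=> y _; rewrite normrM mulrC ler_wpM2r.
Qed.

(* Adding [B |h|] makes the integrand nonnegative, so that Tonelli gives the measurability. *)
Lemma measurable_Rintegral_section :
  measurable_fun setT (fun x => \int[m2]_y (h y * K (x, y))).
Proof.
have inh : m2.-integrable setT (EFin \o (fun y => B * `|h y|)).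
  by apply: integrable_EFinZl; exact: integrable_norm.
have -> : (fun x => \int[m2]_y (h y * K (x, y))) =
  (fun x => fine (\int[m2]_y (h y * K (x, y) + B * `|h y|)%:E)%E - \int[m2]_y (B * `|h y|)).
  apply/funext => x; rewrite [X in X - _](RintegralD _ (integrable_section1 x) inh)//.
  by rewrite addrK.
apply: measurable_funB => //.
apply: (@measurableT_comp _ _ _ _ _ _ (@fine R)) => //.
apply: (@measurable_fun_fubini_tonelli_F _ _ _ _ _ m2
  (fun p => (h p.2 * K p + B * `|h p.2|)%:E)).
- apply/measurable_EFinP; apply: measurable_funD; apply: measurable_funM => //.
    by apply: (measurableT_comp mh).
  by apply: measurableT_comp => //; apply: (measurableT_comp mh).
- move=> p; rewrite lee_fin.
  have : `|h p.2 * K p| <= B * `|h p.2| by rewrite normrM mulrC ler_wpM2r.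
  by rewrite ler_norml => /andP[+ _]; lra.
Qed.

End swap.

(** * The profile e^(-|x|) on the line *)

Section laplace_line.
Context {R : realType}.
Local Notation leb1 := (@lebesgue_measure R).

Definition laplace (x : R) : R := expR (- `|x|).

Lemma laplace_ge0 x : 0 <= laplace x. Proof. exact: expR_ge0. Qed.

Lemma laplace_le1 x : laplace x <= 1.
Proof. by rewrite /laplace -expR0 ler_expR oppr_le0. Qed.

Lemma laplaceN x : laplace (- x) = laplace x.
Proof. by rewrite /laplace normrN. Qed.

Lemma continuous_laplace : continuous laplace.
Proof.
move=> x; rewrite /laplace; apply: continuous_comp; last exact: continuous_expR.
by apply: cvgN; exact: norm_continuous.
Qed.

Lemma measurable_laplace : measurable_fun setT laplace.
Proof. by apply: continuous_measurable_fun; exact: continuous_laplace. Qed.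

Lemma ge0_integral_opp (f : R -> \bar R) : measurable_fun setT f ->
  (forall x, 0 <= f x)%E -> (\int[leb1]_x f (- x)%R = \int[leb1]_x f x)%E.
Proof.
move=> mf f0.
have mN : measurable_fun [set: measurableTypeR R] (-%R : R -> measurableTypeR R).
  exact: oppr_measurable.
pose nu : {measure set (measurableTypeR R) -> \bar R} :=
  measure_function_pushforward__canonical__measure_function_Measure leb1 mN.
rewrite [in RHS](@eq_measure_integral _ _ _ setT nu leb1 f); last first.
  by move=> A mA _; exact/esym/(lebesgue_measureN mA).
by apply/esym; exact: (ge0_integral_pushforward mN leb1 measurableT mf (fun y _ => f0 y)).
Qed.

Let E (x : R) := expR (- x).

Let dE (x : R) : is_derive x (1 : R) E (- E x).
Proof.
have := @is_derive1_comp R expR -%R x _ _ (is_derive_expR (- x)) (is_deriveNid x 1).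
by rewrite mulrN1.
Qed.

Let dC (a x : R) : is_derive x 1 (fun x => cos (a * x)) (- (a * sin (a * x))).
Proof.
have da : is_derive x 1 (fun x : R => a * x) a.
  by have := is_deriveZ a (is_derive_id x (1 : R)); rewrite /GRing.scale/= mulr1.
have := is_derive1_comp (is_derive_cos (a * x)) da.
by rewrite mulNr (mulrC (sin _)).
Qed.

Let dS (a x : R) : is_derive x 1 (fun x => sin (a * x)) (a * cos (a * x)).
Proof.
have da : is_derive x 1 (fun x : R => a * x) a.
  by have := is_deriveZ a (is_derive_id x (1 : R)); rewrite /GRing.scale/= mulr1.
have := is_derive1_comp (is_derive_sin (a * x)) da.
by rewrite mulrC.
Qed.

(** The summand 1 keeps the integrand nonnegative, as the fundamental theorem on a half-line
    requires; it is subtracted again once the integral is known. [F a] is an antiderivative. *)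
Let f a (x : R) := E x * (1 + cos (a * x)).
Let F a (x : R) := - E x + (1 + a ^+ 2)^-1 * (E x * (a * sin (a * x) - cos (a * x))).

Let dF (a x : R) : is_derive x (1 : R) (F a) (f a x).
Proof.
have := is_deriveD (is_deriveN (dE x)) (is_deriveZ (1 + a ^+ 2)^-1
  (is_deriveM (dE x) (is_deriveB (is_deriveZ a (dS a x)) (dC a x)))).
rewrite /F /f; move/is_derive_eq; apply; rewrite /GRing.scale/=.
have a0 : 1 + a ^+ 2 != 0 by rewrite gt_eqF// ltr_pwDl// sqr_ge0.
have -> : (a \*: (fun y : R => sin (a * y)) - (fun y : R => cos (a * y))) x =
  a * sin (a * x) - cos (a * x) by [].
by field.
Qed.

Lemma integral_laplace_1Dcos_half a :
  (\int[leb1]_(x in `[0%R, +oo[) (f a x)%:E = (1 + (1 + a ^+ 2)^-1)%:E)%E.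
Proof.
have cF x : {for x, continuous (F a)}.
  by apply: differentiable_continuous; apply/derivable1_diffP; case: (dF a x).
have cE : continuous E.
  by move=> x; apply: differentiable_continuous; apply/derivable1_diffP; case: (dE x).
have cC : continuous (fun x : R => cos (a * x)).
  by move=> x; apply: differentiable_continuous; apply/derivable1_diffP; case: (dC a x).
have a0 : 0 < 1 + a ^+ 2 by rewrite ltr_pwDl// sqr_ge0.
rewrite (@ge0_continuous_FTC2y _ (f a) (F a) 0 0).
- rewrite -EFinB; congr EFin; rewrite /F /E oppr0 expR0 mulr0 sin0 cos0 mulr0.
  by field; rewrite gt_eqF.
- by move=> x _; rewrite mulr_ge0 ?expR_ge0//; have := cos_geN1 (a * x); lra.
- apply: continuous_subspaceT => x; apply: cvgM; first exact: cE.
  by apply: cvgD; [exact: cvg_cst|exact: cC].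
- apply/cvgr0Pnorm_le => e e0.
  (* Every term of [F a x] carries the factor e^(-x), and [M] bounds what remains; hence [F a] tends
     to 0 at infinity. *)
  pose M := 1 + (1 + a ^+ 2)^-1 * (`|a| + 1).
  have M0 : 0 < M by rewrite ltr_pwDl// mulr_ge0// ?invr_ge0 ?(ltW a0)// addr_ge0.
  have /cvgr0Pnorm_le /(_ _ (divr_gt0 e0 M0)) := @cvgr_expR R.
  apply: filterS => x; rewrite ger0_norm ?expR_ge0// => Ex.
  apply: (@le_trans _ _ (E x * M)); last by rewrite -ler_pdivlMr.
  have -> : E x * M = E x + E x * ((1 + a ^+ 2)^-1 * (`|a| + 1)) by rewrite /M; ring.
  rewrite /F; apply: (le_trans (ler_normD _ _)); apply: lerD.
    by rewrite normrN ger0_norm ?expR_ge0.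
  rewrite !normrM mulrCA; rewrite (ger0_norm (expR_ge0 _)) ler_wpM2l ?expR_ge0//.
  rewrite ger0_norm ?invr_ge0 ?(ltW a0)// ler_wpM2l ?invr_ge0 ?(ltW a0)//.
  apply: (le_trans (ler_normB _ _)); apply: lerD.
    by rewrite normrM ler_piMr// ler_norml sin_le1 sin_geN1.
  by rewrite ler_norml cos_le1 cos_geN1.
- by move=> x _; case: (dF a x).
- by apply: cvg_at_right_filter; exact: cF.
- by move=> x _; rewrite derive1E (@derive_val _ _ _ _ _ _ _ (dF a x)).
Qed.

Lemma integral_laplace_1Dcos a :
  (\int[leb1]_x (laplace x * (1 + cos (a * x)))%:E = (2 + 2 / (1 + a ^+ 2))%:E)%E.
Proof.
rewrite ge0_symfun_integralT.
- rewrite (_ : [set x | _] = `[0, +oo[%classic); last first.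
    by apply/seteqP; split => x/=; rewrite in_itv/= andbT.
  rewrite (_ : 2 + _ = 2 * (1 + (1 + a ^+ 2)^-1)); last by rewrite mulrDr mulr1.
  rewrite EFinM -integral_laplace_1Dcos_half.
  congr (_ * _)%E; apply: eq_integral => x; rewrite inE/= in_itv/= andbT => x0.
  by rewrite /f /laplace ger0_norm.
- by move=> x; rewrite mulr_ge0 ?laplace_ge0//; have := cos_geN1 (a * x); lra.
- move=> x; apply: cvgM; first exact: continuous_laplace.
  apply: cvgD; first exact: cvg_cst.
  by apply: differentiable_continuous; apply/derivable1_diffP; case: (dC a x).
- by move=> x /=; rewrite laplaceN mulrN cosN.
Qed.

Lemma integral_laplace : (\int[leb1]_x (laplace x)%:E = 2%:E)%E.
Proof.
have := integral_laplace_1Dcos 0.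
under eq_integral do rewrite mul0r cos0 mulrC EFinM.
rewrite ge0_integralZl_EFin//; last 2 first.
- by move=> x _; rewrite lee_fin laplace_ge0.
- by apply/measurable_EFinP; exact: measurable_laplace.
rewrite expr0n addr0 divr1 => H.
rewrite -[LHS]mul1e (_ : 1%E = (2^-1 * (1 + 1))%:E); last first.
  by congr EFin; rewrite mulVf.
by rewrite EFinM -muleA H -EFinM; congr EFin; lra.
Qed.

Lemma integrable_laplace : leb1.-integrable setT (EFin \o laplace).
Proof.
apply: integrable_EFinP; first exact: measurable_laplace.
under eq_integral do rewrite ger0_norm ?laplace_ge0//.
by rewrite integral_laplace ltry.
Qed.

Lemma measurable_cosM (a : R) :
  measurable_fun [set: measurableTypeR R] (fun x : R => cos (a * x)).
Proof.
apply: continuous_measurable_fun => x.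
by apply: differentiable_continuous; apply/derivable1_diffP; case: (dC a x).
Qed.

Lemma measurable_sinM (a : R) :
  measurable_fun [set: measurableTypeR R] (fun x : R => sin (a * x)).
Proof.
apply: continuous_measurable_fun => x.
by apply: differentiable_continuous; apply/derivable1_diffP; case: (dS a x).
Qed.

Lemma cos_norm_le1 (x : R) : `|cos x| <= 1.
Proof. by rewrite ler_norml cos_le1 cos_geN1. Qed.

Lemma sin_norm_le1 (x : R) : `|sin x| <= 1.
Proof. by rewrite ler_norml sin_le1 sin_geN1. Qed.

Lemma Rintegral_laplace : \int[leb1]_x laplace x = 2.
Proof. by rewrite /Rintegral integral_laplace. Qed.

Lemma Rintegral_laplace_cos a :
  \int[leb1]_x (laplace x * cos (a * x)) = 2 / (1 + a ^+ 2).
Proof.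
have iC := integrableMbounded integrable_laplace (measurable_cosM a)
  (fun x => cos_norm_le1 (a * x)).
have := RintegralD measurableT integrable_laplace iC.
rewrite Rintegral_laplace => /esym/eqP; rewrite eq_sym addrC -subr_eq => /eqP <-.
rewrite /Rintegral; under eq_integral do rewrite -{1}[laplace _]mulr1 -mulrDr.
by rewrite integral_laplace_1Dcos/= addrAC subrr add0r.
Qed.

(** Oddness of the sine. The reflection formula concerns nonnegative integrands, so it is applied to
    laplace(x) (1 + sin(ax)), which reflects to laplace(x) (1 - sin(ax)). *)
Lemma Rintegral_laplace_sin a : \int[leb1]_x (laplace x * sin (a * x)) = 0.
Proof.
have iS := integrableMbounded integrable_laplace (measurable_sinM a)
  (fun x => sin_norm_le1 (a * x)).
have H1 := RintegralD measurableT integrable_laplace iS.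
have H2 := RintegralB measurableT integrable_laplace iS.
suff H : \int[leb1]_x (laplace x + laplace x * sin (a * x)) =
         \int[leb1]_x (laplace x - laplace x * sin (a * x)).
  by move: H; rewrite H1 H2; lra.
congr fine; rewrite -(ge0_integral_opp (f := fun x => (laplace x + laplace x * sin (a * x))%:E)).
- by apply: eq_integral => x _; rewrite laplaceN mulrN sinN mulrN.
- apply/measurable_EFinP; apply: measurable_funD; first exact: measurable_laplace.
  by apply: measurable_funM; [exact: measurable_laplace|exact: measurable_sinM].
- move=> x; rewrite lee_fin -{1}(mulr1 (laplace x)) -mulrDr mulr_ge0 ?laplace_ge0//.
Qed.

End laplace_line.

(** * The product profile and its transform *)

Section laplace_tuple.
Context {R : realType}.
Local Notation leb1 := (@lebesgue_measure R).
Local Notation leb n := (@lebesgue_tuple R n).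

Lemma measurable_dotp n (xi : n.-tuple R) : measurable_fun setT (dotp xi).
Proof.
rewrite /dotp; apply: measurable_sum => i; apply: measurable_funM => //.
exact: measurable_tnth.
Qed.

Lemma measurable_cos : measurable_fun setT (@cos R).
Proof. by apply: continuous_measurable_fun; exact: continuous_cos. Qed.

Lemma measurable_sin : measurable_fun setT (@sin R).
Proof. by apply: continuous_measurable_fun; exact: continuous_sin. Qed.

Lemma measurable_fun_dotp d (T : measurableType d) n (f g : T -> n.-tuple R) :
  measurable_fun setT f -> measurable_fun setT g ->
  measurable_fun setT (fun x => dotp (f x) (g x)).
Proof.
move=> mf mg; rewrite /dotp; apply: measurable_sum => i; apply: measurable_funM.
  by apply: (measurableT_comp (measurable_tnth i)).
by apply: (measurableT_comp (measurable_tnth i)).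
Qed.

Lemma integrable_prodt n (g : R -> R) : measurable_fun setT g -> (forall t, 0 <= g t) ->
  (\int[leb1]_x (g x)%:E < +oo)%E -> (leb n).-integrable setT (EFin \o @prodt R n g).
Proof.
move=> mg g0 goo; apply: integrable_EFinP; first exact: measurable_prodt.
under eq_integral do rewrite ger0_norm ?prodt_ge0//.
rewrite ge0_integral_prodt//.
have := @integral_ge0 _ _ _ leb1 setT (fun x => (g x)%:E) (fun x _ => g0 x).
case: (\int[leb1]_x _)%E goo => //= r _ _.
by rewrite -EFin_expe ltry.
Qed.

Lemma integrable_prodt_laplace n : (leb n).-integrable setT (EFin \o prodt laplace).
Proof.
apply: integrable_prodt; [exact: measurable_laplace|exact: laplace_ge0|].
by rewrite integral_laplace ltry.
Qed.

Lemma Rintegral_tuple_prod n (f : n.+1.-tuple R -> R) : measurable_fun setT f ->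
  (leb1 \x leb n)%E.-integrable setT (EFin \o (f \o @tuple_of_pair R n)) ->
  \int[leb n.+1]_x f x = \int[(leb1 \x leb n)%E]_p f (tuple_of_pair p).
Proof.
move=> mf fi; congr fine.
pose P : {measure set (measurableTypeR R * n.-tuple R)%type -> \bar R} :=
  (leb1 \x leb n)%E.
have mf' : measurable_fun setT (EFin \o f) by exact/measurable_EFinP.
transitivity (\int[pushforward P (@tuple_of_pair R n)]_y (f y)%:E)%E.
  by [].
by rewrite (integral_pushforward (@measurable_tuple_of_pair R n) mf')// preimage_setT.
Qed.

Lemma tuple_of_pair_surj n (x : n.+1.-tuple R) :
  exists a t, x = tuple_of_pair (a, t).
Proof. by exists (thead x), [tuple of behead x]; rewrite tuple_of_pairK. Qed.

(** The unnormalised transform of [laplace], a multiple of the Cauchy density. *)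
Definition laplace_hat (t : R) : R := 2 / (1 + t ^+ 2).

(** Both integrals are computed in one induction: by the addition formulas each of them in dimension
    n + 1 involves the sine and the cosine integral in dimension n. *)
Lemma Rintegral_prodt_laplace n (xi : n.-tuple R) :
  \int[leb n]_x (prodt laplace x * cos (dotp xi x)) = prodt laplace_hat xi /\
  \int[leb n]_x (prodt laplace x * sin (dotp xi x)) = 0.
Proof.
have mW m := measurable_prodt (n := m) (@measurable_laplace R).
have mcd m (z : m.-tuple R) : measurable_fun setT (fun x => cos (dotp z x)).
  exact: (measurableT_comp measurable_cos (measurable_dotp z)).
have msd m (z : m.-tuple R) : measurable_fun setT (fun x => sin (dotp z x)).
  exact: (measurableT_comp measurable_sin (measurable_dotp z)).
elim: n xi => [|n IH] xi.
  have d0 (x : 0.-tuple R) : dotp xi x = 0 by rewrite /dotp big_ord0.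
  rewrite /Rintegral !integral_tuple0 ?d0; last 2 first.
  - by apply/measurable_EFinP; exact: measurable_funM (mW 0%N) (msd 0%N xi).
  - by apply/measurable_EFinP; exact: measurable_funM (mW 0%N) (mcd 0%N xi).
  by rewrite cos0 sin0 mulr1 mulr0 /prodt !big_ord0.
have [a [t ->]] := tuple_of_pair_surj xi.
have [Cn Sn] := IH t.
pose K (k : R -> R) (p : measurableTypeR R * n.-tuple R) := k (a * p.1 + dotp t p.2).
have mK k : measurable_fun setT k -> measurable_fun setT (K k).
  move=> mk; apply: (measurableT_comp mk); apply: measurable_funD.
    by apply: measurable_funM.
  exact: (measurableT_comp (measurable_dotp t)).
have step (k : R -> R) (mk : measurable_fun setT k) (k1 : forall y, `|k y| <= 1) :
    \int[leb n.+1]_x (prodt laplace x * k (dotp (tuple_of_pair (a, t)) x)) =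
    \int[leb1]_x (laplace x * \int[leb n]_y (prodt laplace y * k (a * x + dotp t y))).
  have E (p : R * n.-tuple R) : prodt laplace (tuple_of_pair p) *
      k (dotp (tuple_of_pair (a, t)) (tuple_of_pair p)) =
      laplace p.1 * prodt laplace p.2 * K k p.
    by rewrite prodt_tuple_of_pair dotp_tuple_of_pair.
  have mkd : measurable_fun setT
      (fun x => prodt laplace x * k (dotp (tuple_of_pair (a, t)) x)).
    exact: (measurable_funM (mW n.+1) (measurableT_comp mk (measurable_dotp _))).
  rewrite (Rintegral_tuple_prod mkd).
    under eq_Rintegral do rewrite E.
    by rewrite -(Rintegral_section1 integrable_laplace (integrable_prodt_laplace n)
      (mK k mk) (fun p => k1 _)).
  apply: eq_integrable (integrable_product integrable_laplace (integrable_prodt_laplace n)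
    (mK k mk) (fun p => k1 _)) => //.
  by move=> p _ /=; rewrite E.
have iC := integrableMbounded (integrable_prodt_laplace n) (mcd n t)
  (fun y => cos_norm_le1 (dotp t y)).
have iS := integrableMbounded (integrable_prodt_laplace n) (msd n t)
  (fun y => sin_norm_le1 (dotp t y)).
split.
- rewrite (step cos measurable_cos cos_norm_le1) prodt_tuple_of_pair /=.
  rewrite -[laplace_hat a]Rintegral_laplace_cos -RintegralZr//; last first.
    exact: (integrableMbounded integrable_laplace (measurable_cosM a)
      (fun x => cos_norm_le1 (a * x))).
  apply: eq_Rintegral => x _; rewrite -mulrA; congr (_ * _).
  transitivity (\int[leb n]_y (cos (a * x) * (prodt laplace y * cos (dotp t y)) -
      sin (a * x) * (prodt laplace y * sin (dotp t y)))).
    by apply: eq_Rintegral => y _; rewrite cosD; ring.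
  rewrite RintegralB//; try exact: integrable_EFinZl.
  by rewrite !RintegralZl// Cn Sn mulr0 subr0.
- rewrite (step sin measurable_sin sin_norm_le1).
  rewrite -(mul0r (prodt laplace_hat t)) -(Rintegral_laplace_sin a) -RintegralZr//; last first.
    exact: (integrableMbounded integrable_laplace (measurable_sinM a)
      (fun x => sin_norm_le1 (a * x))).
  apply: eq_Rintegral => x _; rewrite -mulrA; congr (_ * _).
  transitivity (\int[leb n]_y (sin (a * x) * (prodt laplace y * cos (dotp t y)) +
      cos (a * x) * (prodt laplace y * sin (dotp t y)))).
    by apply: eq_Rintegral => y _; rewrite sinD; ring.
  rewrite RintegralD//; try exact: integrable_EFinZl.
  by rewrite !RintegralZl// Cn Sn mulr0 addr0.
Qed.

Lemma laplace_hat_ge0 t : 0 <= laplace_hat t.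
Proof. by rewrite divr_ge0// addr_ge0// sqr_ge0. Qed.

Lemma laplace_hat_le2 t : laplace_hat t <= 2.
Proof. by rewrite ler_pdivrMr ?ltr_pwDl ?sqr_ge0// ler_peMr// lerDl sqr_ge0. Qed.

Lemma continuous_laplace_hat : continuous laplace_hat.
Proof.
move=> x; apply: cvgM; first exact: cvg_cst.
apply: cvgV; first by rewrite gt_eqF// ltr_pwDl// sqr_ge0.
apply: cvgD; first exact: cvg_cst.
exact: exprn_continuous.
Qed.

Lemma measurable_laplace_hat : measurable_fun setT laplace_hat.
Proof. by apply: continuous_measurable_fun; exact: continuous_laplace_hat. Qed.

Lemma integral_laplace_hat : (\int[leb1]_x (laplace_hat x)%:E = (2 * pi)%:E)%E.
Proof.
rewrite ge0_symfun_integralT.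
- rewrite (_ : [set x | _] = `[0, +oo[%classic); last first.
    by apply/seteqP; split => x/=; rewrite in_itv/= andbT.
  under eq_integral do rewrite /laplace_hat EFinM.
  rewrite ge0_integralZl_EFin//; last 2 first.
  + by move=> x _; rewrite lee_fin invr_ge0 addr_ge0// sqr_ge0.
  + apply/measurable_EFinP; apply: measurable_funTS.
    apply: (continuous_measurable_fun (f := fun x : R => (1 + x ^+ 2)^-1)) => x.
    apply: cvgV; first by rewrite gt_eqF// ltr_pwDl// sqr_ge0.
    by apply: cvgD; [exact: cvg_cst|exact: exprn_continuous].
  have := @integral0y_oneDsqr R.
  rewrite /oneDsqr => ->.
  by rewrite -!EFinM; congr EFin; lra.
- exact: laplace_hat_ge0.
- exact: continuous_laplace_hat.
- by move=> x /=; rewrite /laplace_hat sqrrN.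
Qed.

End laplace_tuple.

(** * Plancherel on L1 and L2 *)

Section plancherel.
Context {R : realType} (n : nat).
Local Notation leb := (@lebesgue_tuple R n).
Local Notation Rn := (n.-tuple R).
Implicit Types f W Q : Rn -> R.

(** Splitting the transform into its cosine and sine parts leaves only real integrals to analyse. *)
Definition cosint f (xi : Rn) : R := \int[leb]_x (f x * cos (dotp xi x)).
Definition sinint f (xi : Rn) : R := \int[leb]_x (f x * sin (dotp xi x)).

Lemma measurable_cos_dotp (xi : Rn) : measurable_fun setT (fun x => cos (dotp xi x)).
Proof. exact: (measurableT_comp (@measurable_cos R) (measurable_dotp xi)). Qed.

Lemma measurable_sin_dotp (xi : Rn) : measurable_fun setT (fun x => sin (dotp xi x)).
Proof. exact: (measurableT_comp (@measurable_sin R) (measurable_dotp xi)). Qed.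

Lemma measurable_cos_dotp2 : measurable_fun setT (fun p : Rn * Rn => cos (dotp p.1 p.2)).
Proof. by apply: (measurableT_comp (@measurable_cos R)); exact: measurable_fun_dotp. Qed.

Lemma measurable_sin_dotp2 : measurable_fun setT (fun p : Rn * Rn => sin (dotp p.1 p.2)).
Proof. by apply: (measurableT_comp (@measurable_sin R)); exact: measurable_fun_dotp. Qed.

Lemma dotpC (x y : Rn) : dotp x y = dotp y x.
Proof. by rewrite /dotp; apply: eq_bigr => i _; rewrite mulrC. Qed.

Lemma dotp_subtr (x y z : Rn) : dotp z (subt x y) = dotp z x - dotp z y.
Proof.
rewrite /dotp -sumrB; apply: eq_bigr => i _.
by rewrite tnth_mktuple mulrBr.
Qed.

Lemma dotp_addtr (x y z : Rn) : dotp z (addt x y) = dotp z x + dotp z y.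
Proof.
rewrite /dotp -big_split; apply: eq_bigr => i _ /=.
by rewrite tnth_mktuple mulrDr.
Qed.

Lemma measurable_subt2 : measurable_fun setT (fun p : Rn * Rn => subt p.1 p.2).
Proof.
apply/measurable_fun_tnthP => i.
rewrite (_ : _ \o _ = (fun p : Rn * Rn => tnth p.1 i - tnth p.2 i)); last first.
  by apply/funext => p /=; rewrite tnth_mktuple.
apply: measurable_funB.
  by apply: (measurableT_comp (measurable_tnth i)).
by apply: (measurableT_comp (measurable_tnth i)).
Qed.

Lemma measurable_addt2 : measurable_fun setT (fun p : Rn * Rn => addt p.1 p.2).
Proof.
apply/measurable_fun_tnthP => i.
rewrite (_ : _ \o _ = (fun p : Rn * Rn => tnth p.1 i + tnth p.2 i)); last first.
  by apply/funext => p /=; rewrite tnth_mktuple.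
apply: measurable_funD.
  by apply: (measurableT_comp (measurable_tnth i)).
by apply: (measurableT_comp (measurable_tnth i)).
Qed.

Lemma addtC (x y : Rn) : addt x y = addt y x.
Proof. by apply: eq_tupleP => i; rewrite !tnth_mktuple addrC. Qed.

Lemma subt_addtK (z y : Rn) : subt (addt z y) y = z.
Proof. by apply: eq_tupleP => i; rewrite !tnth_mktuple addrK. Qed.

Section sine_cosine_transform.
Variable f : Rn -> R.
Hypothesis intf : leb.-integrable setT (EFin \o f).

Let mf : measurable_fun setT f.
Proof. by apply/measurable_EFinP; exact: measurable_int intf. Qed.

Lemma measurable_cosint : measurable_fun setT (cosint f).
Proof.
exact: (measurable_Rintegral_section (m2 := leb) intf measurable_cos_dotp2
  (fun p => cos_norm_le1 _)).
Qed.

Lemma measurable_sinint : measurable_fun setT (sinint f).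
Proof.
exact: (measurable_Rintegral_section (m2 := leb) intf measurable_sin_dotp2
  (fun p => sin_norm_le1 _)).
Qed.

Lemma cosint_bound xi : `|cosint f xi| <= \int[leb]_x `|f x|.
Proof.
have := Rintegral_section_bound (m2 := leb) intf measurable_cos_dotp2
  (fun p => cos_norm_le1 _) xi.
by rewrite mul1r.
Qed.

Lemma sinint_bound xi : `|sinint f xi| <= \int[leb]_x `|f x|.
Proof.
have := Rintegral_section_bound (m2 := leb) intf measurable_sin_dotp2
  (fun p => sin_norm_le1 _) xi.
by rewrite mul1r.
Qed.

Variable W : Rn -> R.
Hypothesis intW : leb.-integrable setT (EFin \o W).

Let mW : measurable_fun setT W.
Proof. by apply/measurable_EFinP; exact: measurable_int intW. Qed.

Let Kk (k : R -> R) (p : (Rn * Rn) * Rn) : R := k (dotp p.1.1 p.2) * k (dotp p.1.2 p.2).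

Let mKk k : measurable_fun setT k -> measurable_fun setT (Kk k).
Proof.
move=> mk; apply: measurable_funM; apply: (measurableT_comp mk);
  apply: measurable_fun_dotp => //; exact: measurableT_comp.
Qed.

Let Kk1 k p : (forall t, `|k t| <= 1) -> `|Kk k p| <= 1.
Proof. by move=> k1; rewrite normrM mulr_ile1. Qed.

Let A k (p : Rn * Rn) : R := \int[leb]_xi (W xi * Kk k (p, xi)).

Let mA (k : R -> R) : measurable_fun setT k -> (forall t, `|k t| <= 1) -> measurable_fun setT (A k).
Proof.
move=> mk k1; exact: (measurable_Rintegral_section (m2 := leb) intW (mKk mk)
  (fun p => Kk1 p k1)).
Qed.

Let A_bound (k : R -> R) : measurable_fun setT k -> (forall t, `|k t| <= 1) ->
  forall p, `|A k p| <= \int[leb]_x `|W x|.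
Proof.
move=> mk k1 p; have := Rintegral_section_bound (m2 := leb) intW (mKk mk)
  (fun p => Kk1 p k1) p.
by rewrite mul1r.
Qed.

Let intWMb (g : Rn -> R) M : measurable_fun setT g -> (forall x, `|g x| <= M) ->
  leb.-integrable setT (EFin \o (fun x => W x * g x)).
Proof. by move=> mg gM; exact: integrableMbounded intW mg gM. Qed.

(** Expands the square by exchanging integrals twice, once per factor. Both exchanges are legitimate
    since [W] stays integrable after multiplication by the bounded functions [H] and [k]. The cosine
    and the sine part are treated by the same argument. *)
Let trig_square (k : R -> R) (mk : measurable_fun setT k) (k1 : forall t, `|k t| <= 1) :
  let H xi := \int[leb]_x (f x * k (dotp xi x)) in
  \int[leb]_xi (W xi * H xi ^+ 2) = \int[(leb \x leb)%E]_p (f p.1 * f p.2 * A k p).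
Proof.
move=> H.
have mkd2 : measurable_fun setT (fun p : Rn * Rn => k (dotp p.1 p.2)).
  by apply: (measurableT_comp mk); exact: measurable_fun_dotp.
have mH : measurable_fun setT H.
  exact: (measurable_Rintegral_section (m2 := leb) intf mkd2 (fun p => k1 _)).
have HB xi : `|H xi| <= \int[leb]_x `|f x|.
  have := Rintegral_section_bound (m2 := leb) intf mkd2 (fun p => k1 _) xi.
  by rewrite mul1r.
have -> : \int[leb]_xi (W xi * H xi ^+ 2) = \int[leb]_xi ((W xi * H xi) * H xi).
  by apply: eq_Rintegral => xi _; rewrite expr2 mulrA.
have intWH := intWMb mH HB.
rewrite (Rintegral_swap (K := fun p : Rn * Rn => k (dotp p.1 p.2)) intWH intf mkd2
  (fun p => k1 _)).
rewrite -(Rintegral_section1 intf intf (mA mk k1) (A_bound mk k1)).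
apply: eq_Rintegral => x _; congr (_ * _).
have mkx : measurable_fun setT (fun xi => k (dotp xi x)).
  by apply: (measurableT_comp mk); under eq_fun do rewrite dotpC; exact: measurable_dotp.
have intWk := intWMb mkx (fun xi => k1 _).
have -> : \int[leb]_xi (W xi * H xi * k (dotp xi x)) =
    \int[leb]_xi ((W xi * k (dotp xi x)) * H xi).
  by apply: eq_Rintegral => xi _; rewrite mulrAC.
rewrite (Rintegral_swap (K := fun p : Rn * Rn => k (dotp p.1 p.2)) intWk intf mkd2
  (fun p => k1 _)).
apply: eq_Rintegral => y _; congr (_ * _).
by apply: eq_Rintegral => xi _; rewrite -mulrA /Kk/= !(dotpC _ xi).
Qed.

(** cos a cos b + sin a sin b = cos (a - b) merges the two expanded squares into the cosine
    transform of [W] at the difference of the two points. *)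
Lemma weighted_square_transform :
  \int[leb]_xi (W xi * (cosint f xi ^+ 2 + sinint f xi ^+ 2)) =
  \int[(leb \x leb)%E]_p (f p.1 * f p.2 * cosint W (subt p.1 p.2)).
Proof.
have bsq (g : R) M : `|g| <= M -> `|g ^+ 2| <= M ^+ 2.
  by move=> gM; rewrite normrX ler_pXn2r// nnegrE// (le_trans _ gM).
have i1 := intWMb (measurable_funX 2 measurable_cosint) (fun xi => bsq _ _ (cosint_bound xi)).
have i2 := intWMb (measurable_funX 2 measurable_sinint) (fun xi => bsq _ _ (sinint_bound xi)).
under eq_Rintegral do rewrite mulrDr.
rewrite RintegralD//.
rewrite (trig_square (@measurable_cos R) (@cos_norm_le1 R)).
rewrite (trig_square (@measurable_sin R) (@sin_norm_le1 R)).
rewrite -RintegralD//; last 2 first.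
- exact: integrable_product intf intf (mA (@measurable_cos R) (@cos_norm_le1 R))
    (A_bound (@measurable_cos R) (@cos_norm_le1 R)).
- exact: integrable_product intf intf (mA (@measurable_sin R) (@sin_norm_le1 R))
    (A_bound (@measurable_sin R) (@sin_norm_le1 R)).
apply: eq_Rintegral => -[x y] _ /=; rewrite -mulrDr; congr (_ * _).
rewrite /A -RintegralD//; last 2 first.
- exact: (integrable_section1 (m2 := leb) intW (mKk (@measurable_cos R)) (fun p => Kk1 p (@cos_norm_le1 R))).
- exact: (integrable_section1 (m2 := leb) intW (mKk (@measurable_sin R)) (fun p => Kk1 p (@sin_norm_le1 R))).
apply: eq_Rintegral => xi _; rewrite -mulrDr; congr (_ * _).
by rewrite /Kk/= (dotpC x xi) (dotpC y xi) (dotpC _ xi) dotp_subtr cosB.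
Qed.

End sine_cosine_transform.

(** Tonelli and the substitution x = y + z. It serves twice: with [Q] the approximate identity of
    the Plancherel argument, and with [Q] the energy kernel. *)
Lemma double_integral_increment f Q : measurable_fun setT f -> measurable_fun setT Q ->
  (forall z, 0 <= Q z) ->
  (\int[leb \x leb]_p ((f p.1 - f p.2) ^+ 2 * Q (subt p.1 p.2))%:E =
   \int[leb]_z ((Q z)%:E * \int[leb]_y ((f (addt y z) - f y)%R ^+ 2)%:E))%E.
Proof.
move=> mf mQ Q0.
have mF1 : measurable_fun setT (fun p : Rn * Rn =>
    ((f p.1 - f p.2) ^+ 2 * Q (subt p.1 p.2))%:E).
  apply/measurable_EFinP; apply: measurable_funM.
    apply: measurable_funX; apply: measurable_funB.
      exact: (measurableT_comp mf measurable_fst).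
    exact: (measurableT_comp mf measurable_snd).
  exact: (measurableT_comp mQ measurable_subt2).
have mfa : measurable_fun setT (fun p : Rn * Rn => f (addt p.1 p.2)).
  exact: (measurableT_comp mf measurable_addt2).
have mF2 : measurable_fun setT (fun p : Rn * Rn =>
    ((f (addt p.1 p.2) - f p.2) ^+ 2 * Q p.1)%:E).
  apply/measurable_EFinP; apply: measurable_funM.
    apply: measurable_funX; apply: measurable_funB => //.
    exact: (measurableT_comp mf measurable_snd).
  exact: (measurableT_comp mQ measurable_fst).
have pos (a b : R) : 0 <= b -> (0 <= (a ^+ 2 * b)%:E)%E.
  by move=> b0; rewrite lee_fin mulr_ge0// sqr_ge0.
rewrite fubini_tonelli2//; last by move=> p; exact: pos.
transitivity (\int[leb]_y \int[leb]_z ((f (addt z y) - f y) ^+ 2 * Q z)%:E)%E.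
  apply: eq_integral => y _; rewrite /fubini_G.
  rewrite -(ge0_integral_translate y (f := fun x =>
    ((f (x, y).1 - f (x, y).2) ^+ 2 * Q (subt (x, y).1 (x, y).2))%:E)).
  - by apply: eq_integral => z _ /=; rewrite subt_addtK.
  - exact: (measurable_fun_pair1 y mF1).
  - by move=> x; exact: pos.
have -> : (\int[leb]_y \int[leb]_z ((f (addt z y) - f y) ^+ 2 * Q z)%:E)%E =
    (\int[leb]_y fubini_G leb (fun p : Rn * Rn => ((f (addt p.1 p.2) - f p.2) ^+ 2 * Q p.1)%:E) y)%E.
  by [].
rewrite -fubini_tonelli2// ?fubini_tonelli1//; try by move=> p; exact: pos.
apply: eq_integral => z _; rewrite /fubini_F/=.
under eq_integral do rewrite mulrC EFinM (addtC z).
rewrite ge0_integralZl_EFin//.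
- by move=> y _; rewrite lee_fin sqr_ge0.
- apply: measurable_sqr; apply: measurable_funB => //.
  exact: (measurableT_comp mf (measurable_addt z)).
Qed.

Lemma Rintegral_scale (a : R) f : 0 < a -> leb.-integrable setT (EFin \o f) ->
  \int[leb]_x f (scalet a x) = a^-1 ^+ n * \int[leb]_x f x.
Proof.
move=> a0 fi.
have mf : measurable_fun setT (EFin \o f) by exact: measurable_int fi.
have P := integrable_funepos measurableT fi.
have N := integrable_funeneg measurableT fi.
have E1 : (\int[leb]_x ((fun x => (f (scalet a x))%:E)^\+ x) =
    (a^-1 ^+ n)%:E * \int[leb]_x ((fun x => (f x)%:E)^\+ x))%E.
  rewrite -(ge0_integral_scale (f := (EFin \o f)^\+)%E a0)//; last exact: measurable_funepos.
  by apply: eq_integral => x _; rewrite !funepos.unlock.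
have E2 : (\int[leb]_x ((fun x => (f (scalet a x))%:E)^\- x) =
    (a^-1 ^+ n)%:E * \int[leb]_x ((fun x => (f x)%:E)^\- x))%E.
  rewrite -(ge0_integral_scale (f := (EFin \o f)^\-)%E a0)//; last exact: measurable_funeneg.
  by apply: eq_integral => x _; rewrite !funeneg.unlock.
have Pf := integrable_fin_num measurableT P.
have Nf := integrable_fin_num measurableT N.
rewrite /Rintegral.
have -> : (\int[leb]_x (f (scalet a x))%:E = (a^-1 ^+ n)%:E * \int[leb]_x (f x)%:E)%E.
  rewrite [LHS]integralE [X in (_ = _ * X)%E]integralE muleBr//; last by rewrite fin_num_adde_defl// fin_numN.
  by congr (_ - _)%E; [exact: E1|exact: E2].
by rewrite fineM//; exact: integrable_fin_num.
Qed.

Lemma dotp_scalet (a : R) (x y : Rn) : dotp (scalet a x) y = a * dotp x y.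
Proof.
by rewrite /dotp mulr_sumr; apply: eq_bigr => i _; rewrite tnth_mktuple mulrA.
Qed.

Lemma scaletK (a : R) (x : Rn) : a != 0 -> scalet a (scalet a^-1 x) = x.
Proof. by move=> a0; apply: eq_tupleP => i; rewrite !tnth_mktuple mulrA mulfV// mul1r. Qed.

Lemma measurable_scalet (a : R) : measurable_fun setT (@scalet R n a).
Proof.
rewrite (_ : @scalet R n a = affine a [tuple 0 | i < n]); first exact: measurable_affine.
by apply/funext => x; apply: eq_tupleP => i; rewrite !tnth_mktuple addr0.
Qed.

(** As [e] decreases to 0 this weight increases to 1, while its cosine transform is an explicit
    nonnegative approximate identity of total mass (2 pi)^n. *)
Definition laplace_weight (e : R) (xi : Rn) : R := prodt laplace (scalet e xi).
Local Notation W := laplace_weight.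

Lemma prodt_laplaceE (x : Rn) : prodt laplace x = expR (- \sum_(i < n) `|tnth x i|).
Proof. by rewrite /prodt -sumrN expR_sum. Qed.

Lemma laplace_weightE e xi : 0 <= e -> W e xi = expR (- (e * \sum_(i < n) `|tnth xi i|)).
Proof.
move=> e0; rewrite /laplace_weight prodt_laplaceE mulr_sumr; congr (expR (- _)).
by apply: eq_bigr => i _; rewrite tnth_mktuple normrM ger0_norm.
Qed.

Lemma measurable_laplace_weight e : measurable_fun setT (W e).
Proof.
exact: (measurableT_comp (measurable_prodt (@measurable_laplace R)) (measurable_scalet e)).
Qed.

Lemma laplace_weight_ge0 e xi : 0 <= W e xi.
Proof. by apply: prodt_ge0 => t; exact: laplace_ge0. Qed.

Lemma integrable_laplace_weight e : 0 < e -> leb.-integrable setT (EFin \o W e).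
Proof.
move=> e0; apply: integrable_EFinP; first exact: measurable_laplace_weight.
under eq_integral do rewrite ger0_norm ?laplace_weight_ge0//.
have := ge0_integral_scale (n := n) (f := fun x => (prodt laplace x)%:E) e0.
rewrite /laplace_weight => ->.
- rewrite ge0_integral_prodt ?integral_laplace; [|exact: measurable_laplace|exact: laplace_ge0].
  by rewrite -EFin_expe -EFinM ltry.
- by apply/measurable_EFinP; exact: (measurable_prodt (@measurable_laplace R)).
- by move=> x; rewrite lee_fin prodt_ge0// => t; exact: laplace_ge0.
Qed.

Lemma cosint_laplace_weight e z : 0 < e ->
  cosint (W e) z = e^-1 ^+ n * prodt laplace_hat (scalet e^-1 z).
Proof.
move=> e0; rewrite -(Rintegral_prodt_laplace (scalet e^-1 z)).1.
rewrite -Rintegral_scale//; last first.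
  exact: (integrableMbounded (integrable_prodt_laplace n) (measurable_cos_dotp _)
    (fun x => cos_norm_le1 _)).
apply: eq_Rintegral => x _; rewrite /laplace_weight; congr (_ * cos _).
by rewrite dotp_scalet (dotpC z) (dotpC z) dotp_scalet mulrA mulVf ?mul1r ?gt_eqF.
Qed.

Lemma integral_prodt_laplace_hat :
  (\int[leb]_x (prodt laplace_hat x)%:E = ((2 * pi) ^+ n)%:E)%E.
Proof.
rewrite ge0_integral_prodt ?integral_laplace_hat ?EFin_expe//.
- exact: measurable_laplace_hat.
- exact: laplace_hat_ge0.
Qed.

End plancherel.

(** * The Plancherel identity for functions in both L1 and L2 *)

Section plancherel_L1_L2.
Context {R : realType} (n : nat).
Local Notation leb := (@lebesgue_tuple R n).
Local Notation Rn := (n.-tuple R).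
Variable f : Rn -> R.
Hypothesis intf : leb.-integrable setT (EFin \o f).
Hypothesis sqf : (\int[leb]_x (f x ^+ 2)%:E < +oo)%E.

Let mf : measurable_fun setT f.
Proof. by apply/measurable_EFinP; exact: measurable_int intf. Qed.

Let sq0 : (0 <= \int[leb]_x (f x ^+ 2)%:E)%E.
Proof. exact: integral_sqr_ge0. Qed.

Let sqfin : (\int[leb]_x (f x ^+ 2)%:E)%E \is a fin_num.
Proof. by rewrite ge0_fin_numE. Qed.

Let tau (z : Rn) : \bar R := (\int[leb]_y ((f (addt y z) - f y) ^+ 2)%:E)%E.

Let tau0 z : (0 <= tau z)%E.
Proof. exact: (integral_sqr_ge0 leb (fun y => f (addt y z) - f y)). Qed.

Let mtau : measurable_fun setT tau.
Proof.
apply: (@measurable_fun_fubini_tonelli_F _ _ _ _ _ leb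
  (fun p => ((f (addt p.2 p.1) - f p.2) ^+ 2)%:E)).
  apply: measurable_sqr; apply: measurable_funB.
    under eq_fun do rewrite addtC.
    exact: (measurableT_comp mf (@measurable_addt2 R n)).
  exact: (measurableT_comp mf measurable_snd).
by move=> p; rewrite lee_fin sqr_ge0.
Qed.

Let tau_le z : (tau z <= 4%:E * \int[leb]_x (f x ^+ 2)%:E)%E.
Proof.
apply: (@integral_increment_le4 _ _ _ leb (fun k y => addt y z) _ _ f 0%N mf).
  by move=> k; exact: measurable_addt.
by move=> k g mg g0; exact: ge0_integral_translate.
Qed.

Section even_kernel.
Variables (Q : Rn -> R) (q B : R).
Hypothesis mQ : measurable_fun setT Q.
Hypothesis Q0 : forall z, 0 <= Q z.
Hypothesis QB : forall z, Q z <= B.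
Hypothesis Qsym : forall x y, Q (subt x y) = Q (subt y x).
Hypothesis intQ : (\int[leb]_z (Q z)%:E = q%:E)%E.

Let integral_Q_translate y : (\int[leb]_x (Q (subt x y))%:E = q%:E)%E.
Proof.
pose my : Rn := [tuple - tnth y i | i < n].
rewrite -intQ -(ge0_integral_translate my (f := fun x => (Q x)%:E)).
- apply: eq_integral => x _; congr (EFin (Q _)).
  by apply: eq_tupleP => i; rewrite !tnth_mktuple.
- exact/measurable_EFinP.
- by move=> x; rewrite lee_fin.
Qed.

Let mQ2 : measurable_fun setT (fun p : Rn * Rn => Q (subt p.1 p.2)).
Proof. exact: (measurableT_comp mQ (@measurable_subt2 R n)). Qed.

Let msq1 : measurable_fun setT (fun p : Rn * Rn => f p.1 ^+ 2 * Q (subt p.1 p.2)).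
Proof.
by apply: measurable_funM => //; apply: measurable_funX;
  exact: (measurableT_comp mf measurable_fst).
Qed.

Let msq2 : measurable_fun setT (fun p : Rn * Rn => f p.2 ^+ 2 * Q (subt p.1 p.2)).
Proof.
by apply: measurable_funM => //; apply: measurable_funX;
  exact: (measurableT_comp mf measurable_snd).
Qed.

Let pos (a b : R) : 0 <= b -> (0 <= (a ^+ 2 * b)%:E)%E.
Proof. by move=> b0; rewrite lee_fin mulr_ge0// sqr_ge0. Qed.

Let integral_sq1 : (\int[leb \x leb]_p (f p.1 ^+ 2 * Q (subt p.1 p.2))%:E =
  \int[leb]_x (f x ^+ 2)%:E * q%:E)%E.
Proof.
rewrite fubini_tonelli1; [|exact/measurable_EFinP|by move=> p; exact: pos].
rewrite -ge0_integralZr//.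
- apply: eq_integral => x _; rewrite /fubini_F/=.
  under eq_integral do rewrite EFinM Qsym.
  rewrite ge0_integralZl_EFin//.
  + by rewrite integral_Q_translate.
  + by move=> y _; rewrite lee_fin.
  + apply/measurable_EFinP; under eq_fun do rewrite -Qsym.
    exact: (measurable_fun_pair2 x mQ2).
  + exact: sqr_ge0.
- exact: measurable_sqr.
- by move=> x _; rewrite lee_fin sqr_ge0.
- by rewrite -intQ; apply: integral_ge0 => z _; rewrite lee_fin.
Qed.

Let integral_sq2 : (\int[leb \x leb]_p (f p.2 ^+ 2 * Q (subt p.1 p.2))%:E =
  \int[leb]_x (f x ^+ 2)%:E * q%:E)%E.
Proof.
rewrite fubini_tonelli2; [|exact/measurable_EFinP|by move=> p; exact: pos].
rewrite -ge0_integralZr//.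
- apply: eq_integral => x _; rewrite /fubini_G/=.
  under eq_integral do rewrite EFinM.
  rewrite ge0_integralZl_EFin//.
  + by rewrite integral_Q_translate.
  + by move=> y _; rewrite lee_fin.
  + apply/measurable_EFinP.
    exact: (measurable_fun_pair1 x mQ2).
  + exact: sqr_ge0.
- exact: measurable_sqr.
- by move=> x _; rewrite lee_fin sqr_ge0.
- by rewrite -intQ; apply: integral_ge0 => z _; rewrite lee_fin.
Qed.

(** Integrates 2ab + (a - b)^2 = a^2 + b^2 against Q(x - y). Each square contributes [q] times the
    squared norm, by evenness of [Q] for the first variable. The increment term stands on the left,
    so that no subtraction occurs in [\bar R]. *)
Lemma double_integral_product :
  ((2 * \int[(leb \x leb)%E]_p (f p.1 * f p.2 * Q (subt p.1 p.2)))%:E +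
   \int[leb]_z ((Q z)%:E * tau z) =
   2%:E * (\int[leb]_x (f x ^+ 2)%:E * q%:E))%E.
Proof.
have lt2 : (\int[leb]_x (f x ^+ 2)%:E * q%:E < +oo)%E.
  by rewrite -(fineK sqfin) -EFinM ltry.
have i1 : (leb \x leb)%E.-integrable setT
    (EFin \o (fun p => f p.1 ^+ 2 * Q (subt p.1 p.2))).
  apply: integrable_EFinP => //.
  rewrite (eq_integral (fun p => (f p.1 ^+ 2 * Q (subt p.1 p.2))%:E)).
    by rewrite integral_sq1.
  by move=> p _; rewrite ger0_norm// mulr_ge0// sqr_ge0.
have i2 : (leb \x leb)%E.-integrable setT
    (EFin \o (fun p => f p.2 ^+ 2 * Q (subt p.1 p.2))).
  apply: integrable_EFinP => //.
  rewrite (eq_integral (fun p => (f p.2 ^+ 2 * Q (subt p.1 p.2))%:E)).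
    by rewrite integral_sq2.
  by move=> p _; rewrite ger0_norm// mulr_ge0// sqr_ge0.
have QB' p : `|Q (subt p.1 p.2)| <= B by rewrite ger0_norm.
have i3 := integrable_product intf intf mQ2 QB'.
have E : (\int[leb]_z ((Q z)%:E * tau z) =
    (\int[(leb \x leb)%E]_p (f p.1 ^+ 2 * Q (subt p.1 p.2)) +
     \int[(leb \x leb)%E]_p (f p.2 ^+ 2 * Q (subt p.1 p.2)) -
     2 * \int[(leb \x leb)%E]_p (f p.1 * f p.2 * Q (subt p.1 p.2)))%:E)%E.
  rewrite -(double_integral_increment mf mQ Q0).
  rewrite -RintegralZl// -RintegralD// -RintegralB//; last 2 first.
  - exact: integrable_EFinD.
  - exact: integrable_EFinZl.
  rewrite EFin_Rintegral; last first.
    by apply: integrable_EFinB; [exact: integrable_EFinD|exact: integrable_EFinZl].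
  by apply: eq_integral => p _; congr EFin; ring.
have r1 : \int[(leb \x leb)%E]_p (f p.1 ^+ 2 * Q (subt p.1 p.2)) =
  fine (\int[leb]_x (f x ^+ 2)%:E * q%:E)%E by rewrite /Rintegral integral_sq1.
have r2 : \int[(leb \x leb)%E]_p (f p.2 ^+ 2 * Q (subt p.1 p.2)) =
  fine (\int[leb]_x (f x ^+ 2)%:E * q%:E)%E by rewrite /Rintegral integral_sq2.
rewrite E r1 r2 -EFinD.
rewrite -(fineK sqfin) -!EFinM/=; congr EFin; ring.
Qed.

End even_kernel.

Local Notation hat2 xi := (cosint f xi ^+ 2 + sinint f xi ^+ 2).

Local Notation W := (@laplace_weight R n).
Let G (z : Rn) : R := prodt laplace_hat z.
Let Q (e : R) (z : Rn) : R := e^-1 ^+ n * G (scalet e^-1 z).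

Let mG : measurable_fun setT G.
Proof. exact: measurable_prodt (@measurable_laplace_hat R). Qed.

Let G0 z : 0 <= G z.
Proof. by apply: prodt_ge0 => t; exact: laplace_hat_ge0. Qed.

Let GB z : G z <= 2 ^+ n.
Proof.
rewrite /G /prodt -[X in _ <= _ ^+ X]card_ord -prodr_const; apply: ler_prod => i _.
by rewrite laplace_hat_ge0 laplace_hat_le2.
Qed.

Let mQ e : measurable_fun setT (Q e).
Proof. by apply: measurable_funM => //; exact: (measurableT_comp mG (measurable_scalet _)). Qed.

Let integral_Q_scale e (H : Rn -> \bar R) : 0 < e -> measurable_fun setT H ->
  (forall z, 0 <= H z)%E ->
  (\int[leb]_z ((Q e z)%:E * H z) = \int[leb]_t ((G t)%:E * H (scalet e t)))%E.
Proof.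
move=> e0 mH H0.
have mGz (c : R) : measurable_fun setT (fun z => (G (scalet c z))%:E).
  by apply/measurable_EFinP; exact: (measurableT_comp mG (measurable_scalet _)).
have ei0 : 0 < e^-1 by rewrite invr_gt0.
have := ge0_integral_scale (f := fun t => ((G t)%:E * H (scalet e t))%E) ei0.
rewrite invrK => E.
under eq_integral do rewrite /Q EFinM -muleA.
rewrite ge0_integralZl_EFin//.
- rewrite (eq_integral (fun x => (G (scalet e^-1 x))%:E * H (scalet e (scalet e^-1 x)))%E).
    rewrite E.
    + rewrite muleA -EFinM -exprMn mulVf ?gt_eqF// expr1n mul1e//.
    + apply: emeasurable_funM; first exact/measurable_EFinP.
      exact: (measurableT_comp mH (measurable_scalet _)).
    + by move=> x; rewrite mule_ge0// lee_fin.
  by move=> x _; rewrite scaletK// gt_eqF.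
- by move=> z _; rewrite mule_ge0// lee_fin.
- by apply: emeasurable_funM.
- by rewrite exprn_ge0// ltW.
Qed.

(** After the rescaling z = e t the weight [G] is fixed and [e] enters the error term only through
    the shift [scalet e t], which prepares dominated convergence. *)
Let weighted e : 0 < e ->
  ((2 * \int[leb]_xi (W e xi * hat2 xi))%:E +
   \int[leb]_t ((G t)%:E * tau (scalet e t)) =
   2%:E * (\int[leb]_x (f x ^+ 2)%:E * ((2 * pi) ^+ n)%:E))%E.
Proof.
move=> e0.
have ei0 : 0 < e^-1 by rewrite invr_gt0.
have A1 : \int[leb]_xi (W e xi * hat2 xi) =
    \int[(leb \x leb)%E]_p (f p.1 * f p.2 * Q e (subt p.1 p.2)).
  rewrite (weighted_square_transform intf (integrable_laplace_weight n e0)).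
  by apply: eq_Rintegral => p _; rewrite cosint_laplace_weight.
rewrite A1 -(integral_Q_scale e0 mtau tau0).
apply: (@double_integral_product (Q e) _ (e^-1 ^+ n * 2 ^+ n) (mQ e)).
- by move=> z; rewrite mulr_ge0// exprn_ge0// ltW.
- by move=> z; rewrite ler_wpM2l// exprn_ge0// ltW.
- move=> x y; rewrite /Q; congr (_ * _); rewrite /G /prodt; apply: eq_bigr => i _.
  rewrite !tnth_mktuple /laplace_hat; congr (_ / (_ + _)).
  by rewrite -sqrrN -mulrN opprB.
- have := @integral_Q_scale e (cst 1%E) e0 (measurable_cst _) (fun=> lee01).
  under eq_integral do rewrite mule1.
  move=> ->; under eq_integral do rewrite mule1.
  exact: integral_prodt_laplace_hat.
Qed.

Let Gtau_cvg :
  (\int[leb]_t ((G t)%:E * tau (scalet k.+1%:R^-1 t)))%E @[k --> \oo] --> 0%E.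
Proof.
apply: (@ge0_dominated_cvg0 _ _ _ leb (fun k t => (G t)%:E * tau (scalet k.+1%:R^-1 t))%E
  (fun t => (G t)%:E * (4%:E * \int[leb]_x (f x ^+ 2)%:E))%E).
- move=> k; apply: emeasurable_funM; first exact/measurable_EFinP.
  exact: (measurableT_comp mtau (measurable_scalet _)).
- by apply: emeasurable_funM => //; exact/measurable_EFinP.
- by move=> k x; rewrite mule_ge0// lee_fin.
- by move=> k x; apply: lee_wpmul2l; rewrite ?lee_fin.
- rewrite ge0_integralZr//.
  + rewrite integral_prodt_laplace_hat -(fineK sqfin) -!EFinM ltry//.
  + exact/measurable_EFinP.
  + by move=> x _; rewrite lee_fin.
  + by rewrite mule_ge0.
- move=> t _; rewrite -[X in _ --> X](mule0 (G t)%:E); apply: cvgeZl => //.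
  exact: translation_continuity.
Qed.

Let intWhat e : 0 < e ->
  leb.-integrable setT (EFin \o (fun xi => W e xi * hat2 xi)).
Proof.
move=> e0.
pose M := \int[leb]_x `|f x|.
apply: (integrableMbounded (B := M ^+ 2 + M ^+ 2) (integrable_laplace_weight n e0)).
  by apply: measurable_funD; apply: measurable_funX;
    [exact: measurable_cosint|exact: measurable_sinint].
move=> xi; rewrite ger0_norm ?addr_ge0 ?sqr_ge0//.
have sqM a : `|a| <= M -> a ^+ 2 <= M ^+ 2.
  by move=> aM; rewrite -[leLHS]real_normK ?num_real// ler_pXn2r// nnegrE (le_trans _ aM).
by apply: lerD; apply: sqM; [exact: cosint_bound|exact: sinint_bound].
Qed.

(** Take e = 1 / (k + 1) in [weighted]: the weights increase to 1, so the first term converges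
    monotonically, and the second tends to 0. Finiteness of the squared transform is part of the
    outcome, not presupposed. *)
Lemma plancherel_L1_L2 : (\int[leb]_xi (hat2 xi)%:E =
  ((2 * pi) ^+ n)%:E * \int[leb]_x (f x ^+ 2)%:E)%E.
Proof.
pose S (xi : Rn) := \sum_(i < n) `|tnth xi i|.
have S0 xi : 0 <= S xi by exact: sumr_ge0.
have WE k xi : W k.+1%:R^-1 xi = expR (- (S xi / k.+1%:R)) by rewrite laplace_weightE// mulrC.
have m2 : measurable_fun setT (fun xi => hat2 xi).
  by apply: measurable_funD; apply: measurable_funX;
    [exact: measurable_cosint|exact: measurable_sinint].
have h20 xi : 0 <= hat2 xi by rewrite addr_ge0 ?sqr_ge0.
have k0 k : 0 < (k.+1%:R^-1 : R) by rewrite invr_gt0.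
have c1 : (\int[leb]_xi (W k.+1%:R^-1 xi * hat2 xi)%:E)%E @[k --> \oo] -->
    (\int[leb]_xi (hat2 xi)%:E)%E.
  rewrite [X in _ --> X](eq_integral (fun xi => limn (fun k => (W k.+1%:R^-1 xi * hat2 xi)%:E))).
    apply: cvg_monotone_convergence => //.
    - by move=> k; exact: measurable_int (intWhat (k0 k)).
    - by move=> k xi _; rewrite lee_fin mulr_ge0// WE expR_ge0.
    - move=> xi _ k l kl; rewrite lee_fin ler_wpM2r// !WE ler_expR lerN2.
      by rewrite ler_wpM2l// lef_pV2 ?posrE// ler_nat.
  move=> xi _; apply/esym/cvg_lim => //; apply: cvg_EFin; first by apply: nearW.
  have cW : W k.+1%:R^-1 xi @[k --> \oo] --> (1 : R).
    have H : - (S xi / k.+1%:R) @[k --> \oo] --> (0 : R).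
      by rewrite -[X in _ --> X]oppr0; apply: cvgN; exact: cvg_scaled_harmonic.
    have HE : expR (- (S xi / k.+1%:R)) @[k --> \oo] --> expR (0 : R).
      by apply: continuous_cvg => //; exact: continuous_expR.
    rewrite expR0 in HE.
    rewrite (_ : (fun k => W k.+1%:R^-1 xi) = (fun k => expR (- (S xi / k.+1%:R))))//.
    by apply/funext => k; exact: WE.
  by rewrite -[X in _ --> X]mul1r; exact: (cvgM cW (cvg_cst _)).
have c2 : (2%:E * \int[leb]_xi (W k.+1%:R^-1 xi * hat2 xi)%:E +
    \int[leb]_t ((G t)%:E * tau (scalet k.+1%:R^-1 t)))%E @[k --> \oo] -->
    (2%:E * \int[leb]_xi (hat2 xi)%:E + 0)%E.
  apply: cvgeD => //; last exact: cvgeZl.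
  by rewrite fin_num_adde_defl.
have c3 : (2%:E * \int[leb]_xi (W k.+1%:R^-1 xi * hat2 xi)%:E +
    \int[leb]_t ((G t)%:E * tau (scalet k.+1%:R^-1 t)))%E @[k --> \oo] -->
    (2%:E * (\int[leb]_x (f x ^+ 2)%:E * ((2 * pi) ^+ n)%:E))%E.
  rewrite [X in X @ _](_ : _ = cst (2%:E * (\int[leb]_x (f x ^+ 2)%:E * ((2 * pi) ^+ n)%:E))%E).
    exact: cvg_cst.
  apply/funext => k; rewrite -(weighted (k0 k)) EFinM EFin_Rintegral//.
  exact: intWhat.
have E : (2%:E * \int[leb]_xi (hat2 xi)%:E + 0 =
    2%:E * (\int[leb]_x (f x ^+ 2)%:E * ((2 * pi) ^+ n)%:E))%E.
  by apply: (cvg_unique _ c2 c3).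
have two (y : \bar R) : (y = (2^-1)%:E * (2%:E * y))%E.
  by rewrite muleA -EFinM mulVf ?mul1e.
by rewrite (two (\int[leb]_xi _)%E) -[X in (_ * X)%E]adde0 E -two muleC.
Qed.

End plancherel_L1_L2.

(** * The Plancherel transform *)

Section square_integrable.
Context d (T : measurableType d) {R : realType} (mu : {measure set T -> \bar R}).

Lemma fatou_bound (F : nat -> T -> \bar R) (f : T -> \bar R) (C : \bar R) :
  (forall k, measurable_fun setT (F k)) -> (forall k x, 0 <= F k x)%E ->
  (forall x, F k x @[k --> \oo] --> f x) ->
  (forall k, \int[mu]_x F k x <= C)%E -> (\int[mu]_x f x <= C)%E.
Proof.
move=> mF F0 Ff FC.
have -> : (\int[mu]_x f x = \int[mu]_x limn_einf (F^~ x))%E.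
  by apply: eq_integral => x _; rewrite (cvg_limn_einf_sup (Ff x)).1.
apply: (le_trans (fatou mu measurableT mF (fun k x _ => F0 k x))).
rewrite limn_einf_lim; apply: lime_le; first exact: is_cvg_einfs.
apply: nearW => k; apply: le_trans (FC k).
by apply: ereal_inf_lbound; exists k => /=.
Qed.

Lemma sum_half_le2 m : \sum_(0 <= j < m) (2^-1 ^+ j : R) <= 2.
Proof.
suff -> : \sum_(0 <= j < m) (2^-1 ^+ j : R) = 2 - 2 * 2^-1 ^+ m.
  by rewrite gerBl mulr_ge0// exprn_ge0.
elim: m => [|m IH]; first by rewrite big_geq// expr0; lra.
by rewrite big_nat_recr//= IH exprS; lra.
Qed.

Lemma nneseries_le_bound (u : nat -> R) (C : R) : (forall j, 0 <= u j) ->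
  (forall m, \sum_(0 <= j < m) u j <= C) -> (\sum_(0 <= j <oo) (u j)%:E <= C%:E)%E.
Proof.
move=> u0 uC; apply: lime_le.
  by apply: is_cvg_nneseries => j _ _; rewrite lee_fin.
by apply: nearW => m; rewrite sumEFin lee_fin.
Qed.

(** Riesz-Fischer. The modulus [t k] is kept in the conclusion, so the whole sequence, and not just
    a subsequence, converges to [v] at that rate. *)
Lemma L2_complete (g : nat -> T -> R) (t : nat -> \bar R) :
  (forall k, measurable_fun setT (g k)) ->
  (forall k l, (k <= l)%N -> \int[mu]_x ((g k x - g l x) ^+ 2)%:E <= t k)%E ->
  t @ \oo --> 0%E ->
  exists v : T -> R, measurable_fun setT v /\
    forall k, (\int[mu]_x ((g k x - v x) ^+ 2)%:E <= t k)%E.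
Proof.
move=> mg gt t0.
have tge0 k : (0 <= t k)%E by apply: le_trans (gt k k (leqnn _)); exact: integral_sqr_ge0.
(* The rate 4^-j leaves 2^-j after multiplication by the weight 2^j introduced below. *)
have H j : exists k, forall l, (k <= l)%N -> (t l <= (4^-1 ^+ j)%:E)%E.
  have e0 : 0 < (4^-1 ^+ j : R) by rewrite exprn_gt0.
  have [k _ kH] := (ge0_cvge0P tge0).1 t0 _ e0.
  by exists k => l kl; exact: kH.
have {H}[phi0 phi0P] := choice H.
(* Summing the thresholds makes the indices nondecreasing; adding [j] makes them unbounded. *)
pose phi j := (\sum_(i < j.+1) phi0 i + j)%N.
have phi_ge j : (phi0 j <= phi j)%N.
  by rewrite /phi big_ord_recr/= -addnA addnCA leq_addr.
have phiS j : (phi j <= phi j.+1)%N.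
  by rewrite /phi [X in (_ <= X + _)%N]big_ord_recr/= leq_add// leq_addr.
have phi_id j k : (k <= phi (j + k))%N by rewrite /phi addnA leq_addl.
pose D j x := g (phi j.+1) x - g (phi j) x.
have mD j : measurable_fun setT (D j) by exact: measurable_funB.
have D2 j : (\int[mu]_x (D j x ^+ 2)%:E <= (4^-1 ^+ j)%:E)%E.
  apply: le_trans (phi0P j (phi j) (phi_ge j)); apply: le_trans (gt _ _ (phiS j)).
  by under eq_integral do rewrite /D -sqrrN opprB.
(* The weight 2^j gives |D_j| <= 2^-j + 2^j D_j^2, so wherever the sum [h] is finite the telescoping
   series converges absolutely. *)
pose hj j x : R := 2 ^+ j * D j x ^+ 2.
have hj0 j x : 0 <= hj j x by rewrite mulr_ge0 ?sqr_ge0// exprn_ge0.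
have mhj j : measurable_fun setT (fun x => (hj j x)%:E).
  by apply/measurable_EFinP; apply: measurable_funM => //; exact: measurable_funX.
pose h x := (\sum_(0 <= j <oo) (hj j x)%:E)%E.
have mh : measurable_fun setT h.
  apply: (@ge0_emeasurable_sum _ _ _ _ (fun j x => (hj j x)%:E) xpredT) => //.
  by move=> j x _ _; rewrite lee_fin.
have h0 x : (0 <= h x)%E by apply: nneseries_ge0 => j _ _; rewrite lee_fin.
have inth : (\int[mu]_x h x <= 2%:E)%E.
  rewrite integral_nneseries//; last by move=> j x _; rewrite lee_fin.
  apply: lime_le.
    by apply: is_cvg_nneseries => j _ _; apply: integral_ge0 => x _; rewrite lee_fin.
  apply: nearW => m; apply: (@le_trans _ _ (\sum_(0 <= j < m) (2^-1 ^+ j : R)%:E)%E); last first.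
    by rewrite sumEFin lee_fin sum_half_le2.
  apply: lee_sum => j _; rewrite /hj.
  under eq_integral do rewrite EFinM.
  rewrite ge0_integralZl_EFin//.
  - apply: (@le_trans _ _ ((2 ^+ j)%:E * (4^-1 ^+ j)%:E)%E).
      by apply: lee_wpmul2l => //; rewrite lee_fin exprn_ge0.
    rewrite -EFinM -exprMn lee_fin.
    by have -> : (2 * 4^-1 = 2^-1 :> R) by lra.
  - by move=> x _; rewrite lee_fin sqr_ge0.
  - exact: measurable_sqr.
pose A := [set x | (h x < +oo)%E].
have mA : measurable A by rewrite -[A]setTI; exact: emeasurable_fun_infty_o.
have aeA : {ae mu, forall x, A x}.
  have ih : mu.-integrable setT h.
    apply/integrableP; split => //; under eq_integral do rewrite gee0_abs//.
    by rewrite (le_lt_trans inth)// ltry.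
  have := integrable_ae measurableT ih; apply: filterS => x /(_ I) hx.
  by rewrite /A/= ltey_eq hx.
have cA x : A x -> cvgn (fun j => g (phi j) x).
  move=> Ax.
  have : cvgn (series (telescope (fun j => g (phi j) x))).
    apply: normed_cvg; apply: nondecreasing_is_cvgn.
      by apply: nondecreasing_series => k _ _ /=; exact: normr_ge0.
    exists (2 + fine (h x)) => _ [m _ <-].
    apply: (@le_trans _ _ (\sum_(0 <= j < m) (2^-1 ^+ j + hj j x))).
      apply: ler_sum => j _; rewrite /= /telescope -/(D j x) /hj.
      have a0 : 0 < (2 ^+ j : R) by rewrite exprn_gt0.
      rewrite exprVn -[D j x ^+ 2]real_normK ?num_real//.
      move: `|D j x| (normr_ge0 (D j x)) => y y0.
      have ai0 : 0 < (2 ^+ j)^-1 :> R by rewrite invr_gt0.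
      have aai : 2 ^+ j * (2 ^+ j)^-1 = 1 :> R by rewrite mulfV// gt_eqF.
      move: (2 ^+ j) (2 ^+ j)^-1 a0 ai0 aai => a b a0 b0 ab.
      (* With a = 2^j and b = 1 / a: 0 <= b (a y - 1)^2 = a y^2 - 2y + b, hence y <= b + a y^2 for y
         >= 0. *)
      have := sqr_ge0 (a * y - 1); rewrite expr2 => E.
      have : 0 <= b * ((a * y - 1) * (a * y - 1)) by rewrite mulr_ge0// ltW.
      have -> : b * ((a * y - 1) * (a * y - 1)) =
        (a * b) * (a * y ^+ 2) - 2 * (a * b) * y + b by ring.
      by rewrite ab !mul1r; lra.
    rewrite big_split/=; apply: lerD; first exact: sum_half_le2.
    have hfin : h x \is a fin_num by rewrite ge0_fin_numE.
    rewrite -lee_fin fineK// -sumEFin; apply: (@nneseries_lim_ge _ (fun j => (hj j x)%:E)).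
    by move=> j _ _; rewrite lee_fin.
  rewrite telescopeK => c.
  rewrite (_ : (fun j => g (phi j) x) =
    (fun j => (g (phi j) x - g (phi 0%N) x) + g (phi 0%N) x)); last first.
    by apply/funext => j; rewrite subrK.
  by apply: is_cvgD => //; exact: is_cvg_cst.
(* The value 0 on the null set outside [A] makes [v] an everywhere pointwise limit of measurable
   functions. *)
pose v x := if x \in A then limn (fun j => g (phi j) x) else 0.
have gv x : g (phi j) x * \1_A x @[j --> \oo] --> v x.
  rewrite /v indicE; case: ifPn => xA.
    under eq_fun do rewrite mulr1.
    by apply: cA; rewrite inE in xA.
  under eq_fun do rewrite mulr0.
  exact: cvg_cst.
have mgA j : measurable_fun setT (fun x => g (phi j) x * \1_A x).
  by apply: measurable_funM.
exists v; split.
  by apply: (measurable_fun_cvg (h := fun j x => g (phi j) x * \1_A x)).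
move=> k.
apply: (@fatou_bound (fun j x => ((g k x - g (phi (j + k)%N) x * \1_A x) ^+ 2)%:E)).
- by move=> j; apply: measurable_sqr; apply: measurable_funB.
- by move=> j x; rewrite lee_fin sqr_ge0.
- move=> x; apply: cvg_EFin; first by apply: nearW.
  have c : g k x - g (phi (j + k)%N) x * \1_A x @[j --> \oo] --> g k x - v x.
    apply: cvgB; first exact: cvg_cst.
    by rewrite (cvg_shiftn k (fun j => g (phi j) x * \1_A x)).
  rewrite (_ : fine \o _ = (fun j => (g k x - g (phi (j + k)%N) x * \1_A x) *
     (g k x - g (phi (j + k)%N) x * \1_A x))); last by apply/funext => j /=; rewrite expr2.
  by rewrite expr2; exact: cvgM.
- move=> j; apply: le_trans (gt k (phi (j + k)) (phi_id j k)).
  rewrite (@ge0_ae_eq_integral _ _ _ mu setT _ (fun x => ((g k x - g (phi (j + k)%N) x) ^+ 2)%:E))//.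
  + by apply: measurable_sqr; apply: measurable_funB.
  + by apply: measurable_sqr; apply: measurable_funB.
  + by move=> x _; rewrite lee_fin sqr_ge0.
  + by move=> x _; rewrite lee_fin sqr_ge0.
  + move: aeA; apply: filterS => x Ax _.
    by rewrite indicE mem_set// mulr1.
Qed.

(** Peter-Paul: the squared norms of [f_ k] and [f] differ by at most de |f|^2 + (1 + 1/de) |f_k -
    f|^2 in either direction. First [de] is chosen small, then [k] large. *)
Lemma cvg_integral_sqr (f_ : nat -> T -> R) (f : T -> R) :
  (forall k, measurable_fun setT (f_ k)) -> measurable_fun setT f ->
  (\int[mu]_x (f x ^+ 2)%:E < +oo)%E ->
  (\int[mu]_x ((f_ k x - f x) ^+ 2)%:E)%E @[k --> \oo] --> 0%E ->
  (\int[mu]_x (f_ k x ^+ 2)%:E)%E @[k --> \oo] --> (\int[mu]_x (f x ^+ 2)%:E)%E.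
Proof.
move=> mf_ mf f2 c0.
have I0 (q : T -> R) : (0 <= \int[mu]_x (q x ^+ 2)%:E)%E by exact: integral_sqr_ge0.
have ffin : (\int[mu]_x (f x ^+ 2)%:E)%E \is a fin_num by rewrite ge0_fin_numE.
have key (p q r : T -> R) (de : R) : measurable_fun setT p -> measurable_fun setT q ->
    measurable_fun setT r -> 0 < de ->
    (forall x, p x ^+ 2 <= q x ^+ 2 + (de * f x ^+ 2 + (1 + de^-1) * r x ^+ 2)) ->
    (\int[mu]_x (p x ^+ 2)%:E <= \int[mu]_x (q x ^+ 2)%:E +
     (de%:E * \int[mu]_x (f x ^+ 2)%:E + (1 + de^-1)%:E * \int[mu]_x (r x ^+ 2)%:E))%E.
  move=> mp mq mr de0 le.
  have d1 : 0 <= 1 + de^-1 by rewrite addr_ge0// invr_ge0 ltW.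
  have m1 : measurable_fun setT (fun x => de%:E * (f x ^+ 2)%:E)%E.
    by apply: measurable_funeM; exact: measurable_sqr.
  have m2 : measurable_fun setT (fun x => (1 + de^-1)%:E * (r x ^+ 2)%:E)%E.
    by apply: measurable_funeM; exact: measurable_sqr.
  have p1 x : (0 <= de%:E * (f x ^+ 2)%:E)%E.
    by rewrite -EFinM lee_fin mulr_ge0 ?sqr_ge0// ltW.
  have p2 x : (0 <= (1 + de^-1)%:E * (r x ^+ 2)%:E)%E.
    by rewrite -EFinM lee_fin mulr_ge0 ?sqr_ge0.
  rewrite -(@ge0_integralZl_EFin _ _ _ mu setT measurableT (fun x => (f x ^+ 2)%:E))//;
    [|by move=> x _; rewrite lee_fin sqr_ge0|exact: measurable_sqr|exact: ltW].
  rewrite -(@ge0_integralZl_EFin _ _ _ mu setT measurableT (fun x => (r x ^+ 2)%:E))//;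
    [|by move=> x _; rewrite lee_fin sqr_ge0|exact: measurable_sqr].
  rewrite -ge0_integralD// -ge0_integralD//; last 4 first.
  - by move=> x _; rewrite lee_fin sqr_ge0.
  - exact: measurable_sqr.
  - by move=> x _; rewrite adde_ge0.
  - exact: emeasurable_funD.
  apply: ge0_le_integralT.
  - exact: measurable_sqr.
  - by apply: emeasurable_funD; [exact: measurable_sqr|exact: emeasurable_funD].
  - by move=> x; rewrite lee_fin sqr_ge0.
  - by move=> x; rewrite -!EFinM -!EFinD lee_fin.
have small eta : 0 < eta -> exists2 de : R, 0 < de & \forall k \near \oo,
    (de%:E * \int[mu]_x (f x ^+ 2)%:E + (1 + de^-1)%:E *
      \int[mu]_x ((f_ k x - f x)%R ^+ 2)%:E <= eta%:E)%E.
  move=> eta0; pose F := fine (\int[mu]_x (f x ^+ 2)%:E)%E.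
  have F0 : 0 <= F by rewrite fine_ge0.
  (* Then de F <= eta / 2; the summand 1 covers the case F = 0. *)
  pose de := eta / (2 * (F + 1)).
  have de0 : 0 < de by rewrite divr_gt0// mulr_gt0// ltr_wpDl.
  exists de => //.
  have d1 : 0 < 1 + de^-1 by rewrite addr_gt0// invr_gt0.
  have e0 : 0 < eta / 2 / (1 + de^-1) by rewrite !divr_gt0.
  have := (ge0_cvge0P (fun k => I0 (fun x => f_ k x - f x))).1 c0 _ e0.
  apply: filterS => k Hk.
  rewrite -(fineK ffin) -/F (_ : eta%:E = (eta / 2)%:E + (eta / 2)%:E)%E; last first.
    by rewrite -EFinD; congr EFin; lra.
  apply: leeD.
    rewrite -EFinM lee_fin /de mulrAC ler_pdivrMr ?mulr_gt0// ?ltr_wpDl//.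
    have -> : eta / 2 * (2 * (F + 1)) = eta * F + eta by field.
    by rewrite lerDl ltW.
  apply: (@le_trans _ _ ((1 + de^-1)%:E * (eta / 2 / (1 + de^-1))%:E)%E).
    by apply: lee_pmul => //; rewrite lee_fin ltW.
  by rewrite -EFinM lee_fin mulrC divfK// gt_eqF.
have alg1 (a b de : R) : 0 < de -> a ^+ 2 <= b ^+ 2 + (de * b ^+ 2 + (1 + de^-1) * (a - b) ^+ 2).
  move=> de0; have di0 : 0 < de^-1 by rewrite invr_gt0.
  have E : 0 <= de^-1 * (de * b - (a - b)) ^+ 2 by rewrite mulr_ge0 ?sqr_ge0// ltW.
  have dd : de^-1 * de = 1 by rewrite mulVf// gt_eqF.
  have E2 : de^-1 * (de * b - (a - b)) ^+ 2 = (de^-1 * de) * (de * b ^+ 2) -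
    2 * (de^-1 * de) * b * (a - b) + de^-1 * (a - b) ^+ 2 by ring.
  rewrite E2 dd in E; have E3 : a ^+ 2 = b ^+ 2 + 2 * b * (a - b) + (a - b) ^+ 2 by ring.
  by rewrite E3; lra.
have alg2 (a b de : R) : 0 < de -> b ^+ 2 <= a ^+ 2 + (de * b ^+ 2 + (1 + de^-1) * (a - b) ^+ 2).
  move=> de0; have di0 : 0 < de^-1 by rewrite invr_gt0.
  have E : 0 <= de^-1 * (de * b + (a - b)) ^+ 2 by rewrite mulr_ge0 ?sqr_ge0// ltW.
  have dd : de^-1 * de = 1 by rewrite mulVf// gt_eqF.
  have E2 : de^-1 * (de * b + (a - b)) ^+ 2 = (de^-1 * de) * (de * b ^+ 2) +
    2 * (de^-1 * de) * b * (a - b) + de^-1 * (a - b) ^+ 2 by ring.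
  rewrite E2 dd in E; have E3 : a ^+ 2 = b ^+ 2 + 2 * b * (a - b) + (a - b) ^+ 2 by ring.
  have := sqr_ge0 (a - b).
  by rewrite E3; lra.
have mB k : measurable_fun setT (fun x => f_ k x - f x) by exact: measurable_funB.
rewrite -(fineK ffin); apply/fine_cvgP; split.
  have [de de0 H] := small 1 ltr01; move: H; apply: filterS => k Hk.
  rewrite ge0_fin_numE//.
  apply: (le_lt_trans (key _ _ _ _ (mf_ k) mf (mB k) de0 (fun x => alg1 _ _ _ de0))).
  by rewrite lte_add_pinfty// (le_lt_trans Hk)// ltry.
apply/cvgrPdist_le => eta eta0.
have [de de0 H] := small _ eta0; move: H; apply: filterS => k Hk.
have k1 := key _ _ _ _ (mf_ k) mf (mB k) de0 (fun x => alg1 _ _ _ de0).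
have k2 := key _ _ _ _ mf (mf_ k) (mB k) de0 (fun x => alg2 _ _ _ de0).
have k1' := le_trans k1 (leeD2l _ Hk).
have k2' := le_trans k2 (leeD2l _ Hk).
have kfin : (\int[mu]_x (f_ k x ^+ 2)%:E)%E \is a fin_num.
  by rewrite ge0_fin_numE// (le_lt_trans k1')// -(fineK ffin) -EFinD ltry.
move: k1' k2'; rewrite -(fineK ffin) -(fineK kfin) -!EFinD !lee_fin /= => ? ?.
by rewrite ler_norml; apply/andP; split; lra.
Qed.

End square_integrable.

Section Lfun2.
Context d (T : measurableType d) {R : realType} (mu : {measure set T -> \bar R}).

Lemma Lfun2P (f : T -> R) : f \in Lfun mu 2%:E <->
  measurable_fun setT f /\ (\int[mu]_x (f x ^+ 2)%:E < +oo)%E.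
Proof.
split=> [fL|[mf f2]].
  split; first by move: (sub_Lfun_mfun fL); rewrite inE.
  have /integrableP[_] := Lfun2_integrable_sqr fL.
  by under eq_integral do rewrite /= ger0_norm ?sqr_ge0//.
rewrite inE; apply/andP; split; rewrite inE//=.
rewrite /finite_norm unlock.
rewrite (eq_integral (fun x => (f x ^+ 2)%:E)); last first.
  by move=> x _; rewrite /= powR_mulrn// real_normK// num_real.
rewrite poweR12_sqrt; last exact: integral_sqr_ge0.
rewrite -ge0_fin_numE ?sqrte_ge0// sqrte_fin_num ?integral_sqr_ge0//.
by rewrite ge0_fin_numE// integral_sqr_ge0.
Qed.

End Lfun2.

(** * Construction of the transform on L2 *)

Section fourier_transform.
Context {R : realType} (n : nat).
Local Notation leb := (@lebesgue_tuple R n).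
Local Notation Rn := (n.-tuple R).
Implicit Types u f : Rn -> R.

Lemma L2P u : L2 n u <->
  measurable_fun setT u /\ (\int[leb]_x (u x ^+ 2)%:E < +oo)%E.
Proof. exact: Lfun2P. Qed.

Lemma sqr_L2norm u : (L2norm u ^+ 2 = \int[leb]_x (u x ^+ 2)%:E)%E.
Proof.
rewrite /L2norm unlock.
rewrite (eq_integral (fun x => (u x ^+ 2)%:E)); last first.
  by move=> x _; rewrite /= powR_mulrn// real_normK// num_real.
by rewrite poweR12_sqrt ?sqr_sqrte//; exact: integral_sqr_ge0.
Qed.

Definition fourier_cst : R := (2 * pi) `^ (- (n%:R / 2)).

Lemma fourier_cst_sqr : fourier_cst ^+ 2 * (2 * pi) ^+ n = 1.
Proof.
have p0 : 0 < 2 * pi :> R by rewrite mulr_gt0// pi_gt0.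
rewrite /fourier_cst -powR_mulrn ?powR_ge0// -powRrM.
rewrite -(powR_mulrn _ (ltW p0)) -powRD; last by apply/implyP => _; rewrite gt_eqF.
by rewrite mulNr divfK// addNr powRr0.
Qed.

Definition hatre f xi : R := fourier_cst * cosint f xi.
Definition hatim f xi : R := - (fourier_cst * sinint f xi).

Lemma sqr_normc (a b : R) : Normc.normc (a +i* b)%C ^+ 2 = a ^+ 2 + b ^+ 2.
Proof. by rewrite /= sqr_sqrtr// addr_ge0 ?sqr_ge0. Qed.

Lemma sqr_normcE (z : R[i]) :
  Normc.normc z ^+ 2 = complex.Re z ^+ 2 + complex.Im z ^+ 2.
Proof. by case: z => a b; rewrite sqr_normc. Qed.

Lemma fourier_intE f xi : leb.-integrable setT (EFin \o f) ->
  fourier_int f xi = (hatre f xi +i* hatim f xi)%C.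
Proof.
move=> fi.
have iS := integrableMbounded fi (measurable_sin_dotp xi) (fun x => sin_norm_le1 _).
have -> : fourier_int f xi = ((fourier_cst *
    \int[leb]_x complex.Re (expi (- dotp xi x) * (f x)%:C)%C - 0 *
    \int[leb]_x complex.Im (expi (- dotp xi x) * (f x)%:C)%C) +i*
  (fourier_cst * \int[leb]_x complex.Im (expi (- dotp xi x) * (f x)%:C)%C +
   0 * \int[leb]_x complex.Re (expi (- dotp xi x) * (f x)%:C)%C))%C by [].
rewrite !mul0r subr0 addr0 /hatre /hatim.
have -> : \int[leb]_x complex.Re (expi (- dotp xi x) * (f x)%:C)%C = cosint f xi.
  by apply: eq_Rintegral => x _ /=; rewrite cosN mulr0 subr0 mulrC.
have -> : \int[leb]_x complex.Im (expi (- dotp xi x) * (f x)%:C)%C = - sinint f xi.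
  rewrite -mulN1r -RintegralZl//.
  by apply: eq_Rintegral => x _ /=; rewrite sinN mulr0 add0r mulNr mulrC mulN1r.
by rewrite mulrN.
Qed.

Lemma measurable_hatre f : leb.-integrable setT (EFin \o f) -> measurable_fun setT (hatre f).
Proof. by move=> fi; apply: measurable_funM => //; exact: measurable_cosint. Qed.

Lemma measurable_hatim f : leb.-integrable setT (EFin \o f) -> measurable_fun setT (hatim f).
Proof.
move=> fi; apply: measurable_funN; apply: measurable_funM => //.
exact: measurable_sinint.
Qed.

Lemma hat_sqrE f xi : hatre f xi ^+ 2 + hatim f xi ^+ 2 =
  fourier_cst ^+ 2 * (cosint f xi ^+ 2 + sinint f xi ^+ 2).
Proof. by rewrite /hatre /hatim sqrrN !exprMn mulrDr. Qed.

Lemma plancherel_hat f : leb.-integrable setT (EFin \o f) ->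
  (\int[leb]_x (f x ^+ 2)%:E < +oo)%E ->
  (\int[leb]_xi (hatre f xi ^+ 2 + hatim f xi ^+ 2)%:E = \int[leb]_x (f x ^+ 2)%:E)%E.
Proof.
move=> fi f2; under eq_integral do rewrite hat_sqrE EFinM.
rewrite ge0_integralZl_EFin//.
- by rewrite plancherel_L1_L2// muleA -EFinM fourier_cst_sqr mul1e.
- by move=> xi _; rewrite lee_fin addr_ge0 ?sqr_ge0.
- apply/measurable_EFinP; apply: measurable_funD; apply: measurable_funX;
    [exact: measurable_cosint|exact: measurable_sinint].
- exact: sqr_ge0.
Qed.

Lemma hatreB f g xi : leb.-integrable setT (EFin \o f) ->
  leb.-integrable setT (EFin \o g) ->
  hatre (fun x => f x - g x) xi = hatre f xi - hatre g xi.
Proof.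
move=> fi gi; rewrite /hatre -mulrBr; congr (_ * _).
have iF := integrableMbounded fi (measurable_cos_dotp xi) (fun x => cos_norm_le1 _).
have iG := integrableMbounded gi (measurable_cos_dotp xi) (fun x => cos_norm_le1 _).
by rewrite -RintegralB//; apply: eq_Rintegral => x _; rewrite mulrBl.
Qed.

Lemma hatimB f g xi : leb.-integrable setT (EFin \o f) ->
  leb.-integrable setT (EFin \o g) ->
  hatim (fun x => f x - g x) xi = hatim f xi - hatim g xi.
Proof.
move=> fi gi; rewrite /hatim opprK addrC -opprB -mulrBr; congr (- (_ * _)).
have iF := integrableMbounded fi (measurable_sin_dotp xi) (fun x => sin_norm_le1 _).
have iG := integrableMbounded gi (measurable_sin_dotp xi) (fun x => sin_norm_le1 _).
by rewrite -RintegralB//; apply: eq_Rintegral => x _; rewrite mulrBl.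
Qed.

Lemma measurable_enorm : measurable_fun [set: Rn] (@enorm R n).
Proof.
rewrite /enorm; apply: (@measurableT_comp _ _ _ _ _ _ (@Num.sqrt R)).
  by apply: continuous_measurable_fun; exact: sqrt_continuous.
by apply: measurable_fun_dotp.
Qed.

Lemma measurable_ball0 k : measurable (@Defs.ball0 R n k).
Proof.
rewrite -[Defs.ball0 k]setTI /Defs.ball0.
have := measurable_fun_ler measurable_enorm (measurable_cst (k%:R : R)).
move=> /(_ measurableT [set true]); rewrite setTI; exact.
Qed.

Lemma tnth_le_enorm (x : Rn) i : `|tnth x i| <= enorm x.
Proof.
rewrite -sqrtr_sqr /enorm ler_sqrt; last by apply: sumr_ge0 => j _; rewrite -expr2 sqr_ge0.
rewrite /dotp (bigD1 i)//= -expr2 lerDl.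
by apply: sumr_ge0 => j _; rewrite -expr2 sqr_ge0.
Qed.

(** Balls are enclosed in cubes because the integral of a product indicator is known. *)
Lemma indic_ball0_le k (x : Rn) : \1_(Defs.ball0 k) x <= prodt (\1_(`[- k%:R, k%:R]%classic : set R)) x.
Proof.
rewrite indicE; case: (boolP (x \in _)) => [xk|_]; last first.
  by apply: prodt_ge0 => t; rewrite indicE.
rewrite /prodt big1// => i _; rewrite indicE mem_set//=.
rewrite in_itv/= -ler_norml; apply: (le_trans (tnth_le_enorm x i)).
by move: xk; rewrite inE.
Qed.

Definition trunc u k (x : Rn) : R := u x * \1_(Defs.ball0 k) x.

Section truncation.
Variable u : Rn -> R.
Hypothesis L2u : L2 n u.

Let mu : measurable_fun setT u. Proof. by have /L2P[] := L2u. Qed.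

Let u2 : (\int[leb]_x (u x ^+ 2)%:E < +oo)%E. Proof. by have /L2P[] := L2u. Qed.

Lemma measurable_trunc k : measurable_fun setT (trunc u k).
Proof.
apply: measurable_funM => //; apply: measurable_indic; exact: measurable_ball0.
Qed.

Let trunc_sqr_le k x : trunc u k x ^+ 2 <= u x ^+ 2.
Proof.
rewrite /trunc indicE; case: (x \in _); first by rewrite mulr1.
by rewrite mulr0 expr0n sqr_ge0.
Qed.

Lemma trunc_sqr_lty k : (\int[leb]_x (trunc u k x ^+ 2)%:E < +oo)%E.
Proof.
apply: le_lt_trans u2; apply: ge0_le_integralT.
- exact: measurable_sqr (measurable_trunc k).
- exact: measurable_sqr.
- by move=> x; rewrite lee_fin sqr_ge0.
- by move=> x; rewrite lee_fin.
Qed.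

Lemma integrable_trunc k : leb.-integrable setT (EFin \o trunc u k).
Proof.
apply: integrable_EFinP; first exact: measurable_trunc.
pose I := \1_(`[- k%:R, k%:R]%classic : set R) : R -> R.
have mI : measurable_fun setT I by apply: measurable_indic; exact: measurable_itv.
have I0 t : 0 <= I t by rewrite /I indicE.
have mpI := measurable_prodt (n := n) mI.
(* On the ball |u| <= u^2 + 1, and [prodt I] is at least the indicator of the ball. *)
apply: (@le_lt_trans _ _ (\int[leb]_x ((u x ^+ 2)%:E + (prodt I x)%:E))%E).
  apply: ge0_le_integralT.
  - by apply/measurable_EFinP; apply: measurableT_comp => //; exact: measurable_trunc.
  - by apply: emeasurable_funD; [exact: measurable_sqr|exact/measurable_EFinP].
  - by move=> x; rewrite lee_fin.
  - move=> x; rewrite -EFinD lee_fin.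
    have := indic_ball0_le k x; rewrite /trunc indicE; case: (x \in _) => H.
      rewrite mulr1; apply: (@le_trans _ _ (u x ^+ 2 + 1)); last by rewrite lerD2l.
      rewrite -(real_normK (num_real (u x))).
      have := sqr_ge0 (`|u x| - 2^-1); have := normr_ge0 (u x); rewrite !expr2; nra.
    by rewrite mulr0 normr0 addr_ge0 ?sqr_ge0.
rewrite ge0_integralD//.
- apply: lte_add_pinfty => //; rewrite ge0_integral_prodt//.
  have -> : (\int[@lebesgue_measure R]_x (I x)%:E)%E =
      lebesgue_measure (`[- k%:R, k%:R]%classic : set R).
    by rewrite integral_indic ?setIT//; exact: measurable_itv.
  by rewrite lebesgue_measure_itv/=; case: ifP => _; rewrite -?EFinD -EFin_expe ltry.
- by move=> x _; rewrite lee_fin sqr_ge0.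
- exact: measurable_sqr.
- by move=> x _; rewrite lee_fin prodt_ge0.
- exact/measurable_EFinP.
Qed.

Lemma trunc_near x : \forall k \near \oo, trunc u k x = u x.
Proof.
near=> k; rewrite /trunc indicE mem_set ?mulr1//=.
by near: k; exact: nbhs_infty_ger.
Unshelve. all: by end_near. Qed.

Lemma trunc_cvg : (\int[leb]_x ((u x - trunc u k x) ^+ 2)%:E)%E @[k --> \oo] --> 0%E.
Proof.
apply: (@ge0_dominated_cvg0 _ _ _ leb (fun k x => ((u x - trunc u k x) ^+ 2)%:E)
  (fun x => (u x ^+ 2)%:E)) => //.
- by move=> k; apply: measurable_sqr; apply: measurable_funB => //; exact: measurable_trunc.
- exact: measurable_sqr.
- by move=> k x; rewrite lee_fin sqr_ge0.
- move=> k x; rewrite lee_fin /trunc indicE; case: (x \in _).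
    by rewrite mulr1 subrr expr0n sqr_ge0.
  by rewrite mulr0 subr0.
- move=> x _; apply: cvg_near_cst; have := trunc_near x; apply: filterS => k ->.
  by rewrite subrr expr0n.
Qed.

Let truncB_le k l x : (k <= l)%N ->
  (trunc u k x - trunc u l x) ^+ 2 <= (u x - trunc u k x) ^+ 2.
Proof.
move=> kl; rewrite /trunc !indicE.
have [xk|xk] := boolP (x \in Defs.ball0 k).
  rewrite (_ : x \in Defs.ball0 l = true); first by rewrite mulr1 !subrr.
  apply/idP; move: xk; rewrite !inE /Defs.ball0/= => xk; apply: (le_trans xk).
  by rewrite ler_nat.
rewrite mulr0 sub0r subr0 sqrrN; case: (x \in _); first by rewrite mulr1.
by rewrite mulr0 expr0n sqr_ge0.
Qed.

Lemma hat_trunc_cauchy k l : (k <= l)%N ->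
  (\int[leb]_xi ((hatre (trunc u k) xi - hatre (trunc u l) xi) ^+ 2 +
     (hatim (trunc u k) xi - hatim (trunc u l) xi) ^+ 2)%:E <=
   \int[leb]_x ((u x - trunc u k x) ^+ 2)%:E)%E.
Proof.
move=> kl.
pose g x := trunc u k x - trunc u l x.
have ig : leb.-integrable setT (EFin \o g).
  by apply: integrable_EFinB; exact: integrable_trunc.
have mg : measurable_fun setT g by apply: measurable_funB; exact: measurable_trunc.
have gle : (\int[leb]_x (g x ^+ 2)%:E <= \int[leb]_x ((u x - trunc u k x) ^+ 2)%:E)%E.
  apply: ge0_le_integralT.
  - exact: measurable_sqr.
  - by apply: measurable_sqr; apply: measurable_funB => //; exact: measurable_trunc.
  - by move=> x; rewrite lee_fin sqr_ge0.
  - by move=> x; rewrite lee_fin; exact: truncB_le.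
have g2 : (\int[leb]_x (g x ^+ 2)%:E < +oo)%E.
  apply: (@le_lt_trans _ _ (\int[leb]_x (u x ^+ 2)%:E)%E) => //; apply: ge0_le_integralT.
  - exact: measurable_sqr.
  - exact: measurable_sqr.
  - by move=> x; rewrite lee_fin sqr_ge0.
  - move=> x; rewrite lee_fin; apply: (le_trans (truncB_le x kl)).
    rewrite /trunc indicE; case: (x \in _); first by rewrite mulr1 subrr expr0n sqr_ge0.
    by rewrite mulr0 subr0.
apply: le_trans gle; rewrite -(plancherel_hat ig g2).
rewrite le_eqVlt; apply/orP; left; apply/eqP; apply: eq_integral => xi _.
by rewrite hatreB ?hatimB//; exact: integrable_trunc.
Qed.

(** Shows that the choice defining [fourier u] is not its default. The transforms of the truncations
    are Cauchy by Plancherel applied to their differences; completeness gives limits of the real and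
    imaginary parts separately. *)
Lemma fourierP : is_fourier u (fourier u).
Proof.
apply: xgetPex.
pose t k := (\int[leb]_x ((u x - trunc u k x) ^+ 2)%:E)%E.
have mre k := measurable_hatre (integrable_trunc k).
have mim k := measurable_hatim (integrable_trunc k).
have split2 (a b : Rn -> R) : measurable_fun setT a -> measurable_fun setT b ->
    (\int[leb]_x (a x ^+ 2 + b x ^+ 2)%:E =
     \int[leb]_x (a x ^+ 2)%:E + \int[leb]_x (b x ^+ 2)%:E)%E.
  move=> ma mb; under eq_integral do rewrite EFinD.
  by rewrite ge0_integralD//; try (by move=> x _; rewrite lee_fin sqr_ge0);
    exact: measurable_sqr.
have mreB k l := measurable_funB (mre k) (mre l).
have mimB k l := measurable_funB (mim k) (mim l).
have [vr [mvr vrt]] : exists v : Rn -> R, measurable_fun setT v /\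
    forall k, (\int[leb]_xi ((hatre (trunc u k) xi - v xi) ^+ 2)%:E <= t k)%E.
  apply: L2_complete => //; last exact: trunc_cvg.
  move=> k l kl; apply: le_trans (hat_trunc_cauchy kl).
  by rewrite (split2 _ _ (mreB k l) (mimB k l)) leeDl// integral_sqr_ge0.
have [vi [mvi vit]] : exists v : Rn -> R, measurable_fun setT v /\
    forall k, (\int[leb]_xi ((hatim (trunc u k) xi - v xi) ^+ 2)%:E <= t k)%E.
  apply: L2_complete => //; last exact: trunc_cvg.
  move=> k l kl; apply: le_trans (hat_trunc_cauchy kl).
  by rewrite (split2 _ _ (mreB k l) (mimB k l)) leeDr// integral_sqr_ge0.
(* The limits are square integrable because their squared distance to the transform of the
   truncation of index 0 is at most the finite number [t 0]. *)
have t0fin : (t 0%N < +oo)%E.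
  have m0 := measurable_trunc 0.
  have := integral_sqrB_le2 leb mu m0 (measurable_cst (0 : R)).
  move/le_lt_trans; apply; rewrite /cst.
  under eq_integral do rewrite subr0.
  under [X in (_ + _ * X)%E]eq_integral do rewrite sub0r sqrrN.
  by apply: lte_add_pinfty; apply: lte_mul_pinfty => //; exact: trunc_sqr_lty.
have fin2 (a v : Rn -> R) : measurable_fun setT a -> measurable_fun setT v ->
    (\int[leb]_x (a x ^+ 2)%:E < +oo)%E ->
    (\int[leb]_x ((a x - v x) ^+ 2)%:E <= t 0%N)%E ->
    (\int[leb]_x (v x ^+ 2)%:E < +oo)%E.
  move=> ma mv a2 avt.
  have := integral_sqrB_le2 leb mv (measurable_cst (0 : R)) ma.
  rewrite /cst; under eq_integral do rewrite subr0.
  move/le_lt_trans; apply.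
  under eq_integral do rewrite -sqrrN opprB.
  under [X in (_ + _ * X)%E]eq_integral do rewrite subr0.
  by apply: lte_add_pinfty; apply: lte_mul_pinfty => //; exact: le_lt_trans avt _.
have hat2fin : (\int[leb]_xi (hatre (trunc u 0) xi ^+ 2)%:E < +oo)%E /\
    (\int[leb]_xi (hatim (trunc u 0) xi ^+ 2)%:E < +oo)%E.
  have := plancherel_hat (integrable_trunc 0) (trunc_sqr_lty 0).
  rewrite split2// => E.
  have := trunc_sqr_lty 0; rewrite -E => H.
  split; apply: le_lt_trans H.
    by rewrite leeDl// integral_sqr_ge0.
  by rewrite leeDr// integral_sqr_ge0.
exists (fun xi => (vr xi +i* vi xi)%C); split.
- by apply/Lfun2P; split => //; exact: fin2 (mre 0%N) mvr hat2fin.1 (vrt 0%N).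
- by apply/Lfun2P; split => //; exact: fin2 (mim 0%N) mvi hat2fin.2 (vit 0%N).
- apply: (@ge0_squeeze_cvge0 _ _ (fun k => t k + t k)%E).
  + by move=> k; apply: integral_ge0 => xi _; rewrite lee_fin sqr_ge0.
  + move=> k.
    rewrite (eq_integral (fun xi => ((hatre (trunc u k) xi - vr xi) ^+ 2 +
      (hatim (trunc u k) xi - vi xi) ^+ 2)%:E)); last first.
      move=> xi _; rewrite fourier_intE; last exact: integrable_trunc.
      by rewrite [X in Normc.normc X](_ : _ = ((hatre (trunc u k) xi - vr xi) +i*
        (hatim (trunc u k) xi - vi xi))%C)// sqr_normc.
    rewrite split2; [exact: leeD|exact: measurable_funB|exact: measurable_funB].
  + rewrite -[X in _ --> X](adde0 0%E); apply: cvgeD => //; exact: trunc_cvg.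
Qed.

End truncation.

End fourier_transform.

(** * Increments, Plancherel and consistency with the L1 transform *)

Section fourier_properties.
Context {R : realType} (n : nat).
Local Notation leb := (@lebesgue_tuple R n).
Local Notation Rn := (n.-tuple R).

Lemma integrable_translate (h : Rn) (f : Rn -> R) : leb.-integrable setT (EFin \o f) ->
  leb.-integrable setT (EFin \o (fun x => f (addt x h))).
Proof.
move=> fi; have mf : measurable_fun setT f.
  by apply/measurable_EFinP; exact: measurable_int fi.
apply: integrable_EFinP; first exact: (measurableT_comp mf (measurable_addt h)).
have := integrable_EFin_lty fi.
rewrite -(ge0_integral_translate h (f := fun x => (`|f x|)%:E))//.
by apply/measurable_EFinP; exact: measurableT_comp.
Qed.

Lemma Rintegral_translate (h : Rn) (f : Rn -> R) : leb.-integrable setT (EFin \o f) ->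
  \int[leb]_x f (addt x h) = \int[leb]_x f x.
Proof.
move=> fi.
have mf : measurable_fun setT (EFin \o f) by exact: measurable_int fi.
have E1 : (\int[leb]_x ((fun x => (f (addt x h))%:E)^\+ x) =
    \int[leb]_x ((fun x => (f x)%:E)^\+ x))%E.
  rewrite -(ge0_integral_translate h (f := (EFin \o f)^\+)%E)//; last exact: measurable_funepos.
  by apply: eq_integral => x _; rewrite !funepos.unlock.
have E2 : (\int[leb]_x ((fun x => (f (addt x h))%:E)^\- x) =
    \int[leb]_x ((fun x => (f x)%:E)^\- x))%E.
  rewrite -(ge0_integral_translate h (f := (EFin \o f)^\-)%E)//; last exact: measurable_funeneg.
  by apply: eq_integral => x _; rewrite !funeneg.unlock.
congr fine; rewrite [LHS]integralE [RHS]integralE.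
by congr (_ - _)%E; [exact: E1|exact: E2].
Qed.

Lemma addt_subtK (x h : Rn) : subt (addt x h) h = x.
Proof. exact: subt_addtK. Qed.

(** A shift by [h] multiplies the transform by a unimodular exponential, and |e^(it) - 1|^2 = 2 (1 -
    cos t). In real terms the pair of cosine and sine parts is rotated by the angle xi . h. *)
Lemma hat_increment (f : Rn -> R) (h xi : Rn) : leb.-integrable setT (EFin \o f) ->
  let g x := f (addt x h) - f x in
  hatre g xi ^+ 2 + hatim g xi ^+ 2 =
  2 * (1 - cos (dotp xi h)) * (hatre f xi ^+ 2 + hatim f xi ^+ 2).
Proof.
move=> fi g.
have fh := integrable_translate h fi.
have iC := integrableMbounded fi (measurable_cos_dotp xi) (fun x => cos_norm_le1 _).
have iS := integrableMbounded fi (measurable_sin_dotp xi) (fun x => sin_norm_le1 _).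
set c := cos (dotp xi h); set s := sin (dotp xi h).
have cosx x : cos (dotp xi x) = cos (dotp xi (addt x h)) * c + sin (dotp xi (addt x h)) * s.
  by rewrite -[in LHS](addt_subtK x h) dotp_subtr cosB.
have sinx x : sin (dotp xi x) = sin (dotp xi (addt x h)) * c - cos (dotp xi (addt x h)) * s.
  by rewrite -[in LHS](addt_subtK x h) dotp_subtr sinB.
have Ch : cosint (fun x => f (addt x h)) xi = c * cosint f xi + s * sinint f xi.
  rewrite -!RintegralZl// -RintegralD//; try exact: integrable_EFinZl.
  rewrite -(Rintegral_translate h (f := fun x => c * (f x * cos (dotp xi x)) +
    s * (f x * sin (dotp xi x)))); last by apply: integrable_EFinD; exact: integrable_EFinZl.
  apply: eq_Rintegral => x _; rewrite cosx; ring.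
have Sh : sinint (fun x => f (addt x h)) xi = c * sinint f xi - s * cosint f xi.
  rewrite -!RintegralZl// -RintegralB//; try exact: integrable_EFinZl.
  rewrite -(Rintegral_translate h (f := fun x => c * (f x * sin (dotp xi x)) -
    s * (f x * cos (dotp xi x)))); last by apply: integrable_EFinB; exact: integrable_EFinZl.
  apply: eq_Rintegral => x _; rewrite sinx; ring.
rewrite /g hatreB// hatimB// /hatre /hatim Ch Sh.
have : c ^+ 2 + s ^+ 2 = 1 by rewrite cos2Dsin2.
clear cosx sinx Ch Sh; clearbody c s; move: c s (cosint f xi) (sinint f xi) (fourier_cst n) => c s C S k /(canRL (addrK _)) cs.
transitivity (k ^+ 2 * ((c ^+ 2 + s ^+ 2) + 1 - 2 * c) * (C ^+ 2 + S ^+ 2)); first by ring.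
by rewrite cs; ring.
Qed.

Section transform.
Variables (u : Rn -> R).
Hypothesis L2u : L2 n u.
Let vr xi := complex.Re (fourier u xi).
Let vi xi := complex.Im (fourier u xi).
Local Notation w2 xi := (Normc.normc (fourier u xi) ^+ 2).

Let mu : measurable_fun setT u. Proof. by have /L2P[] := L2u. Qed.
Let u2 : (\int[leb]_x (u x ^+ 2)%:E < +oo)%E. Proof. by have /L2P[] := L2u. Qed.
Let vrP : measurable_fun setT vr /\ (\int[leb]_x (vr x ^+ 2)%:E < +oo)%E.
Proof. by have [/Lfun2P] := fourierP L2u. Qed.
Let viP : measurable_fun setT vi /\ (\int[leb]_x (vi x ^+ 2)%:E < +oo)%E.
Proof. by have [_ /Lfun2P] := fourierP L2u. Qed.

Let mre k := measurable_hatre (integrable_trunc L2u k).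
Let mim k := measurable_hatim (integrable_trunc L2u k).

Let both_cvg : (\int[leb]_xi ((hatre (trunc u k) xi - vr xi) ^+ 2 +
  (hatim (trunc u k) xi - vi xi) ^+ 2)%:E)%E @[k --> \oo] --> 0%E.
Proof.
have [_ _] := fourierP L2u.
rewrite (_ : (fun k => \int[leb]_xi _)%E =
  (fun k => \int[leb]_xi ((hatre (trunc u k) xi - vr xi) ^+ 2 +
  (hatim (trunc u k) xi - vi xi) ^+ 2)%:E)%E)//.
apply/funext => k; apply: eq_integral => xi _; congr EFin.
rewrite fourier_intE; last exact: integrable_trunc.
by rewrite sqr_normcE /vr /vi; case: (fourier u xi).
Qed.

Let re_cvg : (\int[leb]_xi ((hatre (trunc u k) xi - vr xi) ^+ 2)%:E)%E @[k --> \oo] --> 0%E.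
Proof.
apply: (ge0_squeeze_cvge0 _ _ both_cvg); first by move=> k; exact: integral_sqr_ge0.
move=> k; have mB := measurable_funB (mre k) vrP.1; have mB' := measurable_funB (mim k) viP.1.
apply: ge0_le_integralT.
- exact: measurable_sqr.
- by apply/measurable_EFinP; apply: measurable_funD; exact: measurable_funX.
- by move=> x; rewrite lee_fin sqr_ge0.
- by move=> x; rewrite lee_fin lerDl sqr_ge0.
Qed.

Let im_cvg : (\int[leb]_xi ((hatim (trunc u k) xi - vi xi) ^+ 2)%:E)%E @[k --> \oo] --> 0%E.
Proof.
apply: (ge0_squeeze_cvge0 _ _ both_cvg); first by move=> k; exact: integral_sqr_ge0.
move=> k; have mB := measurable_funB (mre k) vrP.1; have mB' := measurable_funB (mim k) viP.1.
apply: ge0_le_integralT.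
- exact: measurable_sqr.
- by apply/measurable_EFinP; apply: measurable_funD; exact: measurable_funX.
- by move=> x; rewrite lee_fin sqr_ge0.
- by move=> x; rewrite lee_fin lerDr sqr_ge0.
Qed.

Lemma measurable_fourier_sqr : measurable_fun setT (fun xi => w2 xi).
Proof.
under eq_fun do rewrite sqr_normcE.
by apply: measurable_funD; apply: measurable_funX; [exact: vrP.1|exact: viP.1].
Qed.

Section weight.
Variables (w : Rn -> R) (B : R).
Hypothesis mw : measurable_fun setT w.
Hypothesis w0 : forall xi, 0 <= w xi.
Hypothesis wB : forall xi, w xi <= B.

Let msw : measurable_fun setT (fun xi => Num.sqrt (w xi)).
Proof.
apply: (@measurableT_comp _ _ _ _ _ _ (@Num.sqrt R)) => //.
by apply: continuous_measurable_fun; exact: sqrt_continuous.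
Qed.

Let weighted_le (g : Rn -> R) : measurable_fun setT g ->
  (\int[leb]_xi ((Num.sqrt (w xi) * g xi) ^+ 2)%:E <= B%:E * \int[leb]_xi (g xi ^+ 2)%:E)%E.
Proof.
move=> mg; have B0 : 0 <= B := le_trans (w0 [tuple 0 | i < n]) (wB _).
rewrite -ge0_integralZl_EFin//.
- apply: ge0_le_integralT.
  + by apply: measurable_sqr; exact: measurable_funM.
  + by apply: measurable_funeM; exact: measurable_sqr.
  + by move=> x; rewrite lee_fin sqr_ge0.
  + by move=> x; rewrite -EFinM lee_fin exprMn sqr_sqrtr// ler_wpM2r ?sqr_ge0.
- by move=> x _; rewrite lee_fin sqr_ge0.
- exact: measurable_sqr.
Qed.

Let weighted_cvg (g_ : nat -> Rn -> R) (g : Rn -> R) :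
  (forall k, measurable_fun setT (g_ k)) -> measurable_fun setT g ->
  (\int[leb]_x (g x ^+ 2)%:E < +oo)%E ->
  (\int[leb]_x ((g_ k x - g x) ^+ 2)%:E)%E @[k --> \oo] --> 0%E ->
  (\int[leb]_x (w x * g_ k x ^+ 2)%:E)%E @[k --> \oo] --> (\int[leb]_x (w x * g x ^+ 2)%:E)%E.
Proof.
move=> mg_ mg g2 gc; have B0 : 0 <= B := le_trans (w0 [tuple 0 | i < n]) (wB _).
have E (q : Rn -> R) : (\int[leb]_x (w x * q x ^+ 2)%:E =
    \int[leb]_x ((Num.sqrt (w x) * q x) ^+ 2)%:E)%E.
  by apply: eq_integral => x _; rewrite exprMn sqr_sqrtr.
rewrite E (_ : (fun k => \int[leb]_x (w x * g_ k x ^+ 2)%:E)%E =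
  (fun k => \int[leb]_x ((Num.sqrt (w x) * g_ k x) ^+ 2)%:E)%E); last first.
  by apply/funext => k; rewrite E.
apply: cvg_integral_sqr.
- by move=> k; exact: measurable_funM.
- exact: measurable_funM.
- by apply: (le_lt_trans (weighted_le mg)); rewrite lte_mul_pinfty.
- apply: (@ge0_squeeze_cvge0 _ _ (fun k => B%:E * \int[leb]_x ((g_ k x - g x)%R ^+ 2)%:E)%E).
  + by move=> k; exact: integral_sqr_ge0.
  + move=> k; under eq_integral do rewrite -mulrBr.
    by apply: weighted_le; exact: measurable_funB.
  + by rewrite -[X in _ --> X](mule0 B%:E); apply: cvgeZl.
Qed.

(** Multiplication by the square root of the bounded weight preserves L2 convergence, so weighted
    squared norms pass from the truncations to the limit. It is applied with w = 2 (1 - cos (xi .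
    h)) <= 4 for increments and with w = 1 for Plancherel. *)
Lemma weighted_fourier_cvg :
  (\int[leb]_xi (w xi * (hatre (trunc u k) xi ^+ 2 + hatim (trunc u k) xi ^+ 2))%:E)%E
    @[k --> \oo] --> (\int[leb]_xi (w xi * w2 xi)%:E)%E.
Proof.
have E (a b : Rn -> R) : measurable_fun setT a -> measurable_fun setT b ->
    (\int[leb]_xi (w xi * (a xi ^+ 2 + b xi ^+ 2))%:E =
    \int[leb]_xi (w xi * a xi ^+ 2)%:E + \int[leb]_xi (w xi * b xi ^+ 2)%:E)%E.
  move=> ma mb; under eq_integral do rewrite mulrDr EFinD.
  rewrite ge0_integralD//; try (by move=> x _; rewrite lee_fin mulr_ge0 ?sqr_ge0);
    by apply/measurable_EFinP; apply: measurable_funM => //; exact: measurable_funX.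
under eq_fun do rewrite (E _ _ (mre _) (mim _)).
under eq_integral do rewrite sqr_normcE.
rewrite (E _ _ vrP.1 viP.1); apply: cvgeD.
- apply: ge0_adde_def; rewrite inE; apply: integral_ge0 => x _;
    by rewrite lee_fin mulr_ge0 ?sqr_ge0.
- exact: weighted_cvg (mre) vrP.1 vrP.2 re_cvg.
- exact: weighted_cvg (mim) viP.1 viP.2 im_cvg.
Qed.

End weight.

Lemma increment_fourier (h : Rn) :
  (\int[leb]_x ((u (addt x h) - u x) ^+ 2)%:E =
   \int[leb]_xi (2 * (1 - cos (dotp xi h)) * w2 xi)%:E)%E.
Proof.
pose w xi := 2 * (1 - cos (dotp xi h)).
have mcos : measurable_fun setT (fun xi : Rn => cos (dotp xi h)).
  apply: (measurableT_comp (@measurable_cos R)).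
  by under eq_fun do rewrite dotpC; exact: measurable_dotp.
have mw : measurable_fun setT w.
  by apply: measurable_funM => //; exact: measurable_funB.
have w0 xi : 0 <= w xi by rewrite /w; have := cos_le1 (dotp xi h); lra.
have w4 xi : w xi <= 4 by rewrite /w; have := cos_geN1 (dotp xi h); lra.
have c1 := weighted_fourier_cvg mw w0 w4.
pose g k x := trunc u k (addt x h) - trunc u k x.
have mt k := measurable_trunc L2u k.
have mth k : measurable_fun setT (fun x => trunc u k (addt x h)).
  exact: (measurableT_comp (mt k) (measurable_addt h)).
have muh : measurable_fun setT (fun x => u (addt x h)).
  exact: (measurableT_comp mu (measurable_addt h)).
have mg k : measurable_fun setT (g k) by exact: measurable_funB.
have presh (k : nat) (f : Rn -> \bar R) : measurable_fun setT f -> (forall x, 0 <= f x)%E ->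
    (\int[leb]_x f (addt x h) = \int[leb]_x f x)%E.
  by move=> mf f0; exact: ge0_integral_translate.
have incr (f : Rn -> R) : measurable_fun setT f ->
    (\int[leb]_x ((f (addt x h) - f x) ^+ 2)%:E <= 4%:E * \int[leb]_x (f x ^+ 2)%:E)%E.
  move=> mf; apply: (@integral_increment_le4 _ _ _ leb (fun _ x => addt x h) _ presh f 0%N mf).
  by move=> k; exact: measurable_addt.
have c2 : (\int[leb]_x (g k x ^+ 2)%:E)%E @[k --> \oo] -->
    (\int[leb]_x ((u (addt x h) - u x) ^+ 2)%:E)%E.
  apply: (cvg_integral_sqr (f := fun x => u (addt x h) - u x)) => //.
  - exact: measurable_funB.
  - by apply: (le_lt_trans (incr u mu)); rewrite lte_mul_pinfty.
  - apply: (@ge0_squeeze_cvge0 _ _ (fun k => 4%:E * \int[leb]_x ((u x - trunc u k x)%R ^+ 2)%:E)%E).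
    + by move=> k; exact: integral_sqr_ge0.
    + move=> k; apply: le_trans (incr (fun x => u x - trunc u k x) (measurable_funB mu (mt k))).
      rewrite le_eqVlt; apply/orP; left; apply/eqP; apply: eq_integral => x _.
      by congr EFin; rewrite /g; ring.
    + by rewrite -[X in _ --> X](mule0 4%:E); apply: cvgeZl => //; exact: trunc_cvg.
suff E : (fun k => \int[leb]_x (g k x ^+ 2)%:E)%E = (fun k => \int[leb]_xi
    (w xi * (hatre (trunc u k) xi ^+ 2 + hatim (trunc u k) xi ^+ 2))%:E)%E.
  by rewrite E in c2; apply: (cvg_unique _ c2 c1).
apply/funext => k.
have it := integrable_trunc L2u k.
have ig : leb.-integrable setT (EFin \o g k).
  by apply: integrable_EFinB => //; exact: integrable_translate.
rewrite -(plancherel_hat ig).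
  by apply: eq_integral => xi _; rewrite hat_increment.
apply: (le_lt_trans (incr _ (mt k))); rewrite lte_mul_pinfty//.
exact: trunc_sqr_lty.
Qed.

Lemma plancherel : (\int[leb]_xi (w2 xi)%:E = \int[leb]_x (u x ^+ 2)%:E)%E.
Proof.
have c1 := @weighted_fourier_cvg (cst 1) 1 (measurable_cst _) (fun _ => ler01) (fun _ => lexx _).
have c2 := @cvg_integral_sqr _ _ _ leb (trunc u) u (measurable_trunc L2u) mu u2.
have {}c2 : (\int[leb]_x (trunc u k x ^+ 2)%:E)%E @[k --> \oo] --> (\int[leb]_x (u x ^+ 2)%:E)%E.
  apply: c2; have := trunc_cvg L2u.
  rewrite (_ : (fun k => \int[leb]_x ((u x - trunc u k x) ^+ 2)%:E)%E =
    (fun k => \int[leb]_x ((trunc u k x - u x) ^+ 2)%:E)%E)//.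
  by apply/funext => k; apply: eq_integral => x _; rewrite -sqrrN opprB.
under [LHS]eq_integral do rewrite -[w2 _]mul1r.
suff E : (fun k => \int[leb]_xi
    (cst 1 xi * (hatre (trunc u k) xi ^+ 2 + hatim (trunc u k) xi ^+ 2))%:E)%E =
    (fun k => \int[leb]_x (trunc u k x ^+ 2)%:E)%E.
  by rewrite E in c1; apply: (cvg_unique _ c1 c2).
apply/funext => k; rewrite -(plancherel_hat (integrable_trunc L2u k) (trunc_sqr_lty L2u k)).
by apply: eq_integral => xi _; rewrite mul1r.
Qed.

(** The transforms of the truncations converge to the explicit transform at every point, by L1
    convergence, and to [fourier u] in L2; so the two agree almost everywhere. This is what makes
    the transform of the separating example computable. *)
Lemma fourier_L1 (w : Rn -> R) : leb.-integrable setT (EFin \o u) ->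
  measurable_fun setT w -> (forall xi, 0 <= w xi) ->
  (\int[leb]_xi (w xi * w2 xi)%:E =
   \int[leb]_xi (w xi * (hatre u xi ^+ 2 + hatim u xi ^+ 2))%:E)%E.
Proof.
move=> iu mw w0.
have mr := measurable_hatre iu; have mi := measurable_hatim iu.
have L1c : (\int[leb]_x (`|trunc u k x - u x|)%:E)%E @[k --> \oo] --> 0%E.
  apply: (@ge0_dominated_cvg0 _ _ _ leb (fun k x => (`|trunc u k x - u x|)%:E)
    (fun x => (`|u x|)%:E)) => //.
  - move=> k; apply/measurable_EFinP; apply: measurableT_comp => //.
    by apply: measurable_funB => //; exact: measurable_trunc.
  - by apply/measurable_EFinP; exact: measurableT_comp.
  - move=> k x; rewrite lee_fin /trunc indicE; case: (x \in _).
      by rewrite mulr1 subrr normr0.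
    by rewrite mulr0 sub0r normrN.
  - exact: integrable_EFin_lty.
  - move=> x _; apply: cvg_near_cst; have := trunc_near u x; apply: filterS => k ->.
    by rewrite subrr normr0.
have iB k : leb.-integrable setT (EFin \o (fun x => trunc u k x - u x)).
  by apply: integrable_EFinB => //; exact: integrable_trunc.
have L1c' : \int[leb]_x `|trunc u k x - u x| @[k --> \oo] --> (0 : R).
  by have /fine_cvgP[] := L1c.
have F0 : 0 <= @fourier_cst R n by exact: powR_ge0.
have fc : @fourier_cst R n * \int[leb]_x `|trunc u k x - u x| @[k --> \oo] --> (0 : R).
  by rewrite -[X in _ --> X](mulr0 (@fourier_cst R n)); apply: cvgM => //; exact: cvg_cst.
have rc xi : hatre (trunc u k) xi @[k --> \oo] --> hatre u xi.
  apply/cvgrPdist_le => e e0; move/cvgr0Pnorm_le : fc => /(_ _ e0).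
  apply: filterS => k; apply: le_trans.
  rewrite distrC -hatreB//; last exact: integrable_trunc.
  rewrite normrM [leRHS]ger0_norm ?mulr_ge0 ?Rintegral_ge0// ger0_norm//.
  by rewrite ler_wpM2l//; exact: cosint_bound.
have ic xi : hatim (trunc u k) xi @[k --> \oo] --> hatim u xi.
  apply/cvgrPdist_le => e e0; move/cvgr0Pnorm_le : fc => /(_ _ e0).
  apply: filterS => k; apply: le_trans.
  rewrite distrC -hatimB//; last exact: integrable_trunc.
  rewrite normrN normrM [leRHS]ger0_norm ?mulr_ge0 ?Rintegral_ge0// ger0_norm//.
  by rewrite ler_wpM2l//; exact: sinint_bound.
have zero (a_ : nat -> Rn -> R) (a v : Rn -> R) : (forall k, measurable_fun setT (a_ k)) ->
    measurable_fun setT a -> measurable_fun setT v ->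
    (forall xi, a_ k xi @[k --> \oo] --> a xi) ->
    (\int[leb]_xi ((a_ k xi - v xi) ^+ 2)%:E)%E @[k --> \oo] --> 0%E ->
    {ae leb, forall xi, a xi = v xi}.
  move=> ma_ ma mv aa av.
  have I0 : (\int[leb]_xi ((a xi - v xi) ^+ 2)%:E = 0)%E.
    apply/eqP; rewrite eq_le integral_sqr_ge0 andbT.
    apply/lee_addgt0Pr => e e0; rewrite add0e.
    have /(_ _ e0)[N _ NH] := (ge0_cvge0P (fun k => integral_sqr_ge0 leb
      (fun xi => a_ k xi - v xi))).1 av.
    (* Fatou along the sequence started at [N], beyond which the squared L2 distance to [v] is at
       most [e]. *)
    apply: (@fatou_bound _ _ _ leb (fun k xi => ((a_ (k + N)%N xi - v xi) ^+ 2)%:E)).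
    - by move=> k; apply: measurable_sqr; exact: measurable_funB.
    - by move=> k xi; rewrite lee_fin sqr_ge0.
    - move=> xi; apply: cvg_EFin; first by apply: nearW.
      have c : a_ (k + N)%N xi - v xi @[k --> \oo] --> a xi - v xi.
        apply: cvgB; last exact: cvg_cst.
        by rewrite (cvg_shiftn N (fun k => a_ k xi)).
      rewrite (_ : fine \o _ = (fun k => (a_ (k + N)%N xi - v xi) * (a_ (k + N)%N xi - v xi))).
        by rewrite expr2; exact: cvgM.
      by apply/funext => k /=; rewrite expr2.
    - by move=> k; apply: NH; rewrite /= leq_addl.
  have mB : measurable_fun setT (fun xi => ((a xi - v xi) ^+ 2)%:E).
    by apply: measurable_sqr; exact: measurable_funB.
  have := (ae_eq_integral_abs leb measurableT mB).1.
  rewrite (eq_integral (fun xi => ((a xi - v xi) ^+ 2)%:E)); last first.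
    by move=> xi _; rewrite gee0_abs// lee_fin sqr_ge0.
  move=> /(_ I0); apply: filterS => xi /(_ I) [] /eqP.
  by rewrite sqrf_eq0 subr_eq0 => /eqP.
have aer := zero _ _ _ mre mr vrP.1 rc re_cvg.
have aei := zero _ _ _ mim mi viP.1 ic im_cvg.
apply: ge0_ae_eq_integral => //.
- apply/measurable_EFinP; apply: measurable_funM => //; exact: measurable_fourier_sqr.
- apply/measurable_EFinP; apply: measurable_funM => //.
  by apply: measurable_funD; exact: measurable_funX.
- by move=> xi _; rewrite lee_fin mulr_ge0// sqr_ge0.
- by move=> xi _; rewrite lee_fin mulr_ge0// addr_ge0// sqr_ge0.
- move: aer aei; apply: filterS2 => xi -> -> _.
  by rewrite sqr_normcE.
Qed.

End transform.

End fourier_properties.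

(** * Radial integrals and the Gamma function *)

Section log_radial_integral.
Context d (T : measurableType d) {R : realType} (mu : {measure set T -> \bar R}).
Variables (N : T -> R) (a V de : R).
Hypothesis mN : measurable_fun setT N.
Hypothesis V0 : 0 <= V.
Hypothesis de0 : 0 < de.
Hypothesis volN : forall L : R, (mu [set x | (0 < N x <= expR L)%R] <= (V * expR (a * L))%:E)%E.

(** Where N is positive this is N^(-a) min(N, 1/N)^b: the power that exactly balances the volume
    growth e^(aL), with a gain of order [b] both near 0 and near infinity. *)
Definition log_radial (b : R) (N : T -> R) (x : T) : R :=
  if 0 < N x then expR (- a * ln (N x) - b * `|ln (N x)|) else 0.

Lemma log_radial_ge0 b x : 0 <= log_radial b N x.
Proof. by rewrite /log_radial; case: ifP => _ //; exact: expR_ge0. Qed.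

Lemma measurable_log_radial b : measurable_fun setT (log_radial b N).
Proof.
apply: measurable_fun_ifT => //; first exact: measurable_fun_ltr.
apply: (measurableT_comp (@measurable_expR R)); apply: measurable_funB.
  by apply: measurable_funM => //; apply: (measurableT_comp (@measurable_ln R)).
apply: measurable_funM => //; apply: measurableT_comp => //.
by apply: (measurableT_comp (@measurable_ln R)).
Qed.

Let D (L : R) : set T := [set x | 0 < N x <= expR L].

Let mD L : measurable (D L).
Proof.
have -> : D L = [set x | 0 < N x] `&` [set x | N x <= expR L].
  by apply/seteqP; split => x /=; [move=> /andP[]|move=> [p q]; apply/andP; split].
apply: measurableI.
  have := measurable_fun_ltr (measurable_cst (0 : R)) mN.
  by move=> /(_ measurableT [set true]); rewrite setTI; apply.
have := measurable_fun_ler mN (measurable_cst (expR L)).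
by move=> /(_ measurableT [set true]); rewrite setTI; apply.
Qed.

(** Each shell is enlarged to the ball of its outer radius e^(j+1) or e^(-j), since only volumes of
    balls are controlled, and is normalised by that volume. The prefactor absorbs the variation of
    N^(-a) across a shell and keeps the decay e^(-de j). *)
Let term (j : nat) (x : T) : R :=
  expR ((`|a| + `|a| - de * j%:R)) * (expR (- a * (j%:R + 1)) * \1_(D (j%:R + 1)) x +
   expR (a * j%:R) * \1_(D (- j%:R)) x).

Let term0 j x : 0 <= term j x.
Proof. by rewrite mulr_ge0 ?expR_ge0// addr_ge0// mulr_ge0 ?expR_ge0// indicE. Qed.

Let mterm j : measurable_fun setT (term j).
Proof.
by apply: measurable_funM => //; apply: measurable_funD; apply: measurable_funM => //;
  exact: measurable_indic.
Qed.

(* The shell [e^j < N <= e^(j+1)] (or [e^(-j-1) < N <= e^(-j)]) containing [x] gives one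
   term of the series that already dominates the left-hand side. *)
Let log_radial_le x : exists j : nat, log_radial de N x <= term j x.
Proof.
rewrite /log_radial; case: ifPn => [Nx|_]; last by exists 0%N.
pose L := ln (N x); have NL : N x = expR L by rewrite lnK.
exists (Num.truncn `|L|); rewrite /term -/L.
set j := Num.truncn `|L|.
have jL : j%:R <= `|L| < j.+1%:R by have := truncn_itv (normr_ge0 L).
have [/andP[jl lj]] : j%:R <= `|L| < j%:R + 1 by rewrite natr1.
have aabs := ler_norm a; have aabs' := ler_norm (- a); rewrite normrN in aabs'.
have a0 := normr_ge0 a; have dj : de * j%:R <= de * `|L| by rewrite ler_pM2l.
have [L0|L0] := leP 0 L.
  rewrite ger0_norm// in jl lj dj *.
  apply: (@le_trans _ _ (expR (`|a| + `|a| - de * j%:R) * (expR (- a * (j%:R + 1)) * \1_(D (j%:R + 1)) x))).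
    rewrite indicE mem_set; last by rewrite /D/= Nx NL ler_expR/= ltW.
    rewrite mulr1 -expRD ler_expR.
    suff : a * (j%:R + 1 - L) <= `|a| + `|a| by lra.
    apply: (@le_trans _ _ (`|a| * (j%:R + 1 - L))); first by rewrite ler_wpM2r//; lra.
    by apply: (@le_trans _ _ (`|a| * 1)); [rewrite ler_wpM2l//; lra|lra].
  by rewrite ler_wpM2l ?expR_ge0// lerDl mulr_ge0 ?expR_ge0// indicE.
rewrite ltr0_norm// in jl lj dj *.
apply: (@le_trans _ _ (expR (`|a| + `|a| - de * j%:R) * (expR (a * j%:R) * \1_(D (- j%:R)) x))).
  rewrite indicE mem_set; last by rewrite /D/= Nx NL ler_expR/= lerNr.
  rewrite mulr1 -expRD ler_expR.
  suff : a * (- L - j%:R) <= `|a| + `|a| by lra.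
  apply: (@le_trans _ _ (`|a| * (- L - j%:R))); first by rewrite ler_wpM2r//; lra.
  by apply: (@le_trans _ _ (`|a| * 1)); [rewrite ler_wpM2l//; lra|lra].
by rewrite ler_wpM2l ?expR_ge0// lerDr mulr_ge0 ?expR_ge0// indicE.
Qed.

Let integral_term j : (\int[mu]_x (term j x)%:E <=
  (2 * V * expR (`|a| + `|a|) * expR (- de) ^+ j)%:E)%E.
Proof.
have ind (c L : R) : 0 <= c -> (\int[mu]_x (c * \1_(D L) x)%:E <= (c * (V * expR (a * L)))%:E)%E.
  move=> c0; under eq_integral do rewrite EFinM.
  rewrite ge0_integralZl_EFin//.
    rewrite integral_indic// setIT EFinM lee_wpmul2l ?lee_fin//; exact: volN.
  by apply/measurable_EFinP; exact: measurable_indic.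
have mi (c L : R) : measurable_fun setT (fun x => (c * \1_(D L) x)%:E).
  by apply/measurable_EFinP; apply: measurable_funM => //; exact: measurable_indic.
have pi (c L : R) x : 0 <= c -> (0 <= (c * \1_(D L) x)%:E)%E.
  by move=> c0; rewrite lee_fin mulr_ge0// indicE.
under eq_integral do rewrite /term EFinM EFinD.
rewrite ge0_integralZl_EFin//; last 2 first.
- by move=> x _; rewrite adde_ge0// pi// expR_ge0.
- by apply: emeasurable_funD.
rewrite ge0_integralD//; try by move=> x _; apply: pi; exact: expR_ge0.
apply: (@le_trans _ _ ((expR (`|a| + `|a| - de * j%:R))%:E * (V + V)%:E)%E).
  apply: lee_wpmul2l; first by rewrite lee_fin expR_ge0.
  rewrite EFinD; apply: leeD.
    apply: (le_trans (ind _ _ (expR_ge0 _))).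
    by rewrite lee_fin mulrCA -expRD mulNr addNr expR0 mulr1.
  apply: (le_trans (ind _ _ (expR_ge0 _))).
  by rewrite lee_fin mulrCA -expRD mulrN subrr expR0 mulr1.
rewrite -EFinM lee_fin expRD -expRM_natl mulrN [j%:R * de]mulrC.
by rewrite le_eqVlt; apply/orP; left; apply/eqP; ring.
Qed.

Lemma log_radial_integral_lty : (\int[mu]_x (log_radial de N x)%:E < +oo)%E.
Proof.
pose q := expR (- de).
have q1 : q < 1 by rewrite /q -expR0 ltr_expR oppr_lt0.
have q0 : 0 <= q by exact: expR_ge0.
pose C := 2 * V * expR (`|a| + `|a|).
have C0 : 0 <= C by rewrite !mulr_ge0// expR_ge0.
have geo m : \sum_(0 <= j < m) C * q ^+ j <= C / (1 - q).
  rewrite -mulr_sumr; apply: ler_wpM2l => //.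
  rewrite -[leRHS]mul1r ler_pdivlMr ?subr_gt0//.
  suff -> : (\sum_(0 <= j < m) q ^+ j) * (1 - q) = 1 - q ^+ m.
    by rewrite gerBl exprn_ge0.
  elim: m => [|m IH]; first by rewrite big_geq// expr0; ring.
  by rewrite big_nat_recr//= mulrDl IH exprS; ring.
pose S x := (\sum_(0 <= j <oo) (term j x)%:E)%E.
have mS : measurable_fun setT S.
  apply: (@ge0_emeasurable_sum _ _ _ _ (fun j x => (term j x)%:E) xpredT) => //.
    by move=> j x _ _; rewrite lee_fin.
  by move=> j _; exact/measurable_EFinP.
apply: (@le_lt_trans _ _ (\int[mu]_x S x)%E).
  apply: ge0_le_integralT => //.
  - by apply/measurable_EFinP; exact: measurable_log_radial.
  - by move=> x; rewrite lee_fin log_radial_ge0.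
  - move=> x; have [j jx] := log_radial_le x.
    have := @nneseries_lim_ge _ (fun j => (term j x)%:E) xpredT 0%N j.+1.
    move=> H; apply: le_trans (H _); last by move=> i _ _; rewrite lee_fin.
    rewrite big_nat_recr//= -[leLHS]add0e; apply: leeD; last by rewrite lee_fin.
    by apply: sume_ge0 => i _; rewrite lee_fin.
rewrite integral_nneseries//; last 2 first.
- by move=> j; exact/measurable_EFinP.
- by move=> j x _; rewrite lee_fin.
apply: (@le_lt_trans _ _ (C / (1 - q))%:E); last exact: ltry.
apply: lime_le.
  by apply: is_cvg_nneseries => j _ _; apply: integral_ge0 => x _; rewrite lee_fin.
apply: nearW => m; apply: (@le_trans _ _ (\sum_(0 <= j < m) (C * q ^+ j)%:E)%E).
  by apply: lee_sum => j _; exact: integral_term.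
by rewrite sumEFin lee_fin.
Qed.

End log_radial_integral.

(** * Positivity of the Gamma function *)

Section Gamma_positive.
Context {R : realType}.
Local Notation leb1 := (@lebesgue_measure R).

Lemma normr_log_radial_lty (de : R) : 0 < de ->
  (\int[leb1]_t (log_radial 1 de (fun t : R => `|t|) t)%:E < +oo)%E.
Proof.
move=> de0; apply: (@log_radial_integral_lty _ _ _ _ _ 1 2 de) => //.
  exact: normr_measurable.
move=> L; apply: (@le_trans _ _ (leb1 (`[- expR L, expR L]%classic : set R))).
  apply: le_measure; rewrite ?inE.
  - have -> : [set x : R | 0 < `|x| <= expR L] =
        [set x | 0 < `|x|] `&` [set x | `|x| <= expR L].
      by apply/seteqP; split => x /=; [move=> /andP[]|move=> [p q]; apply/andP; split].
    have mn : measurable_fun [set: measurableTypeR R] (fun x : R => `|x|) by exact: normr_measurable.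
    apply: measurableI.
      have := measurable_fun_ltr (measurable_cst (0 : R)) mn.
      by move=> /(_ measurableT [set true]); rewrite setTI; apply.
    have := measurable_fun_ler mn (measurable_cst (expR L)).
    by move=> /(_ measurableT [set true]); rewrite setTI; apply.
  - exact: measurable_itv.
  - by move=> x /= /andP[_]; rewrite in_itv/= ler_norml.
rewrite lebesgue_measure_itv/= mul1r; case: ifP => _; last by rewrite lee_fin mulr_ge0// expR_ge0.
by rewrite -EFinD lee_fin; lra.
Qed.

(** A real-valued integral that diverges has the value 0, so positivity requires finiteness as well
    as a lower bound. Finiteness comes from a radial majorant with N(t) = |t|, the lower bound from
    the interval [1, 2]. *)
Lemma Gamma_gt0 (z : R) : 0 < z -> 0 < Gamma z.
Proof.
move=> z0; pose f (t : R) := t `^ (z - 1) * expR (- t).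
have f0 t : 0 <= f t by rewrite mulr_ge0 ?powR_ge0 ?expR_ge0.
have mf : measurable_fun [set: measurableTypeR R] f.
  apply: measurable_funM; first exact: measurable_powR.
  by apply: (measurableT_comp (@measurable_expR R)).
pose I := `]0, +oo[%classic : set (measurableTypeR R).
have mI : measurable I by exact: measurable_itv.
pose de := Num.min z 1.
have de0 : 0 < de by rewrite lt_min z0 ltr01.
have dez : de <= z by rewrite ge_min lexx.
(* From ln(t / a) < t / a one gets t^a e^(-t) <= e^(a ln a); dividing by t^(1 + de) bounds the
   integrand for t >= 1. For t < 1 the inequality de <= z is used instead. *)
pose a := z + de; have a0 : 0 < a by rewrite addr_gt0.
pose C := expR `|a * ln a|.
have bound (t : R) : I t -> f t <= C * log_radial 1 de (fun t : R => `|t|) t.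
  rewrite /I/= in_itv/= andbT => t0.
  rewrite /log_radial normr_gt0 gt_eqF// gtr0_norm// /f /C -expRD.
  rewrite /powR gt_eqF// -expRD ler_expR.
  have l1 := ln_sublinear (divr_gt0 t0 a0).
  rewrite lnM ?posrE ?invr_gt0// lnV ?posrE// in l1.
  have l2 : a * (ln t - ln a) <= t.
    by rewrite mulrC -ler_pdivlMr// ltW.
  have e : a * ln t = z * ln t + de * ln t by rewrite /a mulrDl.
  rewrite mulrBr e in l2.
  have l3 := ler_norm (a * ln a); have l4 := normr_ge0 (a * ln a).
  have [L0|L0] := leP 0 (ln t).
    by rewrite (ger0_norm L0); move: l2 l3 l4; clear; set w := a * ln a; lra.
  rewrite (ltr0_norm L0).
  have : z * - ln t >= de * - ln t by rewrite ler_wpM2r// oppr_ge0 ltW.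
  move: l2 l3 l4 (ltW t0); clear; set w := a * ln a; lra.
have mG : measurable_fun [set: measurableTypeR R] (log_radial 1 de (fun t : R => `|t|)).
  by apply: measurable_log_radial; exact: normr_measurable.
have mfI : measurable_fun I (EFin \o f).
  by apply: (@measurable_funS _ _ _ _ setT) => //; exact/measurable_EFinP.
have fin : (\int[leb1]_(t in I) (f t)%:E < +oo)%E.
  apply: (@le_lt_trans _ _ (\int[leb1]_t (C%:E * (log_radial 1 de (fun t : R => `|t|) t)%:E))%E).
    rewrite integral_mkcond; apply: ge0_le_integralT.
    - apply/(measurable_restrictT _ mI); exact: mfI.
    - by apply: measurable_funeM; exact/measurable_EFinP.
    - by move=> x; rewrite /patch; case: ifP => // _; rewrite lee_fin.
    - move=> x; rewrite /patch; case: ifPn => [xI|_].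
        by rewrite -EFinM lee_fin; apply: bound; rewrite inE in xI.
      by rewrite -EFinM lee_fin mulr_ge0 ?expR_ge0// log_radial_ge0.
  rewrite ge0_integralZl_EFin//.
  - by apply: lte_mul_pinfty; [rewrite lee_fin expR_ge0|by []|exact: normr_log_radial_lty].
  - by move=> x _; rewrite lee_fin log_radial_ge0.
  - exact/measurable_EFinP.
  - exact: expR_ge0.
pose J := `[1, 2]%classic : set (measurableTypeR R).
have mJ : measurable J by exact: measurable_itv.
pose c := expR (- (`|z - 1| * 2) - 2).
have cJ (t : R) : J t -> c <= f t.
  rewrite /J/= in_itv/= => /andP[t1 t2].
  have t0 : 0 < t by lra.
  rewrite /f /powR gt_eqF// -expRD ler_expR.
  have lt0 : 0 <= ln t by exact: ln_ge0.
  have lt1 : ln t <= 2 by apply: le_trans t2; apply: ltW; exact: ln_sublinear.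
  have : - (`|z - 1| * 2) <= (z - 1) * ln t.
    have : `|(z - 1) * ln t| <= `|z - 1| * 2.
      by rewrite normrM ler_wpM2l// ger0_norm.
    by rewrite ler_norml => /andP[].
  lra.
have JI : J `<=` I.
  by move=> t; rewrite /J /I/= !in_itv/= andbT => /andP[t1 _]; lra.
have lower : (c%:E <= \int[leb1]_(t in I) (f t)%:E)%E.
  apply: (@le_trans _ _ (\int[leb1]_(t in J) (f t)%:E)%E); last first.
    apply: ge0_subset_integral => //; try by move=> x _; rewrite lee_fin.
  apply: (@le_trans _ _ (\int[leb1]_(t in J) (cst c%:E t))%E).
    have J1 : leb1 (`[1, 2]%classic : set R) = 1%:E.
      by rewrite lebesgue_measure_itv/= lte_fin ltr1n/= -EFinB; congr EFin; lra.
    by rewrite integral_cst// [X in (_ * X)%E](_ : _ = 1%:E) ?mule1//; exact: J1.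
  apply: ge0_le_integral => //.
  - by move=> x _; rewrite lee_fin expR_ge0.
  - exact: measurable_funS mfI.
apply: (@lt_le_trans _ _ c); first exact: expR_gt0.
rewrite -lee_fin /Gamma /Rintegral fineK//.
rewrite ge0_fin_numE//; apply: integral_ge0 => t _; rewrite lee_fin; exact: f0.
Qed.

End Gamma_positive.

Section one_minus_cos.
Context {R : realType}.

Lemma normr_sin_le (x : R) : `|sin x| <= `|x|.
Proof.
wlog x0 : x / 0 <= x => [H|].
  have [/H//|/ltW x0] := leP 0 x.
  by have := H (- x); rewrite oppr_ge0 sinN !normrN; apply.
have [c _] := @MVT_segment R sin cos 0 x x0 (fun y _ => is_derive_sin y)
  (continuous_subspaceT (@continuous_sin R)).
rewrite sin0 !subr0 => ->; rewrite normrM ler_piMl// ler_norml.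
by rewrite cos_geN1 cos_le1.
Qed.

Lemma one_minus_cos_ge0 (x : R) : 0 <= 2 * (1 - cos x).
Proof. by rewrite mulr_ge0// subr_ge0 cos_le1. Qed.

Lemma one_minus_cos_le4 (x : R) : 2 * (1 - cos x) <= 4.
Proof. by have := cos_geN1 x; lra. Qed.

Lemma one_minus_cos_le_sqr (x : R) : 2 * (1 - cos x) <= x ^+ 2.
Proof.
have -> : x = (x / 2) *+ 2 by rewrite -mulr_natr divfK.
have h := normr_sin_le (x / 2).
rewrite cos_mulr2n; set y := x / 2 in h *.
have := cos2Dsin2 y; have : sin y ^+ 2 <= y ^+ 2.
  by rewrite -[leLHS]real_normK ?num_real// -[leRHS]real_normK ?num_real// ler_pXn2r ?nnegrE.
by rewrite mulr2n [y *+ 2]mulr2n; nra.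
Qed.

End one_minus_cos.

(** * Cauchy-Schwarz, cubes and volumes of balls *)

Section enorm_theory.
Context {R : realType} (n : nat).
Local Notation leb := (@lebesgue_tuple R n).
Local Notation Rn := (n.-tuple R).
Implicit Types x y : Rn.

Lemma dotp_ge0 x : 0 <= dotp x x.
Proof. by apply: sumr_ge0 => i _; rewrite -expr2 sqr_ge0. Qed.

Lemma sqr_enorm x : enorm x ^+ 2 = dotp x x.
Proof. by rewrite sqr_sqrtr// dotp_ge0. Qed.

Lemma enorm_ge0 x : 0 <= enorm x.
Proof. exact: sqrtr_ge0. Qed.

Lemma enorm_scalet a x : 0 <= a -> enorm (scalet a x) = a * enorm x.
Proof.
move=> a0; rewrite /enorm dotp_scalet dotpC dotp_scalet mulrA -expr2.
by rewrite sqrtrM ?sqr_ge0// sqrtr_sqr ger0_norm.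
Qed.

(** With A = x.x, B = y.y and D = x.y, the product A (A B - D^2) is the squared length of A y - D x.
    The case A = 0 forces x = 0. *)
Lemma dotp_cauchy x y : `|dotp x y| <= enorm x * enorm y.
Proof.
rewrite -(@ler_pXn2r _ 2)// ?nnegrE ?mulr_ge0 ?enorm_ge0//.
rewrite exprMn !sqr_enorm real_normK ?num_real//.
set A := dotp x x; set B := dotp y y; set D := dotp x y.
have [A0|A0] := eqVneq A 0.
  have x0 i : tnth x i = 0.
    have := @psumr_eq0P _ _ xpredT (fun i => tnth x i * tnth x i).
    move=> /(_ (fun i _ => _) A0 i isT) H; apply/eqP.
    rewrite -[_ == 0](orbb) -mulf_eq0 H// => j.
    by rewrite -expr2 sqr_ge0.
  rewrite A0 mul0r /D /dotp big1 ?expr0n// => i _.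
  by rewrite x0 mul0r.
have Ap : 0 < A by rewrite lt_neqAle eq_sym A0 dotp_ge0.
suff : 0 <= A * (A * B - D ^+ 2) by rewrite pmulr_rge0// subr_ge0.
have -> : A * (A * B - D ^+ 2) = \sum_(i < n) (A * tnth y i - D * tnth x i) ^+ 2.
  transitivity (A ^+ 2 * B - (2 * A * D) * D + D ^+ 2 * A); first by ring.
  have -> : A ^+ 2 * B = \sum_(i < n) A ^+ 2 * (tnth y i * tnth y i) by rewrite -mulr_sumr.
  have -> : 2 * A * D * D = \sum_(i < n) 2 * A * D * (tnth x i * tnth y i) by rewrite -mulr_sumr.
  have -> : D ^+ 2 * A = \sum_(i < n) D ^+ 2 * (tnth x i * tnth x i) by rewrite -mulr_sumr.
  by rewrite -sumrB -big_split/=; apply: eq_bigr => i _; ring.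
by apply: sumr_ge0 => i _; exact: sqr_ge0.
Qed.

Implicit Types r : R.

Definition box r : Rn -> R := prodt (\1_(`[- r, r]%classic : set R)).

Lemma measurable_box_factor r :
  measurable_fun [set: measurableTypeR R] (\1_(`[- r, r]%classic : set R) : R -> R).
Proof. by apply: measurable_indic; exact: measurable_itv. Qed.

Lemma measurable_box r : measurable_fun setT (box r).
Proof. by apply: measurable_prodt; exact: measurable_box_factor. Qed.

Lemma box_ge0 r x : 0 <= box r x.
Proof. by apply: prodt_ge0 => t; rewrite indicE. Qed.

Lemma box1 r x : (forall i, `|tnth x i| <= r) -> box r x = 1.
Proof.
move=> xr; rewrite /box /prodt big1// => i _.
by rewrite indicE mem_set//= in_itv/= -ler_norml.
Qed.

Lemma box_le r x a : 0 <= a -> ((forall i, `|tnth x i| <= r) -> 1 <= a) ->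
  box r x <= a.
Proof.
move=> a0 xa; have [/forallP H|/forallPn[i xi]] := boolP [forall i, `|tnth x i| <= r].
  by rewrite box1// xa.
rewrite /box /prodt (bigD1 i)//= indicE memNset ?mul0r//= in_itv/= -ler_norml.
exact/negP.
Qed.

Lemma integral_box r : 0 <= r -> (\int[leb]_x (box r x)%:E = ((2 * r) ^+ n)%:E)%E.
Proof.
move=> r0; rewrite /box ge0_integral_prodt//.
have J : @lebesgue_measure R (`[- r, r]%classic : set R) = (2 * r)%:E.
  rewrite lebesgue_measure_itv/= lte_fin; case: ifPn => [_|].
    by rewrite -EFinB; congr EFin; ring.
  rewrite -leNgt => rr; have -> : r = 0 by lra.
  by rewrite mulr0.
have -> : (\int[@lebesgue_measure R]_x (\1_(`[- r, r]%classic : set R) x)%:E = (2 * r)%:E)%E.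
  by rewrite integral_indic ?setIT//; exact: J.
by rewrite -EFin_expe.
Qed.

Lemma enorm_ball_volume L :
  (leb [set x | (0 < enorm x <= expR L)%R] <= (2 ^+ n * expR (n%:R * L))%:E)%E.
Proof.
set A := [set x | _].
have mA : measurable A.
  have -> : A = [set x | 0 < enorm x] `&` [set x | enorm x <= expR L].
    by apply/seteqP; split => x /=; [move=> /andP[]|move=> [p q]; apply/andP; split].
  apply: measurableI.
    have := measurable_fun_ltr (measurable_cst (0 : R)) (@measurable_enorm R n).
    by move=> /(_ measurableT [set true]); rewrite setTI; apply.
  have := measurable_fun_ler (@measurable_enorm R n) (measurable_cst (expR L)).
  by move=> /(_ measurableT [set true]); rewrite setTI; apply.
rewrite -[A]setIT -integral_indic// expRM_natl -exprMn -integral_box ?expR_ge0//.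
apply: ge0_le_integralT.
- by apply/measurable_EFinP; exact: measurable_indic.
- by apply/measurable_EFinP; exact: measurable_box.
- by move=> x; rewrite lee_fin indicE.
- move=> x; rewrite lee_fin indicE; case: (boolP (x \in A)) => [|_]; last exact: box_ge0.
  rewrite inE => /andP[_ xL]; rewrite box1// => i.
  exact: le_trans (tnth_le_enorm _ _) _.
Qed.

Lemma integral_log_radial_enorm_lty de : 0 < de ->
  (\int[leb]_x (log_radial n%:R de (@enorm R n) x)%:E < +oo)%E.
Proof.
move=> de0; apply: (@log_radial_integral_lty _ _ _ _ _ _ (2 ^+ n)) => //.
- exact: measurable_enorm.
- exact: enorm_ball_volume.
Qed.

End enorm_theory.

(** * The symbol of the energy form *)

Section multiplier.
Context {R : realType} (n : nat) (s : R).
Hypothesis hs : 0 < s < 1.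
Local Notation leb := (@lebesgue_tuple R n).
Local Notation Rn := (n.-tuple R).
Implicit Types z xi : Rn.

Let s0 : 0 < s. Proof. by case/andP: hs. Qed.
Let s1 : 0 < 1 - s. Proof. by case/andP: hs; rewrite subr_gt0. Qed.

Lemma c_ns_gt0 : 0 < c_ns n s.
Proof.
have n0 : 0 <= n%:R :> R := ler0n _ n.
rewrite /c_ns; apply: mulr_gt0.
  apply: mulr_gt0 => //; apply: mulr_gt0; apply: powR_gt0 => //.
  exact: pi_gt0.
by apply: divr_gt0; apply: Gamma_gt0 => //; move: s0 n0; lra.
Qed.

Local Notation kappa := (c_ns n s).

Lemma kernel_plusE z : 0 < enorm z -> kernel_plus s z =
  kappa * expR ((- n%:R - 2 * s) * ln (enorm z)) * Num.max 0 (- ln (enorm z)).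
Proof. by move=> z0; rewrite /kernel_plus /powR gt_eqF. Qed.

Lemma kernel_plus0 z : ~~ (0 < enorm z) -> kernel_plus s z = 0.
Proof.
rewrite -leNgt => z0; have zE : enorm z = 0 by apply/le_anti; rewrite z0 enorm_ge0.
by rewrite /kernel_plus zE ln0// oppr0 maxxx mulr0.
Qed.

Lemma kernel_plus_ge0 z : 0 <= kernel_plus s z.
Proof.
apply: mulr_ge0; last by rewrite le_max lexx.
by apply: mulr_ge0; [exact: ltW c_ns_gt0|exact: powR_ge0].
Qed.

Lemma measurable_kernel_plus : measurable_fun setT (@kernel_plus R n s).
Proof.
apply: measurable_funM.
  apply: measurable_funM => //.
  by apply: (measurableT_comp (@measurable_powR R _)); exact: measurable_enorm.
apply: measurable_maxr => //; apply: measurable_funN.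
by apply: (measurableT_comp (@measurable_ln R)); exact: measurable_enorm.
Qed.

(** Valued in the extended reals: its finiteness is a consequence of the upper bound proved
    below. *)
Definition increment_symbol xi : \bar R :=
  (\int[leb]_z (kernel_plus s z * (2 * (1 - cos (dotp xi z))))%:E)%E.

Local Notation mult := increment_symbol.

Lemma measurable_one_minus_cos_dotp : measurable_fun [set: Rn * Rn]
  (fun p => 2 * (1 - cos (dotp p.2 p.1))).
Proof.
apply: measurable_funM => //; apply: measurable_funB => //.
apply: (measurableT_comp (@measurable_cos R)).
by apply: measurable_fun_dotp; [exact: measurable_snd|exact: measurable_fst].
Qed.

Lemma measurable_symbol_integrand xi :
  measurable_fun setT (fun z => (kernel_plus s z * (2 * (1 - cos (dotp xi z))))%:E).
Proof.
apply/measurable_EFinP; apply: measurable_funM; first exact: measurable_kernel_plus.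
apply: measurable_funM => //; apply: measurable_funB => //.
by apply: (measurableT_comp (@measurable_cos R)); exact: measurable_dotp.
Qed.

Lemma symbol_integrand_ge0 xi z : 0 <= kernel_plus s z * (2 * (1 - cos (dotp xi z))).
Proof. by rewrite mulr_ge0 ?kernel_plus_ge0 ?one_minus_cos_ge0. Qed.

Lemma energy_formE (u : Rn -> R) : L2 n u -> energy_form s u =
  (\int[leb]_xi (mult xi * (Normc.normc (fourier u xi) ^+ 2)%:E))%E.
Proof.
move=> L2u; have [mu _] := (L2P u).1 L2u.
have mw := measurable_fourier_sqr L2u.
set w2 := fun xi => Normc.normc (fourier u xi) ^+ 2.
have w20 xi : 0 <= w2 xi by exact: sqr_ge0.
rewrite /energy_form double_integral_increment//; last 2 first.
- exact: measurable_kernel_plus.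
- exact: kernel_plus_ge0.
pose F (p : Rn * Rn) : \bar R :=
  (kernel_plus s p.1 * (2 * (1 - cos (dotp p.2 p.1)) * w2 p.2))%:E.
have mF : measurable_fun setT F.
  apply/measurable_EFinP; apply: measurable_funM.
    by apply: (measurableT_comp measurable_kernel_plus); exact: measurable_fst.
  apply: measurable_funM; first exact: measurable_one_minus_cos_dotp.
  by apply: (measurableT_comp mw); exact: measurable_snd.
have F0 p : (0 <= F p)%E.
  by rewrite lee_fin mulr_ge0 ?kernel_plus_ge0// mulr_ge0 ?one_minus_cos_ge0.
transitivity (\int[leb]_z \int[leb]_xi F (z, xi))%E.
  apply: eq_integral => z _; rewrite (increment_fourier L2u).
  rewrite -ge0_integralZl_EFin//.
  - move=> xi _; rewrite lee_fin; apply: mulr_ge0; first exact: one_minus_cos_ge0.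
    exact: w20.
  - apply/measurable_EFinP; apply: measurable_funM => //.
    apply: measurable_funM => //; apply: measurable_funB => //.
    apply: (measurableT_comp (@measurable_cos R)).
    rewrite (_ : (fun _ => _) = dotp z); first exact: measurable_dotp.
    by apply/funext => xi; rewrite dotpC.
  - exact: kernel_plus_ge0.
rewrite fubini_tonelli//; apply: eq_integral => xi _.
rewrite muleC -ge0_integralZl_EFin//.
- by apply: eq_integral => z _; rewrite /F/= -EFinM; congr EFin; rewrite [RHS]mulrC -!mulrA.
- by move=> z _; rewrite lee_fin symbol_integrand_ge0.
- exact: measurable_symbol_integrand.
- exact: w20.
Qed.

(** The integrand in w decays with exponent 2s at infinity. Near 0 it gains 2 (1 - s), half of which
    is spent on absorbing the logarithm. *)
Let de := Num.min (1 - s) (2 * s).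

Let de0 : 0 < de. Proof. by rewrite lt_min s1 mulr_gt0. Qed.

Let de1 : de <= 1 - s. Proof. by rewrite ge_min lexx. Qed.

Let de2 : de <= 2 * s. Proof. by rewrite ge_min lexx orbT. Qed.

(** The rescaled integrand in logarithmic variables: L = ln |w|, l = ln |xi|, and P = 2 (1 - cos) is
    the oscillating factor. For L >= 0 the bound P <= 4 is enough. For L < 0 and y = - L, P <=
    e^(-2y) leaves e^(-2(1-s)y) (l + y), where y <= e^((1-s)y) / (1 - s). *)
Lemma log_profile_le (l L P : R) : 0 <= l -> 0 <= P -> P <= 4 -> P <= expR (2 * L) ->
  expR (- (2 * s) * L) * Num.max 0 (l - L) * P <=
  expR (- de * `|L|) * (4 * l + (1 - s)^-1).
Proof.
move=> l0 P0 P4 PL; have t0 : 0 <= (1 - s)^-1 by rewrite invr_ge0 ltW.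
have [L0|L0] := leP 0 L.
  rewrite (ger0_norm L0) -mulrA; apply: ler_pM.
  - exact: expR_ge0.
  - by rewrite mulr_ge0// le_max lexx.
  - by rewrite ler_expR !mulNr lerN2 ler_wpM2r.
  apply: (@le_trans _ _ (l * 4)); last lra.
  by apply: ler_pM => //; [rewrite le_max lexx|rewrite ge_max l0; lra].
rewrite (ltr0_norm L0); set y := - L; have y0 : 0 < y by rewrite oppr_gt0.
have -> : L = - y by rewrite opprK.
rewrite opprK max_r; last by lra.
have e1 : expR (- (2 * s) * - y) * P <= expR (- (2 * (1 - s) * y)).
  apply: (@le_trans _ _ (expR (- (2 * s) * - y) * expR (2 * L))).
    by rewrite ler_wpM2l// expR_ge0.
  by rewrite -expRD ler_expR /y; lra.
apply: (@le_trans _ _ (expR (- (2 * (1 - s) * y)) * (l + y))).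
  by rewrite mulrAC -{1}[L]opprK ler_wpM2r//; lra.
rewrite mulrDr [leRHS]mulrDr; apply: lerD.
  apply: ler_pM; rewrite ?expR_ge0//; last lra.
  rewrite ler_expR mulNr lerN2; apply: (le_trans (ler_wpM2r (ltW y0) de1)).
  by have : 0 <= (1 - s) * y; [rewrite mulr_ge0// ltW|lra].
have -> : - (2 * (1 - s) * y) = - ((1 - s) * y) - ((1 - s) * y) by ring.
rewrite expRD -mulrA; apply: ler_pM.
- exact: expR_ge0.
- by rewrite mulr_ge0 ?expR_ge0// ltW.
- by rewrite ler_expR mulNr lerN2 ler_wpM2r// ltW.
rewrite expRN mulrC ler_pdivrMr ?expR_gt0// [leRHS]mulrC ler_pdivlMr//.
by rewrite mulrC (le_trans _ (expR_ge1Dx _))// lerDr.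
Qed.

Local Notation radial := (log_radial n%:R de (@enorm R n)).

(** At low frequencies nothing is rescaled: |xi . z| <= |z| holds already, and the profile bound is
    used with l = 0. *)
Lemma symbol_integrand_le_small xi z : enorm xi <= 1 ->
  kernel_plus s z * (2 * (1 - cos (dotp xi z))) <= kappa * (1 - s)^-1 * radial z.
Proof.
move=> xi1; have [z0|z0] := boolP (0 < enorm z); last first.
  rewrite kernel_plus0// mul0r mulr_ge0 ?log_radial_ge0// mulr_ge0 ?(ltW c_ns_gt0)//.
  by rewrite invr_ge0 ltW.
rewrite kernel_plusE// /log_radial z0; set L := ln (enorm z).
have zL : enorm z = expR L by rewrite lnK.
set P := 2 * (1 - cos _).
have PL : P <= expR (2 * L).
  apply: (le_trans (one_minus_cos_le_sqr _)).
  rewrite (expRM_natl 2) -zL -[leLHS]real_normK ?num_real// ler_pXn2r ?nnegrE ?enorm_ge0//.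
  apply: (le_trans (dotp_cauchy _ _)).
  by rewrite ler_piMl// enorm_ge0.
have := log_profile_le (lexx 0) (one_minus_cos_ge0 _) (one_minus_cos_le4 _) PL.
rewrite -/P mulr0 !add0r => H.
have -> : (- n%:R - 2 * s) * L = - n%:R * L + - (2 * s) * L by ring.
have -> : - n%:R * L - de * `|L| = - n%:R * L + - de * `|L| by ring.
rewrite !expRD.
set a := expR _ in H *; set b := expR _ in H *; set c := expR _; set m := Num.max _ _ in H *.
have -> : kappa * (c * a) * m * P = kappa * c * (a * m * P) by ring.
have -> : kappa * (1 - s)^-1 * (c * b) = kappa * c * (b * (1 - s)^-1) by ring.
by rewrite ler_wpM2l// mulr_ge0 ?expR_ge0// ltW// c_ns_gt0.
Qed.

(* The substitution [z = w / r] reduces to frequencies of length 1. *)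
Lemma symbol_integrand_le_large xi w : 1 <= enorm xi -> let r := enorm xi in
  r^-1 ^+ n * (kernel_plus s (scalet r^-1 w) * (2 * (1 - cos (dotp xi (scalet r^-1 w))))) <=
  kappa * r `^ (2 * s) * (4 * ln r + (1 - s)^-1) * radial w.
Proof.
move=> xi1 /=; set r := enorm xi; set l := ln r.
have r0 : 0 < r by exact: lt_le_trans xi1.
have l0 : 0 <= l by exact: ln_ge0.
have t0 : 0 <= (1 - s)^-1 by rewrite invr_ge0 ltW.
have k0 := ltW c_ns_gt0.
have rl : r = expR l by rewrite lnK.
have c0 : 0 <= 4 * l + (1 - s)^-1 by rewrite addr_ge0// mulr_ge0.
have Nw : enorm (scalet r^-1 w) = r^-1 * enorm w by rewrite enorm_scalet// invr_ge0 ltW.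
have [w0|w0] := boolP (0 < enorm w); last first.
  rewrite kernel_plus0; last by rewrite Nw pmulr_rgt0// invr_gt0.
  rewrite mul0r mulr0 mulr_ge0 ?log_radial_ge0//.
  by apply: mulr_ge0 => //; apply: mulr_ge0 => //; exact: powR_ge0.
have N0 : 0 < enorm (scalet r^-1 w) by rewrite Nw mulr_gt0// invr_gt0.
rewrite kernel_plusE// Nw lnM ?posrE ?invr_gt0// lnV ?posrE// -/l.
rewrite /log_radial w0; set L := ln (enorm w).
have wL : enorm w = expR L by rewrite lnK.
set P := 2 * (1 - cos _).
have PL : P <= expR (2 * L).
  apply: (le_trans (one_minus_cos_le_sqr _)).
  rewrite (expRM_natl 2) -wL -[leLHS]real_normK ?num_real// ler_pXn2r ?nnegrE ?enorm_ge0//.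
  apply: (le_trans (dotp_cauchy _ _)).
  by rewrite Nw mulrA mulfV ?gt_eqF// mul1r.
have := log_profile_le l0 (one_minus_cos_ge0 _) (one_minus_cos_le4 _) PL.
have -> : - (- l + L) = l - L by ring.
have -> : r^-1 ^+ n = expR (- n%:R * l) by rewrite mulNr expRN expRM_natl -rl exprVn.
have -> : r `^ (2 * s) = expR (2 * s * l) by rewrite /powR gt_eqF.
have -> : - n%:R * L - de * `|L| = - n%:R * L + - de * `|L| by ring.
have -> : (- n%:R - 2 * s) * (- l + L) = n%:R * l + 2 * s * l + (- n%:R * L + - (2 * s) * L).
  by ring.
rewrite !expRD mulNr expRN.
set a := expR (- (2 * s) * L); set b := expR (- de * _); set c := expR (- n%:R * L).
set d := expR (2 * s * l); set e := expR (n%:R * l); set m := Num.max _ _; set q := _ + (1 - s)^-1 => H.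
have e0 : e != 0 by rewrite gt_eqF// expR_gt0.
have -> : e^-1 * (kappa * (e * d * (c * a)) * m * P) = kappa * d * c * (a * m * P).
  by field.
have -> : kappa * d * q * (c * b) = kappa * d * c * (b * q) by ring.
apply: ler_wpM2l => //; apply: mulr_ge0; last exact: expR_ge0.
by apply: mulr_ge0 => //; exact: expR_ge0.
Qed.

Let I : \bar R := (\int[leb]_z (radial z)%:E)%E.

Let I_fin : I \is a fin_num.
Proof.
rewrite ge0_fin_numE; first exact: integral_log_radial_enorm_lty.
by apply: integral_ge0 => z _; rewrite lee_fin log_radial_ge0.
Qed.

Let mradial : measurable_fun setT (EFin \o radial).
Proof. by apply/measurable_EFinP; apply: measurable_log_radial; exact: measurable_enorm. Qed.

Let integral_radialZ c : 0 <= c -> (\int[leb]_z (c * radial z)%:E = (c * fine I)%:E)%E.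
Proof.
move=> c0; under eq_integral do rewrite EFinM.
rewrite ge0_integralZl_EFin//; first by rewrite EFinM fineK.
by move=> z _; rewrite lee_fin log_radial_ge0.
Qed.

Definition log_weight xi : R := enorm xi `^ (2 * s) * Num.max 0 (ln (enorm xi)).

Lemma log_weight_ge0 xi : 0 <= log_weight xi.
Proof. by rewrite mulr_ge0 ?powR_ge0// le_max lexx. Qed.

Lemma increment_symbol_le : exists2 K : R, 0 <= K &
  forall xi, (mult xi <= (K * (1 + log_weight xi))%:E)%E.
Proof.
have k0 := ltW c_ns_gt0.
have t0 : 0 <= (1 - s)^-1 by rewrite invr_ge0 ltW.
have I0 : 0 <= fine I.
  by apply: fine_ge0; apply: integral_ge0 => z _; rewrite lee_fin log_radial_ge0.
(* The 4 pays for the logarithmic term; the rest pays for r^(2s) / (1 - s), through r^(2s) <= e^2 +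
   r^(2s) ln r. *)
pose B := 4 + (1 - s)^-1 * (expR 2 + 1).
have B0 : 0 <= B by rewrite addr_ge0// mulr_ge0// addr_ge0// expR_ge0.
have tB : (1 - s)^-1 <= B.
  rewrite /B; have : (1 - s)^-1 * 1 <= (1 - s)^-1 * (expR 2 + 1).
    by rewrite ler_wpM2l// lerDr expR_ge0.
  lra.
have mle c : measurable_fun setT (fun z => (c * radial z)%:E).
  by apply/measurable_EFinP; apply: measurable_funM => //; exact/measurable_EFinP.
exists (kappa * fine I * B); first by apply: mulr_ge0 => //; apply: mulr_ge0.
move=> xi; have W0 := log_weight_ge0 xi.
have [xi1|xi1] := leP (enorm xi) 1.
  apply: (@le_trans _ _ (\int[leb]_z (kappa * (1 - s)^-1 * radial z)%:E)%E).
    apply: ge0_le_integralT => //.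
    - exact: measurable_symbol_integrand.
    - by move=> z; rewrite lee_fin symbol_integrand_ge0.
    - by move=> z; rewrite lee_fin symbol_integrand_le_small.
  rewrite integral_radialZ; last exact: mulr_ge0.
  rewrite lee_fin.
  have -> : kappa * (1 - s)^-1 * fine I = kappa * fine I * (1 - s)^-1 by ring.
  rewrite -[leRHS]mulrA; apply: ler_wpM2l; first exact: mulr_ge0.
  apply: (le_trans tB).
  by rewrite ler_peMr// lerDl.
set r := enorm xi in xi1 *.
have r0 : 0 < r by exact: lt_trans xi1.
have ri0 : 0 < r^-1 by rewrite invr_gt0.
have lr0 : 0 <= ln r by rewrite ln_ge0// ltW.
pose f z := (kernel_plus s z * (2 * (1 - cos (dotp xi z))))%:E.
have mf : measurable_fun setT f by exact: measurable_symbol_integrand.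
have f0 z : (0 <= f z)%E by rewrite lee_fin symbol_integrand_ge0.
have scale : mult xi = ((r^-1 ^+ n)%:E * \int[leb]_w f (scalet r^-1 w))%E.
  rewrite ge0_integral_scale// invrK muleA -EFinM -exprMn mulVf ?gt_eqF//.
  by rewrite expr1n mul1e.
have mfs : measurable_fun setT (fun w => f (scalet r^-1 w)).
  by apply: (measurableT_comp mf); exact: measurable_scalet.
rewrite scale -ge0_integralZl_EFin//; last by rewrite exprn_ge0// ltW.
pose A := kappa * r `^ (2 * s) * (4 * ln r + (1 - s)^-1).
have A0 : 0 <= A.
  apply: mulr_ge0; first by apply: mulr_ge0 => //; exact: powR_ge0.
  by rewrite addr_ge0// mulr_ge0.
apply: (@le_trans _ _ (\int[leb]_w (A * radial w)%:E)%E).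
  apply: ge0_le_integralT => //.
  - by apply: measurable_funeM.
  - by move=> w; rewrite mule_ge0// lee_fin exprn_ge0// ltW.
  - by move=> w; rewrite -EFinM lee_fin; apply: symbol_integrand_le_large; exact: ltW.
rewrite integral_radialZ// lee_fin /A.
set p := r `^ (2 * s); have p0 : 0 <= p by exact: powR_ge0.
have WE : log_weight xi = p * ln r by rewrite /log_weight max_r.
(* If ln r <= 1 then r^(2s) <= e^(2s) <= e^2; otherwise the logarithm is at least 1. *)
have ple : p <= expR 2 + p * ln r.
  have [l1|l1] := leP (ln r) 1.
    apply: (@le_trans _ _ (expR 2)); last by rewrite lerDl mulr_ge0.
    rewrite /p /powR gt_eqF// ler_expR.
    have := ler_wpM2l (ltW s0) l1; have := s1; lra.
  apply: (@le_trans _ _ (p * ln r)); last by rewrite lerDr expR_ge0.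
  by rewrite ler_peMr// ltW.
have -> : kappa * p * (4 * ln r + (1 - s)^-1) * fine I =
    kappa * fine I * (4 * (p * ln r) + (1 - s)^-1 * p) by ring.
rewrite -[leRHS]mulrA; apply: ler_wpM2l; first exact: mulr_ge0.
rewrite WE.
set W := p * ln r in ple *; have W1 : 0 <= W by rewrite mulr_ge0.
have E0 : 0 <= expR 2 :> R by exact: expR_ge0.
have tp := ler_wpM2l t0 ple.
have tE : 0 <= (1 - s)^-1 * expR 2 * W by rewrite !mulr_ge0.
by rewrite /B; set t := (1 - s)^-1 in t0 tp tE *; lra.
Qed.

Lemma increment_symbol_ge : (0 < n)%N -> exists2 c : R, 0 < c &
  forall xi, 2 <= enorm xi -> ((c * log_weight xi)%:E <= mult xi)%E.
Proof.
move=> n0; have nR : 0 < n%:R :> R by rewrite ltr0n.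
have k0 := c_ns_gt0.
(* [c1] comes from |z| <= 5/4 r^-1 in the power of the kernel, [c2] from a phase of at least 3/4,
   [c3] from the volume of the box; the factor 1/2 below is the share of ln r left in the kernel. *)
pose c1 : R := expR (- (n%:R + 2 * s) * ln (5 / 4)).
pose c2 : R := 2 * (1 - cos (3 / 4)).
pose c3 : R := (2 * n%:R)^-1 ^+ n.
have c20 : 0 < c2.
  have p2 := pi_ge2 R; rewrite mulr_gt0// subr_gt0.
  have : cos (3 / 4) < cos 0 :> R.
    by rewrite ltr_cos ?in_itv/=; [lra|apply/andP; split; lra|apply/andP; split; lra].
  by rewrite cos0.
have c30 : 0 < c3 by rewrite exprn_gt0// invr_gt0 mulr_gt0.
exists (kappa * c1 * 2^-1 * c2 * c3).
  by apply: mulr_gt0 => //; apply: mulr_gt0 => //; apply: mulr_gt0 => //; apply: mulr_gt0 => //; exact: expR_gt0.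
move=> xi; set r := enorm xi => r2.
have r0 : 0 < r by exact: lt_le_trans r2.
have ri0 : 0 < r^-1 by rewrite invr_gt0.
set l := ln r.
have l0 : 0 <= l by rewrite ln_ge0//; apply: le_trans r2; rewrite ler1n.
have rl : r = expR l by rewrite lnK.
(* (5/4)^2 <= 2 <= r, so the kernel's logarithm at |z| <= 5 / (4r) keeps at least half of ln r. *)
have l54 : ln (5 / 4) <= l / 2.
  rewrite ler_pdivlMr// mulr_natr -lnXn//.
  by rewrite ler_ln ?posrE// expr2; lra.
(* Chosen so that n r rho = 1/4: a displacement d inside the box changes the phase by at most 1/4
   and has |d| <= 1 / (4r). *)
pose rho := (4 * n%:R * r)^-1.
have rho0 : 0 < rho by rewrite invr_gt0 !mulr_gt0.
have nrho : n%:R * rho = (4 * r)^-1 by rewrite /rho; field; rewrite !gt_eqF.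
(* The box is centred at xi / |xi|^2, where the phase is 1; [addt z h] is the displacement of z from
   that centre. *)
pose h := scalet (- r^-2) xi.
pose C := kappa * (c1 * expR ((n%:R + 2 * s) * l)) * (l / 2) * c2.
have C0 : 0 <= C.
  apply: mulr_ge0; last exact: ltW.
  apply: mulr_ge0; last by rewrite mulr_ge0.
  by apply: mulr_ge0; [exact: ltW|rewrite mulr_ge0 ?expR_ge0].
have near z : (forall i, `|tnth (addt z h) i| <= rho) ->
    C <= kernel_plus s z * (2 * (1 - cos (dotp xi z))).
  move=> zh; set d := addt z h in zh.
  have d1 : `|dotp xi d| <= 4^-1.
    apply: (@le_trans _ _ (\sum_(i < n) r * rho)).
      apply: (le_trans (ler_norm_sum _ _ _)); apply: ler_sum => i _.
      by rewrite normrM ler_pM// tnth_le_enorm.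
    rewrite sumr_const card_ord -[leLHS]mulr_natr -mulrA [rho * _]mulrC nrho.
    by rewrite le_eqVlt; apply/orP; left; apply/eqP; field; rewrite gt_eqF.
  have d2 : dotp d d <= (4 * r)^-2.
    apply: (@le_trans _ _ (\sum_(i < n) rho ^+ 2)).
      apply: ler_sum => i _; rewrite -expr2 -[leLHS]real_normK ?num_real//.
      by rewrite ler_pXn2r// nnegrE ltW.
    rewrite sumr_const card_ord -[leLHS]mulr_natr -exprVn -nrho exprMn mulrC ler_wpM2r ?sqr_ge0//.
    by rewrite expr2 ler_peMr// ler1n.
  have xx : dotp xi xi = r ^+ 2 by rewrite sqr_enorm.
  have hx : dotp xi h = - 1.
    by rewrite dotpC dotp_scalet xx; field; rewrite gt_eqF.
  have dx : dotp xi d = dotp xi z - 1 by rewrite dotp_addtr hx.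
  have zx : 3 / 4 <= dotp xi z <= 5 / 4.
    by move: d1; rewrite dx ler_norml => /andP[? ?]; lra.
  have zpos : 0 < enorm z.
    rewrite lt_neqAle enorm_ge0 andbT eq_sym; apply/negP => /eqP z0.
    have := dotp_cauchy xi z; rewrite z0 mulr0 normr_le0 => /eqP e.
    by move: zx; rewrite e; lra.
  (* |z|^2 = |d|^2 + (2 xi.z - 1) / r^2 <= (1/16 + 3/2) / r^2, and 1/16 + 3/2 = (5/4)^2. *)
  have zle : enorm z <= 5 / 4 * r^-1.
    rewrite -(@ler_pXn2r _ 2)// ?nnegrE ?enorm_ge0//; last by rewrite mulr_ge0// ltW.
    have dd : dotp d d = dotp z z - 2 * r^-2 * dotp xi z + r^-2.
      rewrite {2}/d dotp_addtr ![dotp d _]dotpC !dotp_addtr.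
      rewrite /h [dotp z (scalet _ _)]dotpC !dotp_scalet.
      rewrite [dotp xi (scalet _ _)]dotpC !dotp_scalet xx.
      by field; rewrite gt_eqF.
    rewrite sqr_enorm; have := d2; rewrite dd.
    have : 0 < r^-2 by rewrite invr_gt0 exprn_gt0.
    have -> : (5 / 4 * r^-1) ^+ 2 = 25 / 16 * r^-2 by field; rewrite gt_eqF.
    have -> : (4 * r)^-2 = 16^-1 * r^-2 by field; rewrite gt_eqF.
    case/andP: zx => _ zx q0; have := ler_wpM2l (ltW q0) zx.
    lra.
  rewrite kernel_plusE//; set L := ln (enorm z).
  have LL : L <= ln (5 / 4) - l.
    have -> : ln (5 / 4) - l = ln (5 / 4 * r^-1).
      by rewrite [RHS]lnM ?posrE ?divr_gt0// [ln r^-1]lnV ?posrE.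
    by rewrite ler_ln ?posrE// mulr_gt0// divr_gt0.
  have n2 : 0 <= n%:R + 2 * s by rewrite addr_ge0 ?mulr_ge0// ltW.
  rewrite max_r; last by lra.
  rewrite /C; apply: ler_pM.
  - apply: mulr_ge0; last by rewrite mulr_ge0.
    by apply: mulr_ge0; [exact: ltW|rewrite mulr_ge0 ?expR_ge0].
  - exact: ltW.
  - apply: ler_pM.
    + by apply: mulr_ge0; [exact: ltW|rewrite mulr_ge0 ?expR_ge0].
    + by rewrite mulr_ge0.
    + apply: ler_wpM2l; first exact: ltW.
      rewrite /c1 -expRD ler_expR.
      have := ler_wpM2l n2 LL; lra.
    + lra.
  - rewrite /c2 ler_pM2l// lerD2l lerN2.
    have [/andP[z1 z2] p2] := (zx, pi_ge2 R).
    by rewrite leNgt ltr_cos ?in_itv/=; [rewrite -leNgt|apply/andP; split; lra|apply/andP; split; lra].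
apply: (@le_trans _ _ (\int[leb]_z (C * box rho (addt z h))%:E)%E); last first.
  apply: ge0_le_integralT.
  - apply/measurable_EFinP; apply: measurable_funM => //.
    apply: (measurableT_comp (measurable_box rho)).
    exact: measurable_addt.
  - exact: measurable_symbol_integrand.
  - by move=> z; rewrite lee_fin mulr_ge0// box_ge0.
  - move=> z; rewrite lee_fin -[leRHS]mulr1.
    have [C1|C1] := eqVneq C 0; first by rewrite C1 mul0r mulr1 symbol_integrand_ge0.
    have Cp : 0 < C by rewrite lt_neqAle eq_sym C1.
    rewrite mulrC -ler_pdivlMr// mulr1; apply: box_le.
      by rewrite divr_ge0// symbol_integrand_ge0.
    by move=> /near zC; rewrite ler_pdivlMr// mul1r.
rewrite (@ge0_integral_translate R n h (fun z => (C * box rho z)%:E)); last 2 first.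
- by apply/measurable_EFinP; apply: measurable_funM => //; exact: measurable_box.
- by move=> z; rewrite lee_fin mulr_ge0// box_ge0.
under eq_integral do rewrite EFinM.
rewrite ge0_integralZl_EFin//; last 2 first.
- by move=> z _; rewrite lee_fin box_ge0.
- by apply/measurable_EFinP; exact: measurable_box.
rewrite (integral_box _ (ltW rho0)) -EFinM lee_fin.
rewrite /log_weight -/r max_r// -/l.
have -> : r `^ (2 * s) = expR (2 * s * l) by rewrite /powR gt_eqF.
have -> : (2 * rho) ^+ n = c3 * expR (- (n%:R * l)).
  rewrite expRN expRM_natl -rl /c3 /rho -exprVn -exprMn; congr (_ ^+ _).
  by field; rewrite !gt_eqF.
rewrite /C [(n%:R + 2 * s) * l]mulrDl expRD expRN.
have : expR (n%:R * l) != 0 by rewrite gt_eqF// expR_gt0.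
set e := expR (n%:R * l) => e0; rewrite le_eqVlt; apply/orP; left; apply/eqP.
by field.
Qed.

End multiplier.

(** * The spectral form *)

Section image_density.
Context d1 d2 (T1 : measurableType d1) (T2 : measurableType d2) {R : realType}.
Variables (mu : {measure set T1 -> \bar R}) (nu : {measure set T2 -> \bar R}).
Variables (h : T1 -> T2) (w : T1 -> R).
Hypothesis mh : measurable_fun setT h.
Hypothesis mw : measurable_fun setT w.
Hypothesis w0 : forall x, 0 <= w x.
Hypothesis nuE : forall B, measurable B ->
  nu B = (\int[mu]_(x in h @^-1` B) (w x)%:E)%E.

Import HBNNSimple.

Let simple (f : {nnsfun T2 >-> R}) :
  (\int[nu]_y (f y)%:E = \int[mu]_x (f (h x) * w x)%:E)%E.
Proof.
have mhA (A : set T2) : measurable A -> measurable (h @^-1` A).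
  by move=> mA; rewrite -[X in measurable X]setTI; exact: mh.
pose F r x := (r * \1_(f @^-1` [set r]) (h x) * w x)%:E.
have mF r : measurable_fun setT (F r).
  apply/measurable_EFinP; apply: measurable_funM => //; apply: measurable_funM => //.
  by apply: (measurableT_comp _ mh); exact: measurable_indic.
have F0 r x : (0 <= F r x)%E.
  by rewrite /F EFinM mule_ge0 ?lee_fin// -lee_fin EFinM nnfun_muleindic_ge0.
transitivity (\sum_(r \in range f) \int[mu]_x F r x)%E.
  under eq_integral do rewrite fimfunE -fsumEFin//.
  rewrite ge0_integral_fsum//; last 2 first.
  - by move=> y; exact/measurable_EFinP/measurable_funM.
  - by move=> y x _; rewrite EFinM nnfun_muleindic_ge0.
  apply: eq_fsbigr => r rf; rewrite integralZl_indic_nnsfun// integral_indic//= setIT.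
  have r0 : 0 <= r by move: rf; rewrite inE => -[y _ <-].
  have mA : measurable (f @^-1` [set r]) by exact: measurable_funPTI.
  rewrite nuE// -ge0_integralZl_EFin//; last 3 first.
  - exact: mhA.
  - by move=> x _; rewrite lee_fin.
  - by apply: measurable_funTS; exact/measurable_EFinP.
  rewrite integral_mkcond; apply: eq_integral => x _.
  rewrite /patch /F indicE; case: ifPn => [/[!inE] xA|xA].
    by rewrite mem_set// mulr1 EFinM.
  by rewrite memNset ?mulr0 ?mul0r// => ?; move: xA; rewrite notin_setE.
rewrite -ge0_integral_fsum//; apply: eq_integral => x _.
rewrite /F fsumEFin// -mulr_fsuml; congr (_ * _)%:E.
by rewrite [in RHS]fimfunE.
Qed.

(** [nu] is the image under [h] of the measure with density [w], known only through its values on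
    sets, which is how the spectral measure is given. The formula is extended from simple functions
    by monotone convergence. *)
Lemma ge0_integral_image_density (f : T2 -> \bar R) : measurable_fun setT f ->
  (forall y, 0 <= f y)%E ->
  (\int[nu]_y f y = \int[mu]_x (f (h x) * (w x)%:E))%E.
Proof.
move=> mf f0; pose f_ := nnsfun_approx measurableT mf.
transitivity (limn (fun n => \int[nu]_y (f_ n y)%:E))%E.
  rewrite -monotone_convergence//.
  - apply: eq_integral => y _; apply/esym/cvg_lim => //.
    by apply: cvg_nnsfun_approx => // *; apply: f0.
  - by move=> n; exact/measurable_EFinP/measurable_funP.
  - by move=> n y _; rewrite lee_fin.
  - by move=> y _ m n mn; rewrite lee_fin; exact/lefP/nd_nnsfun_approx.
rewrite [X in limn X](_ : _ = (fun n => \int[mu]_x (f_ n (h x) * w x)%:E)%E); last first.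
  by apply/funext => n; exact: simple.
rewrite -monotone_convergence//; last 3 first.
- move=> n; apply/measurable_EFinP; apply: measurable_funM => //.
  by apply: (measurableT_comp _ mh); exact: measurable_funP.
- by move=> n x _; rewrite lee_fin mulr_ge0.
- by move=> x _ m n mn; rewrite lee_fin ler_wpM2r//; exact/lefP/nd_nnsfun_approx.
apply: eq_integral => x _; apply/cvg_lim => //.
under eq_fun do rewrite EFinM.
have [->|wx] := eqVneq (w x) 0.
  by rewrite mule0; apply: cvg_near_cst; apply: nearW => n; rewrite mule0.
apply: cvgeZr => //.
by apply: cvg_nnsfun_approx => // *; apply: f0.
Qed.

End image_density.

Section spectral.
Context {R : realType} (n : nat).
Local Notation leb := (@lebesgue_tuple R n).
Local Notation Rn := (n.-tuple R).

Definition spectral_weight (s : R) (xi : Rn) : R :=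
  enorm xi `^ (2 * s) * ln (enorm xi ^+ 2) ^+ 2.

Lemma spectral_weight_ge0 s xi : 0 <= spectral_weight s xi.
Proof. by rewrite mulr_ge0 ?powR_ge0// sqr_ge0. Qed.

Lemma spectral_formE s (u : Rn -> R) : L2 n u -> spectral_form s u =
  (\int[leb]_xi (spectral_weight s xi * Normc.normc (fourier u xi) ^+ 2)%:E)%E.
Proof.
move=> L2u; rewrite /spectral_form integral_mkcond.
pose I := `]0, +oo[%classic : set R.
pose f : R -> \bar R := (fun l : R => (l `^ s * ln l ^+ 2)%:E) \_ I.
have mI : measurable (I : set (measurableTypeR R)) by exact: measurable_itv.
have mf : measurable_fun [set: measurableTypeR R] f.
  apply/(measurable_restrictT _ mI).
  apply: (@measurable_funS _ _ _ _ setT) => //; apply/measurable_EFinP.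
  apply: measurable_funM; first exact: measurable_powR.
  by apply: measurable_funX; exact: measurable_ln.
have f0 l : (0 <= f l)%E.
  by rewrite /f /patch; case: ifP => // _; rewrite lee_fin mulr_ge0 ?powR_ge0// sqr_ge0.
have menorm2 : measurable_fun [set: Rn] (fun xi : Rn => enorm xi ^+ 2).
  by apply: measurable_funX; exact: measurable_enorm.
rewrite (@ge0_integral_image_density _ _ _ _ _ leb _ (fun xi => enorm xi ^+ 2)
  (fun xi => Normc.normc (fourier u xi) ^+ 2))//.
- apply: eq_integral => xi _; rewrite -[X in (X * _)%E]/(f _) [RHS]EFinM; congr (_ * _)%E.
  rewrite /f /patch /I; have [x0|x0] := boolP (0 < enorm xi ^+ 2).
    rewrite mem_set/= ?in_itv/= ?x0//; congr ((_ * _)%:E).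
    by rewrite -(powR_mulrn 2) ?enorm_ge0// -powRrM.
  (* At xi = 0 the spectral integral excludes the point, and the weight vanishes as well since
     [ln 0] is 0 by convention. *)
  rewrite memNset/= ?in_itv/= ?andbT; last exact/negP.
  by rewrite /spectral_weight ln0 ?expr0n ?mulr0// leNgt.
- exact: measurable_fourier_sqr.
- by move=> xi; exact: sqr_ge0.
Qed.

End spectral.

(** * Comparison of the two spaces *)

Section energy_and_spectral_spaces.
Context {R : realType} (n : nat) (s : R).
Hypothesis hs : 0 < s < 1.
Local Notation leb := (@lebesgue_tuple R n).
Local Notation Rn := (n.-tuple R).
Local Notation w2 u xi := (Normc.normc (fourier u xi) ^+ 2).
Implicit Types (u : Rn -> R) (xi : Rn).

Let s0 : 0 < s. Proof. by case/andP: hs. Qed.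
Let s1 : s < 1. Proof. by case/andP: hs. Qed.

Lemma measurable_increment_symbol :
  measurable_fun setT (increment_symbol s : Rn -> \bar R).
Proof.
apply: (@measurable_fun_fubini_tonelli_G _ _ _ _ _ leb
  (fun p : Rn * Rn => (kernel_plus s p.1 * (2 * (1 - cos (dotp p.2 p.1))))%:E)).
  apply/measurable_EFinP; apply: measurable_funM; last exact: measurable_one_minus_cos_dotp.
  by apply: (measurableT_comp (measurable_kernel_plus s)); exact: measurable_fst.
by move=> p; rewrite lee_fin; exact: symbol_integrand_ge0.
Qed.

Lemma measurable_log_weight : measurable_fun setT (log_weight s : Rn -> R).
Proof.
apply: measurable_funM.
  by apply: (measurableT_comp (@measurable_powR R _)); exact: measurable_enorm.
apply: measurable_maxr => //.
by apply: (measurableT_comp (@measurable_ln R)); exact: measurable_enorm.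
Qed.

Lemma measurable_spectral_weight : measurable_fun setT (spectral_weight s : Rn -> R).
Proof.
apply: measurable_funM.
  by apply: (measurableT_comp (@measurable_powR R _)); exact: measurable_enorm.
apply: measurable_funX; apply: (measurableT_comp (@measurable_ln R)).
by apply: measurable_funX; exact: measurable_enorm.
Qed.

Lemma powR_expR (r a : R) : 0 < r -> r `^ a = expR (a * ln r).
Proof. by move=> r0; rewrite /powR gt_eqF. Qed.

(** Once ln |xi| >= 1 the squared logarithm dominates the simple one; for 0 < ln |xi| <= 1 the
    weight is at most e^(2s) <= e^2. *)
Lemma log_weight_le_spectral xi : log_weight s xi <= expR 2 + spectral_weight s xi.
Proof.
have p0 := powR_ge0 (enorm xi) (2 * s); have S0 := spectral_weight_ge0 s xi.
rewrite /log_weight; have [l0|l0] := leP (ln (enorm xi)) 0.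
  by rewrite mulr0 addr_ge0// expR_ge0.
have r0 : 0 < enorm xi.
  by rewrite ltNge; apply/negP => r0; rewrite ln0 ?ltxx in l0.
have [l1|l1] := leP (ln (enorm xi)) 1.
  apply: (@le_trans _ _ (expR 2)); last by rewrite lerDl.
  rewrite powR_expR// -[leRHS]mulr1.
  apply: ler_pM => //; first exact: ltW.
  by rewrite ler_expR; have := ler_wpM2l (ltW s0) l1; have := s1; lra.
apply: (@le_trans _ _ (spectral_weight s xi)); last by rewrite lerDr expR_ge0.
rewrite /spectral_weight ler_wpM2l// lnXn// mulr2n; nra.
Qed.

Lemma log_weight_le2 xi : enorm xi <= 2 -> log_weight s xi <= expR (2 * ln 2) * ln 2.
Proof.
move=> r2; have l2 : 0 <= ln 2 :> R by rewrite ln_ge0// ler1n.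
rewrite /log_weight; have [l0|l0] := leP (ln (enorm xi)) 0.
  by rewrite mulr0 mulr_ge0// expR_ge0.
have r0 : 0 < enorm xi.
  by rewrite ltNge; apply/negP => r0; rewrite ln0 ?ltxx in l0.
have ll : ln (enorm xi) <= ln 2 by rewrite ler_ln ?posrE.
rewrite powR_expR//; apply: ler_pM => //; first exact: ltW.
rewrite ler_expR -mulrA ler_wpM2l//.
by apply: (le_trans _ ll); rewrite ler_piMl// ltW.
Qed.

Definition log_energy u : \bar R := (\int[leb]_xi (log_weight s xi * w2 u xi)%:E)%E.

Let mw u (w : Rn -> R) : L2 n u -> measurable_fun setT w ->
  measurable_fun setT (fun xi => (w xi * w2 u xi)%:E).
Proof.
move=> L2u mw; apply/measurable_EFinP; apply: measurable_funM => //.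
exact: measurable_fourier_sqr.
Qed.

Let mass_lty u : L2 n u -> (\int[leb]_xi (w2 u xi)%:E < +oo)%E.
Proof. by move=> L2u; rewrite plancherel//; have [] := (L2P u).1 L2u. Qed.

Lemma energy_le_log_energy : exists2 K : R, 0 <= K & forall u, L2 n u ->
  (energy_form s u <= K%:E * (\int[leb]_xi (w2 u xi)%:E + log_energy u))%E.
Proof.
have [K K0 HK] := @increment_symbol_le R n s hs.
exists K => // u L2u; have m2 := measurable_fourier_sqr L2u.
have mW := measurable_log_weight.
rewrite (energy_formE hs L2u).
apply: (@le_trans _ _ (\int[leb]_xi (K%:E * ((w2 u xi)%:E + (log_weight s xi * w2 u xi)%:E)))%E).
  apply: ge0_le_integralT.
  - apply: emeasurable_funM; first exact: measurable_increment_symbol.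
    exact/measurable_EFinP.
  - apply: measurable_funeM; apply: emeasurable_funD; first exact/measurable_EFinP.
    exact: mw.
  - move=> xi; rewrite mule_ge0// ?lee_fin ?sqr_ge0//.
    by apply: integral_ge0 => z _; rewrite lee_fin symbol_integrand_ge0.
  - move=> xi; rewrite -EFinD -EFinM.
    apply: (le_trans (lee_wpmul2r _ (HK xi))); first by rewrite lee_fin sqr_ge0.
    by rewrite -EFinM lee_fin le_eqVlt; apply/orP; left; apply/eqP; ring.
rewrite ge0_integralZl_EFin//; last 2 first.
- by move=> xi _; rewrite adde_ge0// lee_fin ?sqr_ge0// mulr_ge0 ?sqr_ge0// log_weight_ge0.
- apply: emeasurable_funD; first exact/measurable_EFinP.
  exact: mw.
rewrite ge0_integralD//.
- by move=> xi _; rewrite lee_fin sqr_ge0.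
- exact/measurable_EFinP.
- by move=> xi _; rewrite lee_fin mulr_ge0 ?sqr_ge0// log_weight_ge0.
- exact: mw.
Qed.

(** The lower bound of the symbol starts at |xi| = 2. Below that radius the weight is at most [B]
    and is charged to the total mass of the squared transform. *)
Lemma log_energy_le_energy : (0 < n)%N -> exists2 K : R, 0 <= K & forall u, L2 n u ->
  (log_energy u <= K%:E * (\int[leb]_xi (w2 u xi)%:E + energy_form s u))%E.
Proof.
move=> n0; have [c c0 Hc] := @increment_symbol_ge R n s hs n0.
pose B : R := expR (2 * ln 2) * ln 2.
have B0 : 0 <= B by rewrite mulr_ge0 ?expR_ge0// ln_ge0// ler1n.
exists (c^-1 + B); first by rewrite addr_ge0// invr_ge0 ltW.
have K0 : 0 <= c^-1 + B by rewrite addr_ge0// invr_ge0 ltW.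
move=> u L2u; have m2 := measurable_fourier_sqr L2u.
have mW := measurable_log_weight.
have sym0 xi : (0 <= increment_symbol s xi)%E.
  by apply: integral_ge0 => z _; rewrite lee_fin symbol_integrand_ge0.
have ms2 : measurable_fun setT (fun xi => increment_symbol s xi * (w2 u xi)%:E)%E.
  apply: emeasurable_funM; first exact: measurable_increment_symbol.
  exact/measurable_EFinP.
have s20 xi : (0 <= increment_symbol s xi * (w2 u xi)%:E)%E.
  by rewrite mule_ge0// lee_fin sqr_ge0.
rewrite (energy_formE hs L2u) -ge0_integralD//; last 2 first.
- by move=> xi _; rewrite lee_fin sqr_ge0.
- exact/measurable_EFinP.
rewrite -ge0_integralZl_EFin//; last 2 first.
- by move=> xi _; rewrite adde_ge0// lee_fin sqr_ge0.
- by apply: emeasurable_funD => //; exact/measurable_EFinP.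
apply: ge0_le_integralT.
- exact: mw.
- by apply: measurable_funeM; apply: emeasurable_funD => //; exact/measurable_EFinP.
- by move=> xi; rewrite lee_fin mulr_ge0 ?sqr_ge0// log_weight_ge0.
move=> xi; have w20 : 0 <= w2 u xi by exact: sqr_ge0.
have [r2|r2] := leP (enorm xi) 2.
  apply: (@le_trans _ _ ((c^-1 + B)%:E * (w2 u xi)%:E)%E).
    rewrite -EFinM lee_fin ler_wpM2r//; apply: (le_trans (log_weight_le2 r2)).
    by rewrite lerDr invr_ge0 ltW.
  by apply: lee_wpmul2l; rewrite ?lee_fin// leeDl.
apply: (@le_trans _ _ ((c^-1 + B)%:E * (increment_symbol s xi * (w2 u xi)%:E))%E); last first.
  by apply: lee_wpmul2l; rewrite ?lee_fin// leeDr// lee_fin.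
rewrite muleA [(log_weight s xi * _)%:E]EFinM; apply: lee_wpmul2r; first by rewrite lee_fin.
apply: (@le_trans _ _ ((c^-1)%:E * increment_symbol s xi)%E).
  rewrite -[X in (X <= _)%E]mul1e -(mulVf (lt0r_neq0 c0)) EFinM -muleA.
  apply: lee_wpmul2l; first by rewrite lee_fin invr_ge0 ltW.
  by rewrite -EFinM; exact: Hc (ltW r2).
by apply: lee_wpmul2r => //; rewrite lee_fin lerDl.
Qed.

Lemma energy_lty u : (0 < n)%N -> L2 n u ->
  (energy_form s u < +oo)%E <-> (log_energy u < +oo)%E.
Proof.
move=> n0 L2u; have m2 := mass_lty L2u.
have m20 : (0 <= \int[leb]_xi (w2 u xi)%:E)%E.
  by apply: integral_ge0 => xi _; rewrite lee_fin sqr_ge0.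
have [K K0 HK] := energy_le_log_energy.
have [K' K'0 HK'] := log_energy_le_energy n0.
split => H.
  apply: (le_lt_trans (HK' _ L2u)); apply: lte_mul_pinfty; rewrite ?lee_fin//.
  exact: lte_add_pinfty.
apply: (le_lt_trans (HK _ L2u)); apply: lte_mul_pinfty; rewrite ?lee_fin//.
exact: lte_add_pinfty.
Qed.

Lemma log_energy_le_spectral u : L2 n u ->
  (log_energy u <= (expR 2)%:E * \int[leb]_xi (w2 u xi)%:E + spectral_form s u)%E.
Proof.
move=> L2u; have m2 := measurable_fourier_sqr L2u.
have mS := measurable_spectral_weight.
have S0 xi : (0 <= (spectral_weight s xi * w2 u xi)%:E)%E.
  by rewrite lee_fin mulr_ge0 ?sqr_ge0// spectral_weight_ge0.
rewrite spectral_formE// -ge0_integralZl_EFin//; last 2 first.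
- by move=> xi _; rewrite lee_fin sqr_ge0.
- exact/measurable_EFinP.
rewrite -ge0_integralD//; last 3 first.
- by move=> xi _; rewrite mule_ge0// lee_fin ?expR_ge0// sqr_ge0.
- by apply: measurable_funeM; exact/measurable_EFinP.
- exact: mw.
apply: ge0_le_integralT.
- by apply: mw => //; exact: measurable_log_weight.
- apply: emeasurable_funD; last exact: mw.
  by apply: measurable_funeM; exact/measurable_EFinP.
- by move=> xi; rewrite lee_fin mulr_ge0 ?sqr_ge0// log_weight_ge0.
- move=> xi; rewrite -EFinM -EFinD lee_fin -mulrDl ler_wpM2r ?sqr_ge0//.
  exact: log_weight_le_spectral.
Qed.

Lemma spectral_embedding : continuous_embedding
  (spectral_space n s) (spectral_norm s) (energy_space n s) (energy_norm s).
Proof.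
have [K K0 HK] := energy_le_log_energy.
pose A := K * (1 + expR 2).
have A0 : 0 <= A by rewrite mulr_ge0// addr_ge0// expR_ge0.
have key (k : R) (m S : \bar R) : 0 <= k -> (0 <= m)%E -> (0 <= S)%E ->
    (m + (k%:E * m + S) <= (1 + k)%:E * (m + S))%E.
  move=> k0 m0 S0; rewrite ge0_muleDr// EFinD !ge0_muleDl ?lee_fin// !mul1e addeA.
  by apply: leeD2l; rewrite leeDl// mule_ge0.
have main u : L2 n u -> (energy_form s u <= A%:E * (L2norm u ^+ 2 + spectral_form s u))%E.
  move=> L2u; have m20 : (0 <= \int[leb]_xi (w2 u xi)%:E)%E.
    by apply: integral_ge0 => xi _; rewrite lee_fin sqr_ge0.
  have S0 : (0 <= spectral_form s u)%E.
    by apply: integral_ge0 => l _; rewrite lee_fin mulr_ge0 ?powR_ge0// sqr_ge0.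
  apply: (le_trans (HK _ L2u)); rewrite sqr_L2norm -plancherel// /A EFinM -muleA.
  apply: lee_wpmul2l; first by rewrite lee_fin.
  apply: (le_trans (leeD2l _ (log_energy_le_spectral L2u))).
  by apply: key => //; exact: expR_ge0.
split.
  move=> u [L2u Su]; split => //; apply: (le_lt_trans (main _ L2u)).
  apply: lte_mul_pinfty; rewrite ?lee_fin//.
  apply: lte_add_pinfty => //; rewrite sqr_L2norm.
  by have [] := (L2P u).1 L2u.
(* [1 + A] compares the squared norms: 1 for the L2 part and [A] for the energy form. *)
exists (Num.sqrt (1 + A)); split; first exact: sqrtr_ge0.
move=> u [L2u Su]; rewrite /energy_norm /spectral_norm.
have -> : (Num.sqrt (1 + A))%:E = sqrte (1 + A)%:E by [].
have N0 : (0 <= L2norm u ^+ 2)%E.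
  by rewrite sqr_L2norm; apply: integral_ge0 => x _; rewrite lee_fin sqr_ge0.
have S0 : (0 <= spectral_form s u)%E.
  by apply: integral_ge0 => l _; rewrite lee_fin mulr_ge0 ?powR_ge0// sqr_ge0.
rewrite -sqrteM ?lee_fin ?addr_ge0// lee_sqrt; last first.
  by rewrite mule_ge0 ?lee_fin ?addr_ge0// adde_ge0.
rewrite EFinD ge0_muleDl ?lee_fin// mul1e; apply: leeD; last exact: main.
by rewrite leeDl.
Qed.

(** The weight is negative for 0 < |xi| < 1, but r^(2s) |ln r^2| <= 1/s there, so the negative part
    is at most 1/s times the mass. The positive part is exactly twice the logarithmic energy. *)
Lemma signed_log_energy_lty u : L2 n u ->
  (\int[leb]_xi (enorm xi `^ (2 * s) * ln (enorm xi ^+ 2) * w2 u xi)%:E < +oo)%E <->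
  (log_energy u < +oo)%E.
Proof.
move=> L2u; have m2 := measurable_fourier_sqr L2u.
pose g xi : R := enorm xi `^ (2 * s) * ln (enorm xi ^+ 2).
have mg : measurable_fun setT g.
  apply: measurable_funM.
    by apply: (measurableT_comp (@measurable_powR R _)); exact: measurable_enorm.
  apply: (measurableT_comp (@measurable_ln R)).
  by apply: measurable_funX; exact: measurable_enorm.
pose f xi := (g xi * w2 u xi)%:E.
have mf : measurable_fun setT f by exact: mw.
have ln2 xi : ln (enorm xi ^+ 2) = 2 * ln (enorm xi).
  have [r0|r0] := ltP 0 (enorm xi); first by rewrite lnXn// mulr2n; ring.
  have -> : enorm xi = 0 by apply/le_anti; rewrite r0 enorm_ge0.
  by rewrite expr0n/= ln0// mulr0.
have fpos xi : (f^\+ xi = 2%:E * (log_weight s xi * w2 u xi)%:E)%E.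
  rewrite funepos.unlock /f -EFinM -EFin_max; congr EFin.
  have p0 := powR_ge0 (enorm xi) (2 * s).
  rewrite /g /log_weight ln2; have [l0|l0] := leP (ln (enorm xi)) 0.
    rewrite mulr0 mul0r mulr0 max_r//.
    by rewrite mulr_le0_ge0 ?sqr_ge0// mulr_ge0_le0// mulr_ge0_le0.
  rewrite max_l; first by ring.
  apply: mulr_ge0; last exact: sqr_ge0.
  by apply: mulr_ge0 => //; rewrite mulr_ge0// ltW.
have fneg xi : (f^\- xi <= ((s^-1)%:E * (w2 u xi)%:E))%E.
  rewrite funeneg.unlock /f -EFinN -EFinM -EFin_max lee_fin ge_max.
  rewrite mulr_ge0 ?invr_ge0 ?sqr_ge0 ?(ltW s0)// andbT -mulNr ler_wpM2r ?sqr_ge0//.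
  rewrite /g ln2; have [r0|r0] := ltP 0 (enorm xi); last first.
    by rewrite ln0// !mulr0 oppr0 invr_ge0 ltW.
  rewrite powR_expR//; set L := ln _.
  rewrite -[leRHS]mul1r ler_pdivlMr//.
  (* With x = - 2 s L this is 1 + x <= e^x, which yields x e^(-x) <= 1. *)
  have := expR_ge1Dx (- (2 * s * L)) => e.
  have E0 := expR_gt0 (2 * s * L).
  have : expR (2 * s * L) * (- (2 * s * L)) <= expR (2 * s * L) * expR (- (2 * s * L)).
    by rewrite ler_pM2l//; lra.
  by rewrite -expRD subrr expR0; lra.
have W0 xi : (0 <= (log_weight s xi * w2 u xi)%:E)%E.
  by rewrite lee_fin mulr_ge0 ?sqr_ge0// log_weight_ge0.
have posE : (\int[leb]_xi f^\+ xi = 2%:E * log_energy u)%E.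
  rewrite -ge0_integralZl_EFin//; first by apply: eq_integral => xi _; exact: fpos.
  by apply: mw => //; exact: measurable_log_weight.
have negE : (\int[leb]_xi f^\- xi < +oo)%E.
  apply: (@le_lt_trans _ _ ((s^-1)%:E * \int[leb]_xi (w2 u xi)%:E)%E); last first.
    by apply: lte_mul_pinfty; rewrite ?lee_fin ?invr_ge0 ?(ltW s0)//; exact: mass_lty.
  rewrite -ge0_integralZl_EFin//; last 3 first.
  - by move=> xi _; rewrite lee_fin sqr_ge0.
  - exact/measurable_EFinP.
  - by rewrite invr_ge0 ltW.
  apply: ge0_le_integralT => //.
  - exact: measurable_funeneg.
  - by apply: measurable_funeM; exact/measurable_EFinP.
have neg0 : (0 <= \int[leb]_xi f^\- xi)%E by apply: integral_ge0.
rewrite -[X in (X < _)%E]/(\int[leb]_xi f xi)%E integralE posE.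
have L0 : (0 <= log_energy u)%E by apply: integral_ge0.
split => H; last first.
  apply: (@le_lt_trans _ _ (2%:E * log_energy u)%E); first by rewrite leeBlDr ?leeDl// ge0_fin_numE.
  by apply: lte_mul_pinfty.
(* If the positive part were infinite, subtracting the finite negative part would leave the integral
   at infinity. *)
rewrite ltNge leye_eq; apply/negP => /eqP E.
move: H; rewrite E mulry gtr0_sg// mul1e addye ?ltxx//.
by rewrite eqe_oppLR/= lt_eqF.
Qed.

Lemma energy_spaceE : (0 < n)%N -> energy_space n s =
  [set u : Rn -> R | L2 n u /\
    (\int[leb]_xi (enorm xi `^ (2 * s) * ln (enorm xi ^+ 2) * w2 u xi)%:E < +oo)%E].
Proof.
move=> n0; apply/seteqP; split => u [L2u H]; split => //.
  by apply/(signed_log_energy_lty L2u)/(energy_lty n0 L2u).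
by apply/(energy_lty n0 L2u)/(signed_log_energy_lty L2u).
Qed.

End energy_and_spectral_spaces.

(** * A lacunary cosine series *)

Section cosine_series.
Context {R : realType} (n : nat).
Local Notation leb := (@lebesgue_tuple R n).
Local Notation Rn := (n.-tuple R).
Variables (b : nat -> R) (eta : nat -> Rn).
Hypothesis b0 : forall k, 0 <= b k.
Hypothesis b1 : forall k, b k <= 2^-1 ^+ k.
Local Notation W := (@prodt R n laplace).
Local Notation G := (@prodt R n laplace_hat).

Let term k x : R := W x * cos (dotp (eta k) x).
Let psum K x : R := \sum_(0 <= k < K) b k * term k x.

(** Coefficients below 2^-k make the series converge normally with majorant 2 W, whatever the
    frequencies; these are fixed only when the two spaces are separated. *)
Definition cosine_series (x : Rn) : R :=
  limn (fun K => \sum_(0 <= k < K) b k * (W x * cos (dotp (eta k) x))).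

Let W0 x : 0 <= W x.
Proof. by apply: prodt_ge0 => t; exact: laplace_ge0. Qed.

Let W1 x : W x <= 1.
Proof.
by rewrite /prodt; apply: prodr_ile1 => i _; rewrite laplace_ge0 laplace_le1.
Qed.

Let intW : leb.-integrable setT (EFin \o W).
Proof. exact: integrable_prodt_laplace. Qed.

Let mterm k : measurable_fun setT (term k).
Proof.
apply: measurable_funM; last exact: measurable_cos_dotp.
by apply: measurable_prodt; exact: measurable_laplace.
Qed.

Let mpsum K : measurable_fun setT (psum K).
Proof. by apply: measurable_sum => k; apply: measurable_funM. Qed.

Let term_bound k x : `|term k x| <= W x.
Proof. by rewrite normrM ger0_norm// ler_piMr// cos_norm_le1. Qed.

Let psum_bound K x : `|psum K x| <= 2 * W x.
Proof.
apply: (le_trans (ler_norm_sum _ _ _)).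
apply: (@le_trans _ _ (\sum_(0 <= k < K) 2^-1 ^+ k * W x)).
  by apply: ler_sum => k _; rewrite normrM (ger0_norm (b0 k)) ler_pM.
by rewrite -mulr_suml ler_wpM2r// sum_half_le2.
Qed.

Let psum_cvg x : psum ^~ x @ \oo --> cosine_series x.
Proof.
suff : cvgn (series (fun k => b k * term k x)) by [].
apply: normed_cvg; apply: (@series_le_cvg _ _ (geometric 1 2^-1)).
- by move=> k; exact: normr_ge0.
- by move=> k; rewrite /geometric/= mul1r exprn_ge0.
- move=> k; rewrite /geometric/= mul1r normrM (ger0_norm (b0 k)) -[leRHS]mulr1.
  by rewrite ler_pM// (le_trans (term_bound k x)).
- by apply: is_cvg_geometric_series; rewrite ger0_norm// invf_lt1// ltr1n.
Qed.

Lemma cosine_series_bound x : `|cosine_series x| <= 2 * W x.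
Proof.
have c := cvg_norm (@psum_cvg x).
by apply: (ler_cvg_to (c _) (cvg_cst (2 * W x))); apply: nearW => K; exact: psum_bound.
Qed.

Lemma measurable_cosine_series : measurable_fun setT cosine_series.
Proof. exact: (measurable_fun_cvg mpsum (fun x _ => @psum_cvg x)). Qed.

Lemma integrable_cosine_series : leb.-integrable setT (EFin \o cosine_series).
Proof.
apply: (le_integrable measurableT _ _ (integrable_EFinZl 2 intW)).
  by apply/measurable_EFinP; exact: measurable_cosine_series.
by move=> x _ /=; rewrite lee_fin (le_trans (cosine_series_bound x))// ler_norm.
Qed.

Lemma L2_cosine_series : L2 n cosine_series.
Proof.
apply/L2P; split; first exact: measurable_cosine_series.
apply: (@le_lt_trans _ _ (\int[leb]_x (`|4 * W x|)%:E)%E); last first.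
  exact: integrable_EFin_lty (integrable_EFinZl 4 intW).
have mW : measurable_fun setT W by apply: measurable_prodt; exact: measurable_laplace.
apply: ge0_le_integralT.
- by apply/measurable_EFinP; apply: measurable_funX; exact: measurable_cosine_series.
- by apply/measurable_EFinP; apply: measurableT_comp => //; exact: measurable_funM.
- by move=> x; rewrite lee_fin sqr_ge0.
- move=> x; rewrite lee_fin (@ger0_norm _ (4 * W x)) ?mulr_ge0//.
  rewrite -real_normK ?num_real//; have := cosine_series_bound x.
  have := W1 x; have := W0 x; have := normr_ge0 (cosine_series x).
  set a := `|_|; set w := W x => a0 w0 w1 aw.
  have : a ^+ 2 <= (2 * w) ^+ 2 by rewrite ler_pXn2r ?nnegrE ?mulr_ge0.
  nra.
Qed.

Let integrable_psum_mul K (c : Rn -> R) : measurable_fun setT c ->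
  (forall x, `|c x| <= 1) -> leb.-integrable setT (EFin \o (fun x => psum K x * c x)).
Proof.
move=> mc c1; apply: (@integrableMbounded _ _ _ _ _ _ 1) => //.
apply: (le_integrable measurableT _ _ (integrable_EFinZl 2 intW)).
  exact/measurable_EFinP.
by move=> x _ /=; rewrite lee_fin (le_trans (psum_bound K x))// ler_norm.
Qed.

Let cvg_psum_mul (c : Rn -> R) : measurable_fun setT c -> (forall x, `|c x| <= 1) ->
  (\int[leb]_x (psum K x * c x)) @[K --> \oo] --> \int[leb]_x (cosine_series x * c x).
Proof.
move=> mc c1.
have H := @dominated_cvg _ _ _ leb setT measurableT
  (fun K x => (psum K x * c x)%:E) (fun x => (cosine_series x * c x)%:E)
  (fun x => (2 * W x)%:E).
have ic : leb.-integrable setT (EFin \o (fun x => cosine_series x * c x)).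
  by apply: (@integrableMbounded _ _ _ _ _ _ 1) => //; exact: integrable_cosine_series.
apply: fine_cvg; rewrite (EFin_Rintegral ic); apply: H.
- by move=> K; apply/measurable_EFinP; exact: measurable_funM.
- move=> x _; apply: cvg_EFin; first by apply: nearW.
  by apply: cvgMl; exact: psum_cvg.
- by [].
- exact: integrable_EFinZl.
- move=> K x _; rewrite lee_fin normrM -[leRHS]mulr1.
  by apply: ler_pM.
Qed.

Definition cosine_series_hat k xi : R :=
  b k / 2 * (G (addt xi (eta k)) + G (subt xi (eta k))).

Lemma cosine_series_hat_ge0 k xi : 0 <= cosine_series_hat k xi.
Proof.
rewrite mulr_ge0 ?divr_ge0// addr_ge0// prodt_ge0// => t; exact: laplace_hat_ge0.
Qed.

Let integrable_W_mul (c : Rn -> R) : measurable_fun setT c -> (forall x, `|c x| <= 1) ->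
  leb.-integrable setT (EFin \o (fun x => W x * c x)).
Proof. by move=> mc c1; apply: (@integrableMbounded _ _ _ _ _ _ 1). Qed.

Let cosine_transform k xi :
  \int[leb]_x (b k * term k x * cos (dotp xi x)) = cosine_series_hat k xi /\
  \int[leb]_x (b k * term k x * sin (dotp xi x)) = 0.
Proof.
have iC z : leb.-integrable setT (EFin \o (fun x => W x * cos (dotp z x))).
  by apply: integrable_W_mul => [|x]; [exact: measurable_cos_dotp|exact: cos_norm_le1].
have iS z : leb.-integrable setT (EFin \o (fun x => W x * sin (dotp z x))).
  by apply: integrable_W_mul => [|x]; [exact: measurable_sin_dotp|exact: sin_norm_le1].
have dA x : dotp (addt xi (eta k)) x = dotp xi x + dotp (eta k) x.
  by rewrite dotpC dotp_addtr ![dotp x _]dotpC.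
have dS x : dotp (subt xi (eta k)) x = dotp xi x - dotp (eta k) x.
  by rewrite dotpC dotp_subtr ![dotp x _]dotpC.
have [CA SA] := Rintegral_prodt_laplace (addt xi (eta k)).
have [CS SS] := Rintegral_prodt_laplace (subt xi (eta k)).
split.
  transitivity (\int[leb]_x (b k / 2 * (W x * cos (dotp (addt xi (eta k)) x) +
      W x * cos (dotp (subt xi (eta k)) x)))).
    by apply: eq_Rintegral => x _; rewrite dA dS cosD cosB /term; field.
  rewrite RintegralZl//; last by apply: integrable_EFinD.
  by rewrite RintegralD// CA CS.
transitivity (\int[leb]_x (b k / 2 * (W x * sin (dotp (addt xi (eta k)) x) +
    W x * sin (dotp (subt xi (eta k)) x)))).
  by apply: eq_Rintegral => x _; rewrite dA dS sinD sinB /term; field.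
rewrite RintegralZl//; last by apply: integrable_EFinD.
by rewrite RintegralD// SA SS addr0 mulr0.
Qed.

Let psum_transform K xi :
  \int[leb]_x (psum K x * cos (dotp xi x)) = \sum_(0 <= k < K) cosine_series_hat k xi /\
  \int[leb]_x (psum K x * sin (dotp xi x)) = 0.
Proof.
have it k : leb.-integrable setT (EFin \o (fun x => b k * term k x)).
  by apply: integrable_EFinZl; apply: integrable_W_mul => [|x];
    [exact: measurable_cos_dotp|exact: cos_norm_le1].
have [mc ms] := (measurable_cos_dotp xi, measurable_sin_dotp xi).
have c1 x : `|cos (dotp xi x)| <= 1 by exact: cos_norm_le1.
have s1 x : `|sin (dotp xi x)| <= 1 by exact: sin_norm_le1.
elim: K => [|K [IHc IHs]].
  split; [rewrite big_geq//|]; rewrite /Rintegral integral0_eq// => x _;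
    by rewrite /psum big_geq// mul0r.
have [Ck Sk] := cosine_transform K xi.
split.
  rewrite big_nat_recr//= -IHc -Ck -RintegralD//.
  - by apply: eq_Rintegral => x _; rewrite /psum big_nat_recr//= mulrDl.
  - exact: integrable_psum_mul.
  - exact: (integrableMbounded (it K) mc c1).
transitivity (\int[leb]_x (psum K x * sin (dotp xi x)) +
    \int[leb]_x (b K * term K x * sin (dotp xi x))); last by rewrite IHs Sk addr0.
rewrite -RintegralD//.
- by apply: eq_Rintegral => x _; rewrite /psum big_nat_recr//= mulrDl.
- exact: integrable_psum_mul.
- exact: (integrableMbounded (it K) ms s1).
Qed.

Lemma cosint_cosine_series_cvg xi :
  (fun K => \sum_(0 <= k < K) cosine_series_hat k xi) @ \oo --> cosint cosine_series xi.
Proof.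
have := @cvg_psum_mul (fun x => cos (dotp xi x)) (measurable_cos_dotp xi)
  (fun x => cos_norm_le1 _).
by under eq_fun do rewrite (psum_transform _ xi).1.
Qed.

Lemma sinint_cosine_series xi : sinint cosine_series xi = 0.
Proof.
have := @cvg_psum_mul (fun x => sin (dotp xi x)) (measurable_sin_dotp xi)
  (fun x => sin_norm_le1 _).
under eq_fun do rewrite (psum_transform _ xi).2.
by move=> c; apply: (cvg_unique _ c (cvg_cst 0)).
Qed.

(** The bumps are nonnegative, so no cancellation occurs and a single one bounds the whole transform
    from below. *)
Lemma cosine_series_hat_le k xi : cosine_series_hat k xi <= cosint cosine_series xi.
Proof.
apply: (ler_cvg_to (cvg_cst (cosine_series_hat k xi)) (@cosint_cosine_series_cvg xi)).
exists k.+1 => // K /= kK; rewrite (bigD1_seq k)/= ?iota_uniq//; last first.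
  by rewrite mem_index_iota.
by rewrite lerDl sumr_ge0// => i _; exact: cosine_series_hat_ge0.
Qed.

(* Cauchy-Schwarz with the weights 2^-k. *)
Let sqr_sum_le (a : nat -> R) K :
  (\sum_(0 <= k < K) a k) ^+ 2 <= \sum_(0 <= k < K) 2 ^+ k.+1 * a k ^+ 2.
Proof.
elim: K a => [|K IH] a; first by rewrite !big_geq// expr0n.
rewrite !big_nat_recl//=; have := IH (a \o S) => /=.
set S := \sum_(0 <= k < K) a k.+1; set T := \sum_(0 <= k < K) _ => H.
have -> : \sum_(0 <= i < K) 2 ^+ i.+2 * a i.+1 ^+ 2 = 2 * T.
  by rewrite /T mulr_sumr; apply: eq_bigr => i _; rewrite exprS mulrA.
(* (a_0 + S)^2 <= 2 a_0^2 + 2 S^2, and the induction hypothesis for the shifted sequence bounds 2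
   S^2 by 2 T, doubling each weight. *)
have := sqr_ge0 (a 0%N - S); rewrite expr1; nra.
Qed.

Lemma cosint_cosine_series_sqr_le xi :
  ((cosint cosine_series xi ^+ 2)%:E <=
   \sum_(0 <= k <oo) (2 ^+ k.+1 * cosine_series_hat k xi ^+ 2)%:E)%E.
Proof.
have t0 k : (0 <= (2 ^+ k.+1 * cosine_series_hat k xi ^+ 2)%:E)%E.
  by rewrite lee_fin mulr_ge0 ?sqr_ge0// exprn_ge0.
have c : (fun K => ((\sum_(0 <= k < K) cosine_series_hat k xi) ^+ 2)%:E) @ \oo -->
    (cosint cosine_series xi ^+ 2)%:E.
  apply: cvg_EFin; first exact: nearW.
  by apply: cvgM; exact: cosint_cosine_series_cvg.
rewrite -(cvg_lim _ c)//; apply: lime_le; first by apply/cvg_ex; eexists; exact: c.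
apply: nearW => K; apply: le_trans (nneseries_lim_ge K _); last by move=> k _ _; exact: t0.
by rewrite sumEFin lee_fin sqr_sum_le.
Qed.

End cosine_series.

(** * Weighted moments of the squared transform of the profile *)

Section profile_moment.
Context {R : realType} (n : nat) (s : R).
Hypothesis hs : 0 < s < 1.
Local Notation leb := (@lebesgue_tuple R n).
Local Notation leb1 := (@lebesgue_measure R).
Local Notation Rn := (n.-tuple R).
Local Notation G := (@prodt R n laplace_hat).
Implicit Types x xi : Rn.

Let s0 : 0 < s. Proof. by case/andP: hs. Qed.
Let s1 : 0 < 1 - s. Proof. by case/andP: hs; rewrite subr_gt0. Qed.

(** In the exponent 2s + 1, the 2s carries the power of the weight and the 1 absorbs the logarithm.
    Against the decay |t|^-4 of the squared transform this leaves |t|^(2s - 3), integrable at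
    infinity because s < 1. *)
Definition moment_factor (t : R) : R := (1 + `|t|) `^ (2 * s + 1) * laplace_hat t ^+ 2.

Lemma moment_factor_ge0 t : 0 <= moment_factor t.
Proof. by rewrite mulr_ge0 ?powR_ge0// sqr_ge0. Qed.

Lemma measurable_moment_factor : measurable_fun [set: measurableTypeR R] moment_factor.
Proof.
apply: measurable_funM; last by apply: measurable_funX; exact: measurable_laplace_hat.
by apply: (measurableT_comp (@measurable_powR R _)); apply: measurable_funD.
Qed.

Lemma integral_moment_factor_lty : (\int[leb1]_t (moment_factor t)%:E < +oo)%E.
Proof.
(* 2s + 1 - 4 = - (1 + 2 (1 - s)), so a gain of up to 2 (1 - s) over the critical power is available
   at infinity. *)
pose de := Num.min 1 (2 * (1 - s)).
have de0 : 0 < de by rewrite lt_min ltr01 mulr_gt0.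
have de2 : de <= 2 * (1 - s) by rewrite ge_min lexx orbT.
pose lr := log_radial 1 de (fun t : R => `|t|).
pose I1 : R -> R := \1_(`[- 1, 1]%classic : set R).
have mI : measurable_fun [set: measurableTypeR R] I1.
  by apply: measurable_indic; exact: measurable_itv.
have ml : measurable_fun [set: measurableTypeR R] lr.
  by apply: measurable_log_radial; exact: normr_measurable.
have lr0 t : 0 <= lr t by exact: log_radial_ge0.
have I10 t : 0 <= I1 t by rewrite /I1 indicE.
have bound t : moment_factor t <= 16 * (I1 t + lr t).
  have h1 : 1 <= 1 + `|t| by rewrite lerDl.
  have h0 : 0 < 1 + `|t| by exact: lt_le_trans h1.
  have q0 : 0 < 1 + t ^+ 2 by rewrite ltr_wpDr// sqr_ge0.
  have q1 : (1 + `|t|) ^+ 2 <= 2 * (1 + t ^+ 2).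
    by rewrite -[t ^+ 2]real_normK ?num_real//; have := sqr_ge0 (1 - `|t|); nra.
  have lh : laplace_hat t <= 4 * (1 + `|t|) ^- 2.
    rewrite /laplace_hat ler_pdivrMr// mulrAC ler_pdivlMr ?exprn_gt0//; nra.
  have lh2 : laplace_hat t ^+ 2 <= 16 * (1 + `|t|) `^ (- 4).
    have -> : 16 * (1 + `|t|) `^ (- 4) = (4 * (1 + `|t|) ^- 2) ^+ 2.
      rewrite powRN (powR_mulrn 4 (ltW h0)) exprMn exprVn -exprM; congr (_ * _).
      by rewrite expr2; ring.
    by rewrite ler_pXn2r ?nnegrE ?laplace_hat_ge0// mulr_ge0// invr_ge0 exprn_ge0// ltW.
  apply: (@le_trans _ _ (16 * (1 + `|t|) `^ (- (1 + 2 * (1 - s))))).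
    rewrite /moment_factor; apply: (le_trans (ler_wpM2l (powR_ge0 _ _) lh2)).
    rewrite mulrCA -powRD; last by rewrite (gt_eqF h0) implybT.
    by rewrite le_eqVlt; apply/orP; left; apply/eqP; congr (_ * _ `^ _); ring.
  rewrite ler_pM2l//; have [t1|t1] := leP `|t| 1.
    apply: (@le_trans _ _ 1); last first.
      by rewrite /I1 indicE mem_set ?lerDl//= in_itv/= -ler_norml.
    rewrite powR_expR// -[leRHS]expR0 ler_expR mulNr oppr_le0 mulr_ge0 ?ln_ge0//.
    by rewrite addr_ge0// mulr_ge0// ltW.
  apply: (@le_trans _ _ (lr t)); last by rewrite lerDr.
  have t0 : 0 < `|t| by exact: lt_trans t1.
  rewrite /lr /log_radial t0 powR_expR// ler_expR.
  have l0 : 0 <= ln `|t| by rewrite ln_ge0// ltW.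
  have ll : ln `|t| <= ln (1 + `|t|) by rewrite ler_ln ?posrE// lerDr.
  rewrite (ger0_norm l0).
  have a0 : 0 <= 1 + 2 * (1 - s) by rewrite addr_ge0// mulr_ge0// ltW.
  have := ler_wpM2l a0 ll; have := ler_wpM2r l0 de2; lra.
have I1E : leb1 (`[- 1, 1]%classic : set R) = 2%:E.
  rewrite lebesgue_measure_itv/= lte_fin ifT; last by lra.
  by rewrite -EFinB; congr EFin; lra.
apply: (@le_lt_trans _ _ (\int[leb1]_t (16%:E * ((I1 t)%:E + (lr t)%:E)))%E).
  apply: ge0_le_integralT.
  - by apply/measurable_EFinP; exact: measurable_moment_factor.
  - by apply: measurable_funeM; apply: emeasurable_funD; exact/measurable_EFinP.
  - by move=> t; rewrite lee_fin moment_factor_ge0.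
  - by move=> t; rewrite -EFinD -EFinM lee_fin.
rewrite ge0_integralZl_EFin//; last 2 first.
- by move=> t _; rewrite -EFinD lee_fin addr_ge0.
- by apply: emeasurable_funD; exact/measurable_EFinP.
apply: lte_mul_pinfty => //.
rewrite ge0_integralD//; last 4 first.
- by move=> t _; rewrite lee_fin.
- exact/measurable_EFinP.
- by move=> t _; rewrite lee_fin.
- exact/measurable_EFinP.
apply: lte_add_pinfty; last exact: normr_log_radial_lty.
by rewrite integral_indic// setIT [X in (X < _)%E](_ : _ = 2%:E) ?ltry//; exact: I1E.
Qed.

Lemma enorm_le_sum x : enorm x <= \sum_(i < n) `|tnth x i|.
Proof.
rewrite -(@ler_pXn2r _ 2)// ?nnegrE ?enorm_ge0 ?sumr_ge0// sqr_enorm.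
rewrite expr2 mulr_suml; apply: ler_sum => i _.
apply: (@le_trans _ _ (`|tnth x i| * `|tnth x i|)).
  by rewrite -normrM ler_norm.
rewrite ler_wpM2l// (bigD1 i)//= lerDl sumr_ge0//.
Qed.

(** Replaces the radial weight by a product over the coordinates, so that the moment integral
    factorises. *)
Lemma enorm1_le_prod x : 1 + enorm x <= \prod_(i < n) (1 + `|tnth x i|).
Proof.
apply: (@le_trans _ _ (1 + \sum_(i < n) `|tnth x i|)).
  by rewrite lerD2l enorm_le_sum.
suff [] : 1 + \sum_(i < n) `|tnth x i| <= \prod_(i < n) (1 + `|tnth x i|) /\
    0 <= \sum_(i < n) `|tnth x i| by [].
apply: (big_rec2 (fun a b : R => 1 + a <= b /\ 0 <= a)); first by rewrite addr0.
move=> i p q _ [pq p0]; have t0 := normr_ge0 (tnth x i); split; last exact: addr_ge0.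
have : (1 + `|tnth x i|) * (1 + p) <= (1 + `|tnth x i|) * q.
  by rewrite ler_wpM2l// addr_ge0.
by have := mulr_ge0 t0 p0; lra.
Qed.

Lemma moment_le_prodt x : (1 + enorm x) `^ (2 * s + 1) * G x ^+ 2 <= prodt moment_factor x.
Proof.
have e1 : 0 < 2 * s + 1 by rewrite addr_gt0// mulr_gt0.
have -> : prodt moment_factor x =
    (\prod_(i < n) (1 + `|tnth x i|)) `^ (2 * s + 1) * G x ^+ 2.
  rewrite /prodt /moment_factor big_split/= prodrXl; congr (_ * _).
  suff [] : \prod_(i < n) (1 + `|tnth x i|) `^ (2 * s + 1) =
      (\prod_(i < n) (1 + `|tnth x i|)) `^ (2 * s + 1) /\
      0 <= \prod_(i < n) (1 + `|tnth x i|) by [].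
  apply: (big_rec2 (fun a b : R => a = b `^ (2 * s + 1) /\ 0 <= b)) => [|i p q _ [-> q0]].
    by rewrite powR1.
  have t0 : 0 <= 1 + `|tnth x i| by rewrite addr_ge0.
  by rewrite powRM// mulr_ge0.
apply: ler_wpM2r; first exact: sqr_ge0.
apply: ge0_ler_powR; [exact: ltW| | |exact: enorm1_le_prod].
  by rewrite nnegrE addr_ge0// enorm_ge0.
by rewrite nnegrE; apply: prodr_ge0 => i _; rewrite addr_ge0.
Qed.

Lemma integral_moment_lty :
  (\int[leb]_x ((1 + enorm x) `^ (2 * s + 1) * G x ^+ 2)%:E < +oo)%E.
Proof.
apply: (@le_lt_trans _ _ (\int[leb]_x (prodt moment_factor x)%:E)%E).
  apply: ge0_le_integralT.
  - apply/measurable_EFinP; apply: measurable_funM; last first.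
      by apply: measurable_funX; apply: measurable_prodt; exact: measurable_laplace_hat.
    apply: (measurableT_comp (@measurable_powR R _)).
    by apply: measurable_funD => //; exact: measurable_enorm.
  - apply/measurable_EFinP; apply: measurable_prodt; exact: measurable_moment_factor.
  - by move=> x; rewrite lee_fin mulr_ge0 ?powR_ge0// sqr_ge0.
  - by move=> x; rewrite lee_fin moment_le_prodt.
rewrite ge0_integral_prodt//; last 2 first.
- exact: measurable_moment_factor.
- exact: moment_factor_ge0.
have f0 : (0 <= \int[leb1]_t (moment_factor t)%:E)%E.
  by apply: integral_ge0 => t _; rewrite lee_fin moment_factor_ge0.
have fin : (\int[leb1]_t (moment_factor t)%:E)%E \is a fin_num.
  by rewrite ge0_fin_numE// integral_moment_factor_lty.
by rewrite -(fineK fin) -EFin_expe ltry.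
Qed.

Lemma enorm_addt_le (x y : Rn) : enorm (addt x y) <= enorm x + enorm y.
Proof.
rewrite -(@ler_pXn2r _ 2)// ?nnegrE ?addr_ge0 ?enorm_ge0//.
rewrite sqr_enorm dotp_addtr ![dotp (addt _ _) _]dotpC !dotp_addtr sqrrD !sqr_enorm.
rewrite [dotp y x]dotpC mulr2n.
have := le_trans (ler_norm _) (dotp_cauchy x y); lra.
Qed.

(** With m = ln (1 + |x|) one has |x + eta| <= e^(l + m), and l >= 1 gives l + m <= l (1 + m) <= l
    e^m. The last factor e^m is the extra 1 in the exponent 2s + 1. *)
Lemma log_weight_translate_le (l : R) (eta x : Rn) : 1 <= l -> enorm eta <= expR l ->
  log_weight s (addt x eta) <= expR (2 * s * l) * l * (1 + enorm x) `^ (2 * s + 1).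
Proof.
move=> l1 etal; set r := enorm (addt x eta).
have r1 : r <= expR l * (1 + enorm x).
  apply: (le_trans (enorm_addt_le _ _)); rewrite mulrDr mulr1 addrC; apply: lerD => //.
  rewrite ler_peMl ?enorm_ge0// -[leLHS]expR0 ler_expR; exact: le_trans l1.
have l0 : 0 <= l by exact: le_trans l1.
have x1 : 1 <= 1 + enorm x by rewrite lerDl enorm_ge0.
have x0 : 0 < 1 + enorm x by exact: lt_le_trans x1.
set m := ln (1 + enorm x); have m0 : 0 <= m by exact: ln_ge0.
have xm : 1 + enorm x = expR m by rewrite lnK.
have R0 : 0 <= expR (2 * s * l) * l * (1 + enorm x) `^ (2 * s + 1).
  by rewrite mulr_ge0 ?powR_ge0// mulr_ge0 ?expR_ge0.
rewrite /log_weight -/r; have [L0|L0] := leP (ln r) 0; first by rewrite mulr0.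
have r0 : 0 < r by rewrite ltNge; apply/negP => r0; rewrite ln0 ?ltxx in L0.
have rl : ln r <= l + m.
  by rewrite -(expRK (l + m)) expRD -xm ler_ln ?posrE// mulr_gt0 ?expR_gt0.
rewrite !powR_expR// -/m.
apply: (@le_trans _ _ (expR (2 * s * (l + m)) * (l * expR m))).
  apply: ler_pM => //; [exact: ltW| |].
    by rewrite ler_expR ler_wpM2l// mulr_ge0// ltW.
  apply: (le_trans rl); apply: (@le_trans _ _ (l * (1 + m))).
    by rewrite mulrDr mulr1 lerD2l ler_peMl.
  by rewrite ler_wpM2l// expR_ge1Dx.
have -> : 2 * s * (l + m) = 2 * s * l + 2 * s * m by ring.
have -> : (2 * s + 1) * m = 2 * s * m + m by ring.
rewrite !expRD le_eqVlt; apply/orP; left; apply/eqP; ring.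
Qed.

End profile_moment.

(** * A function in the energy space but not in the spectral space *)

Section strictness.
Context {R : realType} (n : nat) (s : R).
Hypothesis hs : 0 < s < 1.
Hypothesis n0 : (0 < n)%N.
Local Notation leb := (@lebesgue_tuple R n).
Local Notation Rn := (n.-tuple R).
Local Notation G := (@prodt R n laplace_hat).
Local Notation w2 u xi := (Normc.normc (fourier u xi) ^+ 2).

Let s0 : 0 < s. Proof. by case/andP: hs. Qed.
Let s1 : s < 1. Proof. by case/andP: hs. Qed.

Lemma subtE (x y : Rn) : subt x y = addt x (scalet (- 1) y).
Proof. by apply: eq_from_tnth => i; rewrite !tnth_mktuple mulN1r. Qed.

Lemma addtE (x y : Rn) : addt x y = subt x (scalet (- 1) y).
Proof. by apply: eq_from_tnth => i; rewrite !tnth_mktuple mulN1r opprK. Qed.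

Lemma measurable_subt (h : Rn) : measurable_fun setT (fun x : Rn => subt x h).
Proof. by under eq_fun do rewrite subtE; exact: measurable_addt. Qed.

(** [l k] is ln N_k. As b_k^2 N_k^(2s) = 64^-k, one factor [l k] leaves 4^-k up to a constant, small
    enough to absorb the weight 2^(k+1) of Cauchy-Schwarz, while [l k ^+ 2] leaves 4^k. The factor 2
    ensures [l k >= 2], used in the lower bound of the spectral weight. *)
Let l (k : nat) : R := 2 * 16 ^+ k.

Let l2 k : 2 <= l k.
Proof. by rewrite /l ler_peMr// exprn_ege1// ler1n. Qed.

Let b (k : nat) : R := expR (- (s * l k)) * 8^-1 ^+ k.

Let b0 k : 0 <= b k.
Proof. by rewrite mulr_ge0 ?expR_ge0// exprn_ge0. Qed.

Let b1 k : b k <= 2^-1 ^+ k.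
Proof.
rewrite /b -[leRHS]mul1r; apply: ler_pM; rewrite ?expR_ge0 ?exprn_ge0//.
  rewrite -[leRHS]expR0 ler_expR oppr_le0 mulr_ge0 ?(ltW s0)//.
  by rewrite (le_trans _ (l2 k)).
by rewrite lerXn2r ?nnegrE ?invr_ge0// lef_pV2 ?posrE// ler_nat.
Qed.

Let sqr_b k : b k ^+ 2 * expR (2 * s * l k) = 64^-1 ^+ k.
Proof.
transitivity (expR (- (s * l k)) ^+ 2 * expR (2 * s * l k) * (8^-1 ^+ k) ^+ 2).
  by rewrite /b; ring.
rewrite -expRM_natl -expRD.
rewrite (_ : _ + _ = 0); last by ring.
rewrite expR0 mul1r -exprM mulnC exprM; congr (_ ^+ _).
by rewrite expr2; field.
Qed.

Let i0 : 'I_n := Ordinal n0.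

Let eta (k : nat) : Rn := [tuple if i == i0 then expR (l k) else 0 | i < n].

Let enorm_eta k : enorm (eta k) = expR (l k).
Proof.
rewrite /enorm /dotp (bigD1 i0)//= big1 ?addr0 => [|i ii0]; last first.
  by rewrite !tnth_mktuple (negbTE ii0) mul0r.
by rewrite !tnth_mktuple eqxx -expr2 sqrtr_sqr ger0_norm// expR_ge0.
Qed.

Let u := cosine_series b eta.

Let L2u : L2 n u. Proof. exact: L2_cosine_series. Qed.

Let intu : leb.-integrable setT (EFin \o u).
Proof. exact: integrable_cosine_series. Qed.

Let c : R := @fourier_cst R n.

Let c0 : 0 < c.
Proof. by rewrite powR_gt0// mulr_gt0// pi_gt0. Qed.

Let integral_weight (w : Rn -> R) : measurable_fun setT w -> (forall xi, 0 <= w xi) ->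
  (\int[leb]_xi (w xi * w2 u xi)%:E =
   \int[leb]_xi (w xi * (c ^+ 2 * cosint u xi ^+ 2))%:E)%E.
Proof.
move=> mw w0; rewrite (fourier_L1 L2u)//; apply: eq_integral => xi _.
rewrite /hatre /hatim sinint_cosine_series//.
by rewrite mulr0 oppr0 expr0n/= addr0 exprMn.
Qed.

Let M : R := fine (\int[leb]_x ((1 + enorm x) `^ (2 * s + 1) * G x ^+ 2)%:E)%E.

Let mG : measurable_fun setT G.
Proof. by apply: measurable_prodt; exact: measurable_laplace_hat. Qed.

Let integral_translated_profile_le k (h : Rn) : enorm h = expR (l k) ->
  (\int[leb]_xi (log_weight s xi * G (subt xi h) ^+ 2)%:E <=
   (expR (2 * s * l k) * l k * M)%:E)%E.
Proof.
move=> hk.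
have mW := @measurable_log_weight R n s.
have ms := measurable_subt h.
pose f xi := (log_weight s xi * G (subt xi h) ^+ 2)%:E.
have mf : measurable_fun setT f.
  apply/measurable_EFinP; apply: measurable_funM => //.
  by apply: measurable_funX; apply: (measurableT_comp mG).
have f0 xi : (0 <= f xi)%E by rewrite lee_fin mulr_ge0 ?sqr_ge0// log_weight_ge0.
have A0 : 0 <= expR (2 * s * l k) * l k.
  by rewrite mulr_ge0 ?expR_ge0// (le_trans _ (l2 k)).
pose p (x : Rn) := ((1 + enorm x) `^ (2 * s + 1) * G x ^+ 2)%:E.
have mp : measurable_fun setT p.
  apply/measurable_EFinP; apply: measurable_funM; last exact: measurable_funX.
  apply: (measurableT_comp (@measurable_powR R _)).
  by apply: measurable_funD => //; exact: measurable_enorm.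
have p0 x : (0 <= p x)%E by rewrite lee_fin mulr_ge0 ?powR_ge0 ?sqr_ge0.
have Mfin : (\int[leb]_x p x)%E \is a fin_num.
  by rewrite ge0_fin_numE ?integral_moment_lty//; exact: integral_ge0.
rewrite -[X in (X <= _)%E](ge0_integral_translate h mf f0).
rewrite EFinM /M fineK// -ge0_integralZl_EFin//.
apply: ge0_le_integralT.
- by apply: (measurableT_comp mf); exact: measurable_addt.
- exact: measurable_funeM.
- by move=> x; exact: f0.
- move=> x; rewrite /f subt_addtK -EFinM lee_fin [leRHS]mulrA; apply: ler_wpM2r; first exact: sqr_ge0.
  apply: log_weight_translate_le => //; last by rewrite hk.
  by rewrite (le_trans _ (l2 k))// ler1n.
- by move=> x _; exact: p0.
Qed.

Let a k xi := @cosine_series_hat R n b eta k xi.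

Let ma k : measurable_fun setT (a k).
Proof.
apply: measurable_funM => //; apply: measurable_funD; apply: (measurableT_comp mG).
  exact: measurable_addt.
exact: measurable_subt.
Qed.

(** Each bump is translated to the origin, which costs N_k^(2s) l_k times the moment [M]. Then
    2^(k+1) from Cauchy-Schwarz, 64^-k from b_k^2 N_k^(2s) and l_k = 2 . 16^k multiply to 4 .
    2^-k. *)
Let integral_term_le k :
  (\int[leb]_xi (log_weight s xi * (2 ^+ k.+1 * a k xi ^+ 2))%:E <=
   (4 * M * 2^-1 ^+ k)%:E)%E.
Proof.
have mW := @measurable_log_weight R n s.
pose h := scalet (- 1) (eta k).
have hE : enorm h = expR (l k).
  rewrite -enorm_eta; congr Num.sqrt.
  by rewrite dotp_scalet dotpC dotp_scalet; ring.
pose f1 xi := (log_weight s xi * G (subt xi h) ^+ 2)%:E.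
pose f2 xi := (log_weight s xi * G (subt xi (eta k)) ^+ 2)%:E.
have mf h' : measurable_fun setT (fun xi => (log_weight s xi * G (subt xi h') ^+ 2)%:E).
  apply/measurable_EFinP; apply: measurable_funM => //; apply: measurable_funX.
  by apply: (measurableT_comp mG); exact: measurable_subt.
have f0 h' xi : (0 <= (log_weight s xi * G (subt xi h') ^+ 2)%:E)%E.
  by rewrite lee_fin mulr_ge0 ?sqr_ge0// log_weight_ge0.
pose q : R := 2 ^+ k * b k ^+ 2.
have q0 : 0 <= q by rewrite mulr_ge0 ?sqr_ge0// exprn_ge0.
apply: (@le_trans _ _ (\int[leb]_xi (q%:E * (f1 xi + f2 xi)))%E).
  apply: ge0_le_integralT.
  - apply/measurable_EFinP; apply: measurable_funM => //; apply: measurable_funM => //.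
    exact: measurable_funX.
  - by apply: measurable_funeM; apply: emeasurable_funD; exact: mf.
  - move=> xi; rewrite lee_fin mulr_ge0 ?log_weight_ge0//.
    by rewrite mulr_ge0 ?sqr_ge0// exprn_ge0.
  - move=> xi; rewrite /f1 /f2 -EFinD -EFinM lee_fin.
    rewrite -mulrDr [leRHS]mulrCA; apply: ler_wpM2l; first exact: log_weight_ge0.
    rewrite /a /cosine_series_hat addtE -/h exprS /q.
    set A := G _; set B := G _.
    have -> : 2 * 2 ^+ k * (b k / 2 * (A + B)) ^+ 2 =
        2 ^+ k * b k ^+ 2 * ((A + B) ^+ 2 / 2) by field.
    by rewrite ler_wpM2l//; have := sqr_ge0 (A - B); nra.
rewrite ge0_integralZl_EFin//; last 2 first.
- by move=> xi _; rewrite adde_ge0//; exact: f0.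
- by apply: emeasurable_funD; exact: mf.
rewrite ge0_integralD//; last 4 first.
- by move=> xi _; exact: f0.
- exact: mf.
- by move=> xi _; exact: f0.
- exact: mf.
apply: (@le_trans _ _ (q%:E * ((expR (2 * s * l k) * l k * M)%:E + (expR (2 * s * l k) * l k * M)%:E))%E).
  apply: lee_wpmul2l; first by rewrite lee_fin.
  by apply: leeD; apply: integral_translated_profile_le.
rewrite -EFinD -EFinM lee_fin /q le_eqVlt; apply/orP; left; apply/eqP.
transitivity (2 * 2 ^+ k * (b k ^+ 2 * expR (2 * s * l k)) * l k * M); first by ring.
rewrite sqr_b /l.
have -> : 64^-1 ^+ k = 2^-1 ^+ k * 2^-1 ^+ k * 16^-1 ^+ k :> R.
  by rewrite -!exprMn; congr (_ ^+ _); field.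
have e2 : (2 : R) ^+ k != 0 by rewrite expf_neq0.
have e16 : (16 : R) ^+ k != 0 by rewrite expf_neq0.
by rewrite !exprVn; field; rewrite e2 e16.
Qed.

Let energy_u : energy_space n s u.
Proof.
split; first exact: L2u.
apply/(energy_lty hs n0 L2u); rewrite /log_energy.
have mW := @measurable_log_weight R n s.
have W0 xi := @log_weight_ge0 R n s xi.
rewrite integral_weight//.
pose t k xi := (log_weight s xi * (2 ^+ k.+1 * a k xi ^+ 2))%:E.
have mt k : measurable_fun setT (t k).
  apply/measurable_EFinP; apply: measurable_funM => //; apply: measurable_funM => //.
  exact: measurable_funX.
have t0 k xi : (0 <= t k xi)%E.
  by rewrite lee_fin mulr_ge0// mulr_ge0 ?sqr_ge0// exprn_ge0.
have c20 : 0 <= c ^+ 2 by exact: sqr_ge0.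
have mS : measurable_fun setT (fun xi => \sum_(0 <= k <oo) t k xi)%E.
  by apply: ge0_emeasurable_sum => //.
have M0 : 0 <= M.
  apply: fine_ge0; apply: integral_ge0 => x _.
  by rewrite lee_fin mulr_ge0 ?powR_ge0// sqr_ge0.
apply: (@le_lt_trans _ _ (\int[leb]_xi ((c ^+ 2)%:E * \sum_(0 <= k <oo) t k xi))%E).
  apply: ge0_le_integralT.
  - apply/measurable_EFinP; apply: measurable_funM => //; apply: measurable_funM => //.
    by apply: measurable_funX; exact: measurable_cosint.
  - exact: measurable_funeM.
  - by move=> xi; rewrite lee_fin mulr_ge0// mulr_ge0// sqr_ge0.
  - move=> xi; rewrite mulrCA EFinM; apply: lee_wpmul2l; first by rewrite lee_fin.
    apply: (@le_trans _ _ ((log_weight s xi)%:E *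
        \sum_(0 <= k <oo) (2 ^+ k.+1 * a k xi ^+ 2)%:E)%E).
      rewrite [(log_weight s xi * _)%:E]EFinM; apply: lee_wpmul2l; first by rewrite lee_fin.
      exact: cosint_cosine_series_sqr_le.
    rewrite -nneseriesZl//; first by move=> k _; rewrite lee_fin mulr_ge0 ?sqr_ge0// exprn_ge0.
rewrite ge0_integralZl_EFin//; last first.
  by move=> xi _; apply: nneseries_ge0 => k _ _; exact: t0.
apply: lte_mul_pinfty => //.
rewrite integral_nneseries//.
apply: (@le_lt_trans _ _ (\sum_(0 <= k <oo) (4 * M * 2^-1 ^+ k)%:E)%E).
  apply: lee_nneseries => k _; first by move=> _; apply: integral_ge0.
  exact: integral_term_le.
apply: (@le_lt_trans _ _ (4 * M * 2)%:E); last exact: ltry.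
apply: nneseries_le_bound => [k|m].
  by rewrite mulr_ge0 ?mulr_ge0// exprn_ge0.
by rewrite -mulr_sumr ler_wpM2l ?mulr_ge0// sum_half_le2.
Qed.

(** Only the cube of half-side 1 around [eta k] is kept; its volume is at least 1. There the
    transform is at least b_k / 2 times the Fourier constant, and |xi| >= e^(l_k - 1). Hence
    |xi|^(2s) >= e^(-2) N_k^(2s), as s < 1, and ln |xi|^2 >= 2 (l_k - 1) >= l_k. *)
Let spectral_u_ge k : ((expR (- 2) * c ^+ 2 * 4 ^+ k)%:E <= spectral_form s u)%E.
Proof.
have mS := @measurable_spectral_weight R n s.
have S0 xi := @spectral_weight_ge0 R n s xi.
have lk := l2 k; have lk0 : 0 <= l k by exact: le_trans lk.
rewrite spectral_formE// integral_weight//.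
pose D : R := expR (- 2) * c ^+ 2 * 4 ^+ k.
have D0 : 0 <= D by rewrite mulr_ge0 ?exprn_ge0// mulr_ge0 ?expR_ge0// sqr_ge0.
have DE : expR (- 2) * expR (2 * s * l k) * l k ^+ 2 * (c ^+ 2 * (b k / 2) ^+ 2) = D.
  transitivity (expR (- 2) * c ^+ 2 * (b k ^+ 2 * expR (2 * s * l k)) * (l k / 2) ^+ 2).
    by field.
  rewrite sqr_b /D -mulrA; congr (_ * _).
  have -> : l k / 2 = 16 ^+ k by rewrite /l mulrC mulKf.
  have -> : (16 ^+ k) ^+ 2 = 64 ^+ k * 4 ^+ k :> R.
    by rewrite -exprM mulnC exprM -exprMn; congr (_ ^+ _); rewrite expr2; ring.
  by rewrite mulrA -exprMn mulVf// expr1n mul1r.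
pose f (xi : Rn) := (D * box 1 xi)%:E.
have mf : measurable_fun setT f.
  by apply/measurable_EFinP; apply: measurable_funM => //; exact: measurable_box.
have f0 xi : (0 <= f xi)%E by rewrite lee_fin mulr_ge0// box_ge0.
apply: (@le_trans _ _ (\int[leb]_xi f (subt xi (eta k)))%E).
  under eq_integral do rewrite subtE.
  rewrite ge0_integral_translate// /f.
  under eq_integral do rewrite EFinM.
  rewrite ge0_integralZl_EFin//; last 2 first.
  - by move=> xi _; rewrite lee_fin box_ge0.
  - by apply/measurable_EFinP; exact: measurable_box.
  rewrite integral_box// -EFinM lee_fin ler_peMr// mulr1.
  by rewrite exprn_ege1// ler1n.
apply: ge0_le_integralT.
- by apply: (measurableT_comp mf); exact: measurable_subt.
- apply/measurable_EFinP; apply: measurable_funM => //; apply: measurable_funM => //.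
  by apply: measurable_funX; exact: measurable_cosint.
- by move=> xi; exact: f0.
move=> xi; set v := spectral_weight _ _ * _.
have v0 : 0 <= v by rewrite mulr_ge0// mulr_ge0// sqr_ge0.
rewrite lee_fin; have [xb|] := boolP [forall i, `|tnth (subt xi (eta k)) i| <= 1]; last first.
  move=> nb; apply: (@le_trans _ _ (D * 0)); last by rewrite mulr0.
  rewrite ler_wpM2l//; apply: box_le => // H; exfalso; move: nb; apply/negP.
  by rewrite negbK; apply/forallP.
move/forallP in xb.
apply: (@le_trans _ _ D).
  by rewrite ler_piMr//; apply: box_le => // _.
have bk2 : b k / 2 <= cosint u xi.
  apply: (le_trans _ (@cosine_series_hat_le R n b eta b0 b1 k xi)).
  rewrite /cosine_series_hat -[leLHS]mulr1 ler_wpM2l ?divr_ge0//.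
  (* Each coordinate t of the difference has |t| <= 1, where 2 / (1 + t^2) >= 1. *)
  have G1 : 1 <= G (subt xi (eta k)).
    rewrite /prodt; apply: (big_ind (fun y : R => 1 <= y)) => //.
      by move=> x y; exact: mulr_ege1.
    move=> i _; rewrite /laplace_hat ler_pdivlMr; last by rewrite ltr_wpDr// sqr_ge0.
    have : tnth (subt xi (eta k)) i ^+ 2 <= 1.
      by rewrite -real_normK ?num_real// expr_le1.
    by rewrite mul1r; lra.
  by apply: (le_trans G1); rewrite lerDr prodt_ge0// => t; exact: laplace_hat_ge0.
rewrite -DE /v; apply: ler_pM.
- by rewrite mulr_ge0 ?sqr_ge0// mulr_ge0// expR_ge0.
- by rewrite mulr_ge0 ?sqr_ge0.
(* The first coordinate is at least e^l - 1, and e^l - 1 >= e^(l-1) because e >= 2 and e^(l-1) >=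
   1. *)
- have rx : expR (l k - 1) <= enorm xi.
    apply: le_trans (tnth_le_enorm xi i0); apply: le_trans (ler_norm _).
    have := xb i0; rewrite tnth_mktuple [tnth (eta k) _]tnth_mktuple eqxx ler_norml => /andP[x1 _].
    have e1 : 2 <= expR 1 :> R by have := expR_ge1Dx (1 : R); lra.
    have E1 : expR (l k) = expR (l k - 1) * expR 1 by rewrite -expRD subrK.
    have E2 : 1 <= expR (l k - 1) by rewrite -[leLHS]expR0 ler_expR; lra.
    by rewrite E1 in x1; nra.
  have r0 : 0 < enorm xi by apply: lt_le_trans rx; exact: expR_gt0.
  have lr : l k - 1 <= ln (enorm xi) by rewrite -[leLHS]expRK ler_ln ?posrE ?expR_gt0.
  rewrite /spectral_weight; apply: ler_pM; rewrite ?sqr_ge0//.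
  + rewrite powR_expR// -expRD ler_expR.
    have : 2 * s * (l k - 1) <= 2 * s * ln (enorm xi) by rewrite ler_wpM2l// mulr_ge0// ltW.
    have := s1; lra.
  + by rewrite lnXn// ler_pXn2r ?nnegrE//; [lra|lra].
- rewrite ler_wpM2l ?sqr_ge0// ler_pXn2r ?nnegrE ?divr_ge0//.
  by apply: le_trans bk2; rewrite divr_ge0.
Qed.

Lemma energy_space_not_spectral : ~ (energy_space n s `<=` spectral_space n s).
Proof.
move=> /(_ u energy_u)[_ Su].
have S0 : (0 <= spectral_form s u)%E.
  by apply: integral_ge0 => x _; rewrite lee_fin mulr_ge0 ?powR_ge0// sqr_ge0.
have Sfin : spectral_form s u \is a fin_num by rewrite ge0_fin_numE.
pose e := expR (- 2) * c ^+ 2.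
have e0 : 0 < e by rewrite mulr_gt0 ?expR_gt0// exprn_gt0.
(* Any index above this ratio gives a contradiction, since 4^k > k. *)
pose k := (Num.truncn (fine (spectral_form s u) / e)).+1.
have kS : fine (spectral_form s u) / e < k%:R by rewrite truncnS_gt.
have := spectral_u_ge k; rewrite -(fineK Sfin) lee_fin leNgt => /negP; apply.
rewrite ltr_pdivrMr// in kS; apply: (lt_le_trans kS).
by rewrite mulrC ler_wpM2l ?ltW// -natrX ltr_nat ltn_expl.
Qed.

End strictness.

Theorem proposition1p3 (R : realType) (n : nat) (s : R)
    (hn : (1 <= n)%N) (hs : 0 < s < 1) :
  [/\ continuous_embedding (spectral_space n s) (spectral_norm s)
        (energy_space n s) (energy_norm s),
      ~ (energy_space n s `<=` spectral_space n s) &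
      energy_space n s =
        [set u : n.-tuple R -> R | L2 n u /\
          (\int[lebesgue_tuple n]_xi
             (enorm xi `^ (2 * s) * ln (enorm xi ^+ 2)
                * Normc.normc (fourier u xi) ^+ 2)%:E < +oo)%E]].

Proof.
split.
- exact: spectral_embedding.
- exact: energy_space_not_spectral.
- exact: energy_spaceE.
Qed.
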